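(* Let $1\le p<+\infty$ and consider a network with $n$ vertices and $m$ edges with associated matrices $\Psi$, $\mathbb A$, $\mathbb B$, and let $v=v_i$ be the control vertex, represented by the $i$-th canonical basis vector of $\mathbb C^n$. The exact positive reachability space of the controlled transport problem in the network $$\dot x(t,s)=x'(t,s)\ (s\in[0,1],\,t\ge0),\qquad x(t,1)=\mathbb B\,x(t,0)+u(t)\cdot\Psi v\ (t\ge0),\qquad x(0,s)=0\ (s\in[0,1])$$ is given by $$e^+\mathcal R^{\mathrm{BC}}=L^p([0,1],\mathbb R_+)\otimes\operatorname{co}\{\mathbb B^k\Psi v:k\in\{0,1,2,\dots\}\}=L^p([0,1],\mathbb R_+)\otimes\Psi\operatorname{co}\{\mathbb A^kv:k\in\{0,1,2,\dots\}\}.$$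
   Context: Network. A finite directed network has vertices $v_1,\dots,v_n$ and edges $e_1,\dots,e_m$. If edge $e_i$ starts at vertex $v_j$ it carries a weight $w_{ij}\in[0,1]$. The transposed weighted outgoing incidence matrix $\Psi\in \mathrm M_{m\times n}(\mathbb C)$ is $\Psi_{ij}:=w_{ij}$ if $e_i$ starts at $v_j$ and $0$ otherwise; it is assumed column stochastic (the weights of the edges leaving any given vertex sum to $1$). The transposed weighted adjacency matrix $\mathbb A\in \mathrm M_n(\mathbb C)$ has entry $\mathbb A_{ij}$ equal to the weight $w_{kj}$ of the edge $e_k$ leading from $v_j$ to $v_i$ (the sum of such weights if there are several), and $0$ if there is none. The transposed weighted adjacency matrix of the line graph $\mathbb B\in \mathrm M_m(\mathbb C)$ is $\mathbb B_{ij}:=w_{ik}$ if $e_j$ ends at a vertex $v_k$ at which $e_i$ starts, and $0$ otherwise. In particular $\Psi\mathbb A=\mathbb B\Psi$. Control system. The problem is the abstract boundary control system $\dot x=A_mx$, $Qx=Bu$, $x(0)=0$ with: $X:=L^p([0,1],\mathbb C^m)$; $U:=\mathbb C$ with $U^+:=\mathbb R_+$; $A_m:=\operatorname{diag}(\frac d{ds})_{m\times m}$ with $D(A_m):=\{f\in W^{1,p}([0,1],\mathbb C^m):f(1)\in\operatorname{rg}\Psi\}$; boundary space $\partial X:=\operatorname{rg}\Psi\subseteq\mathbb C^m$; $Q:D(A_m)\to\partial X$, $Qf:=f(1)-\mathbb Bf(0)$; $B:=\Psi v$, viewed in $\mathcal L(\mathbb C,\partial X)$; $A\subset A_m$ with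 $D(A)=\ker Q$. $A$ generates a strongly continuous semigroup $(T(t))_{t\ge0}$ on $X$. For $\lambda\in\rho(A)$, $Q_\lambda:=(Q|_{\ker(\lambda-A_m)})^{-1}:\partial X\to\ker(\lambda-A_m)\subseteq X$ exists and is bounded, and $B_\lambda:=Q_\lambda B$. $B$ is $p$-boundary admissible, i.e. $\int_0^tT(t-s)B_\lambda u(s)\,ds\in D(A)$ for all $u\in L^p([0,t],U)$, and the controllability map is $\mathcal B_t^{\mathrm{BC}}u:=(\lambda-A)\int_0^tT(t-s)B_\lambda u(s)\,ds$ (independent of $\lambda\in\rho(A)$). $e^+\mathcal R^{\mathrm{BC}}:=\bigcup_{t\ge0}\{\mathcal B_t^{\mathrm{BC}}u:u\in L^p([0,t],U^+)\}$. $\operatorname{co}S$ is the convex hull of $S$. For $f\in L^p[0,1]$, $d\in\mathbb C^m$, $(f\otimes d)(s):=f(s)d$; for a set $C\subseteq\mathbb R_+^m$, $L^p([0,1],\mathbb R_+)\otimes C$ is the set of finite sums of elements $f\otimes c$ with $f\in L^p([0,1],\mathbb R_+)$, $c\in C$. *)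

(* Defs.v *)
From HB Require Import structures.
From mathcomp Require Import all_boot all_order all_algebra.
From mathcomp Require Import ring_quotient ring.
From mathcomp Require Import all_classical all_reals all_analysis.
From mathcomp Require Import measurable_realfun.
From mathcomp Require Import complex.

Set Implicit Arguments.
Unset Strict Implicit.
Unset Printing Implicit Defensive.
Import Order.TTheory GRing.Theory Num.Theory.
Import numFieldNormedType.Exports.
Import Quotient.
Local Open Scope classical_set_scope.
Local Open Scope ring_scope.
Local Open Scope complex_scope.
Local Open Scope quotient_scope.

(* R[i] as a normed space over itself; this also gives 'cV[R[i]]_m its usual
   topology. *)
HB.instance Definition _ (R : realType) := NormedModule.copy R[i] R[i]^o.



Notation Rec := complex.Re.
Notation Imc := complex.Im.

(* L^p(mu; C^m) for 1 <= p < +oo: functions whose coordinates have real and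
   imaginary parts in L^p, modulo equality mu-almost everywhere, with the norm
   (\int |f|^p)^(1/p), where |c| = \sum_i |c_i| on C^m.  As for LfunType, the
   proof of 1 <= p is kept in the type so that the structures can be inferred. *)
Section VectorLp.
Context d (T : measurableType d) (R : realType).
Variables (mu : {measure set T -> \bar R}) (p : R) (m : nat).

Definition vLp of 1 <= p : {pred T -> 'cV[R[i]]_m} := fun f =>
  `[< forall i, (fun x => Rec (f x i 0)) \in Lfun mu p%:E /\
                (fun x => Imc (f x i 0)) \in Lfun mu p%:E >].

Hypothesis p1 : 1 <= p.

Let p1E : (1 <= p%:E)%E. Proof. by rewrite lee_fin. Qed.

Let Lp0 : (0 : T -> R) \in Lfun mu p%:E.
Proof. exact: (Lfun_submod_closed mu p1E).1. Qed.

Let LpD (f g : T -> R) : f \in Lfun mu p%:E -> g \in Lfun mu p%:E ->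
  (fun x => f x + g x) \in Lfun mu p%:E.
Proof.
by move=> fL gL; have := (Lfun_submod_closed mu p1E).2 1 f g fL gL; rewrite scale1r.
Qed.

Let LpZ (a : R) (f : T -> R) : f \in Lfun mu p%:E ->
  (fun x => a * f x) \in Lfun mu p%:E.
Proof.
by move=> fL; have := (Lfun_submod_closed mu p1E).2 a f 0 fL Lp0; rewrite addr0.
Qed.

Let ReM (a b : R[i]) : Rec (a * b) = Rec a * Rec b + (- Imc a) * Imc b.
Proof. by case: a b => [? ?] [? ?] /=; ring. Qed.

Let ImM (a b : R[i]) : Imc (a * b) = Rec a * Imc b + Imc a * Rec b.
Proof. by case: a b => [? ?] [? ?] /=; ring. Qed.

Let ReD (a b : R[i]) : Rec (a + b) = Rec a + Rec b.
Proof. by case: a b => [? ?] [? ?]. Qed.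

Let ImD (a b : R[i]) : Imc (a + b) = Imc a + Imc b.
Proof. by case: a b => [? ?] [? ?]. Qed.

Lemma vLp_submod_closed : submod_closed (vLp p1).
Proof.
split.
  by apply/asboolP => i; split; rewrite [X in X \in _](_ : _ = 0)//;
    apply/funext => x; rewrite mxE.
move=> a f g /asboolP fL /asboolP gL; apply/asboolP => i.
have [fR fI] := fL i; have [gR gI] := gL i; split.
- under eq_fun do rewrite !mxE ReD ReM.
  by apply: LpD => //; apply: LpD; apply: LpZ.
- under eq_fun do rewrite !mxE ImD ImM.
  by apply: LpD => //; apply: LpD; apply: LpZ.
Qed.

HB.instance Definition _ := GRing.isSubmodClosed.Build _ _ (vLp p1)
  vLp_submod_closed.

Record vLfun := VLfun { vLfun_fun :> T -> 'cV[R[i]]_m; _ : vLfun_fun \in vLp p1 }.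

HB.instance Definition _ := [isSub for vLfun_fun].
HB.instance Definition _ := [Choice of vLfun by <:].
HB.instance Definition _ := [SubChoice_isSubLmodule of vLfun by <:].

Definition vnull : {pred vLfun} := fun f => `[< f = cst 0 %[ae mu] >].

Lemma vnull_zmod_closed : zmod_closed vnull.
Proof.
split; first by apply/asboolP; apply: aeW.
move=> f g /asboolP f0 /asboolP g0; apply/asboolP.
move: f0 g0; apply: filterS2 => x fx gx _.
rewrite [LHS]/(f x - g x) (fx I) (gx I) /cst; exact: subrr.
Qed.

HB.instance Definition _ := GRing.isZmodClosed.Build _ vnull vnull_zmod_closed.

Definition vLspace : Type := quot vnull.
HB.instance Definition _ := GRing.Zmodule.on vLspace.
HB.instance Definition _ := EqQuotient.on vLspace.

Definition vLclass (f : vLfun) : vLspace := \pi f.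
(* a representative of a class, determined up to a null set *)
Definition vLspace_fun (x : vLspace) : T -> 'cV[R[i]]_m := repr x.

Lemma vLclassP (f g : vLfun) :
  vLclass f = vLclass g <-> ae_eq mu setT (f : T -> 'cV[R[i]]_m) g.
Proof.
split=> [/eqP|fg].
  rewrite /vLclass -idealrBE => /asboolP; apply: filterS => x /(_ I) h _.
  by apply/eqP; rewrite -subr_eq0; apply/eqP; exact: h.
apply/eqP; rewrite /vLclass -idealrBE; apply/asboolP.
move: fg; apply: filterS => x /(_ I) h _.
by rewrite [LHS]/(f x - g x) h; exact: subrr.
Qed.

Lemma vLclassK (x : vLspace) : vLclass (repr x) = x.
Proof. by rewrite /vLclass reprK. Qed.

Lemma vLspace_funE (f : vLfun) :
  ae_eq mu setT (vLspace_fun (vLclass f)) f.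
Proof. by apply/vLclassP; rewrite vLclassK. Qed.

Lemma vLclassD (f g : vLfun) : vLclass (f + g) = vLclass f + vLclass g.
Proof. exact: (@pi_add _ vnull). Qed.

Lemma vLclass0 : vLclass 0 = 0.
Proof. by apply: (addrI (vLclass 0)); rewrite -vLclassD !addr0. Qed.

Definition vLscale (a : R[i]) (x : vLspace) : vLspace := vLclass (a *: repr x).

Lemma vLscaleE a f : vLscale a (vLclass f) = vLclass (a *: f).
Proof.
apply/vLclassP; apply: filterS (vLspace_funE f) => x /(_ I) h _.
by rewrite [LHS]/(a *: vLspace_fun (vLclass f) x) h.
Qed.

Fact vLscaleA a b x : vLscale a (vLscale b x) = vLscale (a * b) x.
Proof. by rewrite -[x]vLclassK !vLscaleE scalerA. Qed.

Fact vLscale1 : left_id 1 vLscale.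
Proof. by move=> x; rewrite -[x]vLclassK !vLscaleE scale1r. Qed.

Fact vLscaleDr : right_distributive vLscale +%R.
Proof.
move=> a x y; rewrite -[x]vLclassK -[y]vLclassK -vLclassD !vLscaleE.
by rewrite scalerDr vLclassD.
Qed.

Fact vLscaleDl x : {morph vLscale^~ x : a b / a + b}.
Proof.
by move=> a b /=; rewrite -[x]vLclassK !vLscaleE scalerDl vLclassD.
Qed.

HB.instance Definition _ := GRing.Zmodule_isLmodule.Build R[i] vLspace
  vLscaleA vLscale1 vLscaleDr vLscaleDl.

Definition vnorm (c : 'cV[R[i]]_m) : R := \sum_i Rec `|c i 0|.

Definition vLnorm (x : vLspace) : R[i] :=
  (fine 'N[mu]_p%:E[EFin \o vnorm \o vLspace_fun x]%E)%:C.

Let RecnormE (z : R[i]) : Rec `|z| = Num.sqrt (Rec z ^+ 2 + Imc z ^+ 2).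
Proof. by rewrite normc_def. Qed.

Let Recnorm_ge0 (z : R[i]) : 0 <= Rec `|z|.
Proof. by rewrite RecnormE sqrtr_ge0. Qed.

Let Recnormc (z : R[i]) : (Rec `|z|)%:C = `|z|.
Proof. by rewrite normc_def. Qed.

Lemma vnorm_ge0 c : 0 <= vnorm c.
Proof. by apply: sumr_ge0 => i _. Qed.

Lemma vnormD c1 c2 : vnorm (c1 + c2) <= vnorm c1 + vnorm c2.
Proof.
rewrite /vnorm -big_split; apply: ler_sum => i _ /=.
by rewrite mxE -lecR rmorphD /= !Recnormc ler_normD.
Qed.

Lemma vnormZ a c : vnorm (a *: c) = Rec `|a| * vnorm c.
Proof.
rewrite /vnorm mulr_sumr; apply: eq_bigr => i _; rewrite mxE.
by apply: complexI; rewrite rmorphM /= !Recnormc normrM.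
Qed.

Lemma vnorm_eq0 c : vnorm c = 0 -> c = 0.
Proof.
move=> /eqP; rewrite psumr_eq0// => /allP h; apply/matrixP => i j.
rewrite ord1 mxE; apply/eqP; rewrite -normr_eq0 -Recnormc.
by rewrite (eqP (h i (mem_index_enum _))).
Qed.

Lemma vnorm_measurable (f : vLfun) : measurable_fun setT (vnorm \o f).
Proof.
have /asboolP fL : vLfun_fun f \in vLp p1 by case: f.
apply: measurable_sum => i; have [fR fI] := fL i.
have mR : measurable_fun setT (fun x => Rec (f x i 0)).
  by move: fR => /sub_Lfun_mfun; rewrite inE.
have mI : measurable_fun setT (fun x => Imc (f x i 0)).
  by move: fI => /sub_Lfun_mfun; rewrite inE.
under eq_fun do rewrite RecnormE.
apply: (@measurableT_comp _ _ _ _ _ _ (@Num.sqrt R)).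
  by apply: continuous_measurable_fun; exact: sqrt_continuous.
by apply: measurable_funD; exact: measurable_funX.
Qed.

Let mpowR (f : T -> R) :
  measurable_fun setT f -> measurable_fun setT (fun x => (`|f x| `^ p)%R).
Proof.
move=> mf; apply: (@measurableT_comp _ _ _ _ _ _ (@powR R ^~ p)) => //.
exact: measurableT_comp.
Qed.

Let Lnorm_mono (f g : T -> R) : measurable_fun setT f -> measurable_fun setT g ->
  (forall x, 0 <= f x <= g x) ->
  ('N[mu]_p%:E[EFin \o f] <= 'N[mu]_p%:E[EFin \o g])%E.
Proof.
move=> mf mg fg; rewrite unlock /Lnorm.
have p0 : 0 <= p by rewrite (le_trans _ p1).
have mp (h : T -> R) : measurable_fun setT h ->
    measurable_fun setT (fun x => (`|(EFin \o h) x| `^ p)%E).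
  by move=> mh; apply/measurable_EFinP; exact: mpowR.
apply: gt0_ler_poweR; first by rewrite invr_ge0.
- by rewrite in_itv /= integral_ge0 ?leey// => x _; exact: poweR_ge0.
- by rewrite in_itv /= integral_ge0 ?leey// => x _; exact: poweR_ge0.
apply: ge0_le_integral => //; [|exact: mp|exact: mp|].
- by move=> x _; exact: poweR_ge0.
- move=> x _; have /andP[f0 fgx] := fg x.
  rewrite /= lee_fin ge0_ler_powR// ?nnegrE//.
  by rewrite !ger0_norm// (le_trans f0).
Qed.

Lemma vnorm_Lfun (f : vLfun) : vnorm \o f \in Lfun mu p%:E.
Proof.
have /asboolP fL : vLfun_fun f \in vLp p1 by case: f.
pose g i x := `|Rec (f x i 0)| + `|Imc (f x i 0)|.
have absL h : h \in Lfun mu p%:E -> (fun x => `|h x|) \in Lfun mu p%:E.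
  move=> /andP[]; rewrite !inE => mh nh; apply/andP; rewrite !inE; split.
    exact: measurableT_comp.
  by rewrite /= /finite_norm -[X in Lnorm _ _ X]/(abse \o (EFin \o h)) Lnorm_abse.
have gL i : g i \in Lfun mu p%:E.
  by have [? ?] := fL i; apply: LpD; exact: absL.
have GL : (fun x => \sum_i g i x) \in Lfun mu p%:E.
  rewrite (_ : (fun _ => _) = \sum_i g i).
    by apply: (@big_ind _ (fun h => h \in Lfun mu p%:E)) => // h k; exact: LpD.
  by apply/funext => x; rewrite fct_sumE.
move: (GL) => /andP[]; rewrite !inE => mG nG.
apply/andP; rewrite !inE; split; first exact: vnorm_measurable.
rewrite /= /finite_norm; apply: le_lt_trans nG.
apply: Lnorm_mono => //; first exact: vnorm_measurable.
move=> x; rewrite vnorm_ge0 /=; apply: ler_sum => i _.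
rewrite /g RecnormE; case: (f x i 0) => a b /=.
rewrite -[leRHS]ger0_norm ?addr_ge0// -sqrtr_sqr ler_wsqrtr// sqrrD.
rewrite !real_normK ?num_real// [leRHS]addrAC lerDl.
by rewrite mulrn_wge0// mulr_ge0.
Qed.

Let vLnormE (f : vLfun) :
  (fine 'N[mu]_p%:E[EFin \o vnorm \o f]%E)%:E = 'N[mu]_p%:E[EFin \o vnorm \o f]%E.
Proof.
have /andP[_] := vnorm_Lfun f; rewrite !inE /= => nf.
by rewrite fineK// ge0_fin_numE ?Lnorm_ge0.
Qed.

Let eq_ae_Lnorm (f g : vLfun) : ae_eq mu setT (f : T -> 'cV[R[i]]_m) g ->
  ('N[mu]_p%:E[EFin \o vnorm \o f] = 'N[mu]_p%:E[EFin \o vnorm \o g])%E.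
Proof.
move=> fg; rewrite unlock /Lnorm; congr (_ `^ _)%E.
have mp (h : vLfun) :
    measurable_fun setT (fun x => (`|(EFin \o vnorm \o h) x| `^ p)%E).
  by apply/measurable_EFinP; apply: mpowR; exact: vnorm_measurable.
apply: ae_eq_integral => //.
by apply: filterS fg => x h /h /= ->.
Qed.

Lemma vLnorm_class (f : vLfun) :
  vLnorm (vLclass f) = (fine 'N[mu]_p%:E[EFin \o vnorm \o f]%E)%:C.
Proof. by rewrite /vLnorm (eq_ae_Lnorm (vLspace_funE f)). Qed.

Fact vLnormD x y : vLnorm (x + y) <= vLnorm x + vLnorm y.
Proof.
rewrite -[x]vLclassK -[y]vLclassK -vLclassD !vLnorm_class.
move: (repr x) (repr y) => f g.
rewrite -rmorphD lecR -lee_fin EFinD !vLnormE.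
have mf := vnorm_measurable f; have mg := vnorm_measurable g.
apply: le_trans (minkowski_EFin mu mf mg p1).
apply: Lnorm_mono; [exact: vnorm_measurable|exact: measurable_funD|].
by move=> t; rewrite vnorm_ge0 /= vnormD.
Qed.

Fact vLnormZ a x : vLnorm (a *: x) = `|a| * vLnorm x.
Proof.
have p1E' := p1E.
rewrite -[x]vLclassK [_ *: _]vLscaleE !vLnorm_class.
move: (repr x) => f; rewrite -Recnormc -rmorphM; congr (_%:C).
apply: EFin_inj; rewrite EFinM !vLnormE.
move: (Rec _) (Recnorm_ge0 a) (vnormZ a) => r r0 aE.
pose h : LfunType mu p1E' := Lfun_Sub p1E' (vnorm_Lfun f).
rewrite -[X in (X%:E * _)%E]ger0_norm// -(LnormZ h); congr (Lnorm _ _ _).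
by apply/funext => t /=; rewrite aE.
Qed.

Fact vLnorm_eq0 x : vLnorm x = 0 -> x = 0.
Proof.
rewrite -[x]vLclassK vLnorm_class; move: (repr x) => f [].
have p1E' := p1E.
pose h : LfunType mu p1E' := Lfun_Sub p1E' (vnorm_Lfun f).
move=> /(@fine_Lnormr_eq0 _ _ _ _ _ _ h) h0.
rewrite -vLclass0.
apply/vLclassP; apply: filterS h0 => t /(_ I) ft _.
exact: vnorm_eq0.
Qed.

HB.instance Definition _ := Lmodule_isNormed.Build R[i] vLspace
  vLnormD vLnormZ vLnorm_eq0.

End VectorLp.

(* Operators that need not be everywhere defined are given by their graphs. *)
Section Semigroups.
Context (R : realType) (V : normedModType R[i]).

(* Only the values T t with 0 <= t matter. *)
Definition C0_semigroup (T : R -> V -> V) : Prop :=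
  [/\ forall t, 0 <= t -> linear (T t) /\ continuous (T t),
      forall x, T 0 x = x,
      forall s t x, 0 <= s -> 0 <= t -> T (s + t) x = T s (T t x) &
      forall x, T t x @[t --> 0^'+] --> x].

Definition generator (T : R -> V -> V) : set (V * V) :=
  [set xy : V * V | h^-1%:C *: (T h xy.1 - xy.1) @[h --> 0^'+] --> xy.2].

Definition generates (A : set (V * V)) (T : R -> V -> V) : Prop :=
  C0_semigroup T /\ generator T = A.

(* (x, l *: x - y) \in A means that x \in D(A) and (l - A) x = y. *)
Definition resolvent_set (A : set (V * V)) : set R[i] :=
  [set l | exists2 S : V -> V, linear S /\ continuous S &
     forall x y, A (x, l *: x - y) <-> x = S y].

End Semigroups.

Section Bochner.
Context d (T : measurableType d) (R : realType) (V : normedModType R[i]).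
Variable mu : {measure set T -> \bar R}.

Record simple_map := SimpleMap {
  simple_size : nat;
  simple_set : 'I_simple_size -> set T;
  simple_val : 'I_simple_size -> V;
  simple_meas : forall i, measurable (simple_set i);
  simple_fin : forall i, (mu (simple_set i) < +oo)%E }.

Definition simple_eval (S : simple_map) (x : T) : V :=
  \sum_i (\1_(@simple_set S i) x)%:C *: simple_val i.

Definition simple_integral (S : simple_map) : V :=
  \sum_i (fine (mu (@simple_set S i)))%:C *: simple_val i.

Definition bochner_integral (F : T -> V) (z : V) : Prop :=
  exists S : nat -> simple_map,
    [/\ \forall x \ae mu, simple_eval (S k) x @[k --> \oo] --> F x,
        (\int[mu]_x (Rec `|simple_eval (S k) x - F x|)%:E)%E
          @[k --> \oo] --> 0%E &
        simple_integral (S k) @[k --> \oo] --> z].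

End Bochner.

Definition convex_hull (R : realType) (V : lmodType R[i]) (S : set V) : set V :=
  [set x | exists k (a : 'I_k -> R) (c : 'I_k -> V),
     [/\ forall j, 0 <= a j, \sum_j a j = 1, forall j, S (c j) &
         x = \sum_j (a j)%:C *: c j]].

Definition leb (R : realType) (t : R) :
    {measure set (measurableTypeR R) -> \bar R} :=
  mrestr (@lebesgue_measure R) (measurable_itv `[0, t]).

Record network (R : realType) (n m : nat) := Network {
  src : 'I_m -> 'I_n;
  tgt : 'I_m -> 'I_n;
  wgt : 'I_m -> R;
  wgt01 : forall e, 0 <= wgt e <= 1;
  wgt_stochastic : forall j, \sum_(e | src e == j) wgt e = 1 }.

Section NetworkMatrices.
Context (R : realType) (n m : nat) (N : network R n m).

Definition Psi : 'M[R[i]]_(m, n) :=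
  \matrix_(e, j) if src N e == j then (wgt N e)%:C else 0.

Definition adjA : 'M[R[i]]_n :=
  \matrix_(i, j) \sum_(e | (src N e == j) && (tgt N e == i)) (wgt N e)%:C.

Definition adjB : 'M[R[i]]_m :=
  \matrix_(e, f) if tgt N f == src N e then (wgt N e)%:C else 0.

End NetworkMatrices.

Section Control.
Context (R : realType) (p : R) (p1 : 1 <= p).

Definition Lp01 (m : nat) : normedModType R[i] := vLspace (leb 1) m p1.

(* C^1 with compact support in the open interval (0, 1) *)
Definition test_function (phi : R -> R) : Prop :=
  [/\ forall s, derivable phi s 1, continuous (derive1 phi) &
      exists a b, [/\ 0 < a, b < 1 &
        forall s, ~~ (a <= s <= b) -> phi s = 0]].

Definition integral01 (f : R -> R[i]) : R[i] :=
  (\int[leb 1]_s Rec (f s))%R +i* (\int[leb 1]_s Imc (f s))%R.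

Section Sobolev.
Context (m : nat).

(* f \in W^{1,p}([0, 1], C^m) with f' = g iff weak_derivative f g *)
Definition weak_derivative (f g : Lp01 m) : Prop :=
  forall phi, test_function phi -> forall i,
    integral01 (fun s => vLspace_fun f s i 0 * (derive1 phi s)%:C) =
    - integral01 (fun s => vLspace_fun g s i 0 * (phi s)%:C).

(* F is the continuous representative of f, which defines f(0) and f(1) *)
Definition continuous_repr (f : Lp01 m) (F : R -> 'cV[R[i]]_m) : Prop :=
  {within `[0, 1], continuous F} /\ ae_eq (leb 1) setT (vLspace_fun f) F.

(* L^p([0, 1], R_+) \otimes K *)
Definition positive_tensor (K : set 'cV[R[i]]_m) : set (Lp01 m) :=
  [set x | exists k (f : 'I_k -> R -> R) (c : 'I_k -> 'cV[R[i]]_m),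
     [/\ forall j, f j \in Lfun (leb 1) p%:E,
         forall j, \forall s \ae leb 1, 0 <= f j s,
         forall j, K (c j) &
         ae_eq (leb 1) setT (vLspace_fun x)
           (fun s => \sum_j (f j s)%:C *: c j)]].

End Sobolev.

Context (n m : nat) (N : network R n m).

Definition rgPsi : set 'cV[R[i]]_m := range (fun c : 'cV_n => Psi N *m c).

Definition opAm : set (Lp01 m * Lp01 m) :=
  [set fg | weak_derivative fg.1 fg.2 /\
     exists2 F, continuous_repr fg.1 F & rgPsi (F 1)].

Definition opQ : set (Lp01 m * 'cV[R[i]]_m) :=
  [set fd | (exists g, opAm (fd.1, g)) /\
     exists2 F, continuous_repr fd.1 F & fd.2 = F 1 - adjB N *m F 0].

Definition opA : set (Lp01 m * Lp01 m) :=
  [set fg | opAm fg /\ opQ (fg.1, 0)].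

(* The inverse of the restriction of Q to ker (l - A_m): for l in the resolvent
   set of A and d in rg Psi there is exactly one such f. *)
Definition Qinv (l : R[i]) (d : 'cV[R[i]]_m) : Lp01 m :=
  get [set f | opAm (f, l *: f) /\ opQ (f, d)].

Section Reachability.
Variables (v : 'cV[R[i]]_n) (T : R -> Lp01 m -> Lp01 m) (l : R[i]).

Definition opB (z : R[i]) : 'cV[R[i]]_m := z *: (Psi N *m v).

Definition opBl (z : R[i]) : Lp01 m := Qinv l (opB z).

(* x = (l - A) \int_0^t T (t - s) B_l u(s) ds *)
Definition controllability_map (t : R) (u : R -> R[i]) (x : Lp01 m) : Prop :=
  exists2 z, bochner_integral (leb t) (fun s => T (t - s) (opBl (u s))) z &
    opA (z, l *: z - x).

Definition positive_reachability : set (Lp01 m) :=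
  [set x | exists t (u : R -> R),
     [/\ 0 <= t, u \in Lfun (leb t) p%:E,
         \forall s \ae leb t, 0 <= u s &
         controllability_map t (fun s => (u s)%:C) x]].

End Reachability.
End Control.

Arguments positive_tensor {R p} p1 {m} K _.
Arguments opAm {R p} p1 {n m} N _.
Arguments opQ {R p} p1 {n m} N _.
Arguments opA {R p} p1 {n m} N _.

(* Main.v *)
Require Import Defs.
From mathcomp Require Import all_boot all_order all_algebra.
From mathcomp Require Import all_classical all_reals all_analysis.
From mathcomp Require Import measurable_realfun complex ring lra.
Import Order.TTheory GRing.Theory Num.Theory.
Import numFieldNormedType.Exports.
Set Implicit Arguments.
Unset Strict Implicit.
Unset Printing Implicit Defensive.
Local Open Scope classical_set_scope.
Local Open Scope ring_scope.
Local Open Scope complex_scope.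

(** A signal u(t) emitted at the control vertex enters the edges at s = 1 with
    weights Psi v, travels to s = 0 at unit speed, and is then redistributed by
    B.  The state at time t is therefore
      x(s) = sum over k of u(t - 1 - k + s) B^k Psi v                (driven)
    with u = 0 before time 0.  Its amplitudes on the waves B^k Psi v are
    nonnegative functions in L^p when u is nonnegative.  Conversely, amplitudes
    a_k for k < K are all produced at time K by emitting a_k between the times
    K - 1 - k and K - k (state_driven).  So the reachable states are the finite
    sums of a_k tensor B^k Psi v with a_k >= 0, and these are the elements of
    the positive tensor cone, since a convex hull and its generators span the
    same cone (tensor_state).  The second equality is the intertwining
    Psi A^k = B^k Psi.

    What has to be proved is that the abstract controllability map produces
    these explicit states, knowing of the semigroup T only that its generator is
    A.  Put S = (l - A)^-1, g = Q_l Psi v, and let U be the primitive of u.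
    Three facts lead to
      the integral of u(s) T(t - s) g over [0, t] is S (driven t u),  (1)
    to which l - A is then applied.

    - driven t U - U(t) g satisfies the boundary condition of D(A) and has
      derivative driven t u - U(t) l g, which gives the identity
      S (driven t u) = A S (driven t U) + U(t) g         (resolvent_driven).
    - Once the control is switched off, the driven states form an orbit of T
      (driven_orbit).  Applying S three times moves the control to its third
      primitive, which is smooth enough for the result to be a classical
      solution of y' = A y; classical solutions are orbits (solution_orbit),
      and S is injective and commutes with T.
    - For a short pulse that ends at time t, driven t U vanishes except near
      s = 1, so S (driven t u) is nearly (integral of u) g in L^p
      (resolvent_pulse).

    Cutting u into short pulses and letting each evolve freely, these facts
    show that the Riemann sums of the left side of (1) converge to the right
    side (input_integral), which identifies the Bochner integral.  The local
    boundedness of T that this uses comes from the uniform boundedness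
    principle, hence from the completeness of L^p. *)

(** * Real-valued norms and bounded linear maps *)

Section RealNorm.
Context {R : realType} {V : normedModType R[i]}.
Implicit Types (x y z : V).

(** The norm of a normed module over R[i] takes its values in R[i]; all
    estimates below are made over R. *)
Definition nrm x : R := Rec `|x|.

Lemma nrmE x : (nrm x)%:C = `|x|.
Proof. by apply: RRe_real; exact: normr_real. Qed.

Lemma nrm_ge0 x : 0 <= nrm x.
Proof. by rewrite -ler0c nrmE normr_ge0. Qed.

Lemma nrmD x y : nrm (x + y) <= nrm x + nrm y.
Proof. by rewrite -lecR rmorphD /= !nrmE ler_normD. Qed.

Lemma nrmN x : nrm (- x) = nrm x.
Proof. by rewrite /nrm normrN. Qed.

Lemma nrmB x y : nrm (x - y) <= nrm x + nrm y.
Proof. by rewrite -(nrmN y) nrmD. Qed.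

Lemma nrmC x y : nrm (x - y) = nrm (y - x).
Proof. by rewrite /nrm distrC. Qed.

Lemma nrm0 : nrm (0 : V) = 0.
Proof. by rewrite /nrm normr0. Qed.

Lemma nrm_eq0 x : nrm x = 0 -> x = 0.
Proof.
by move=> h; apply/eqP; rewrite -normr_eq0 -nrmE h.
Qed.

Lemma nrmZ (a : R[i]) x : nrm (a *: x) = Rec `|a| * nrm x.
Proof.
by apply: complexI; rewrite rmorphM /= !nrmE normrZ.
Qed.

Lemma normCr (r : R) : `|r%:C| = `|r|%:C.
Proof. by rewrite normc_def /= expr0n addr0 sqrtr_sqr. Qed.

Lemma nrmZr (r : R) x : nrm (r%:C *: x) = `|r| * nrm x.
Proof. by rewrite nrmZ normCr. Qed.

Lemma nrm_sum (I : Type) (s : seq I) (P : pred I) (F : I -> V) :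
  nrm (\sum_(i <- s | P i) F i) <= \sum_(i <- s | P i) nrm (F i).
Proof.
elim/big_ind2 : _ => //; first by rewrite nrm0.
by move=> x a y b xa yb; apply: le_trans (nrmD _ _) _; exact: lerD.
Qed.

Lemma nrm_le_eps x y : (forall e, 0 < e -> nrm (x - y) <= e) -> x = y.
Proof.
move=> h; apply/eqP; rewrite -subr_eq0; apply/eqP/nrm_eq0/eqP.
by rewrite eq_le nrm_ge0 andbT; apply/ler_addgt0Pl => e e0; rewrite addr0 h.
Qed.

Lemma nrm_le_eps_mul (C : R) x y :
  (forall e, 0 < e -> nrm (x - y) <= C * e) -> x = y.
Proof.
move=> h; apply: nrm_le_eps => e e0.
have C0 : 0 <= C.
  by have := le_trans (nrm_ge0 _) (h 1 ltr01); rewrite mulr1.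
have e1 : 0 < e / (C + 1) by rewrite divr_gt0// ltr_wpDl.
apply: le_trans (h _ e1) _.
by rewrite mulrA ler_pdivrMr ?ltr_wpDl// mulrDr mulr1 (mulrC e) lerDl ltW.
Qed.

Lemma gt0C (e : R[i]) : 0 < e -> exists2 r : R, 0 < r & e = r%:C.
Proof.
move=> e0; exists (Rec e); last by rewrite RRe_real// gtr0_real.
by rewrite -ltcR RRe_real// gtr0_real.
Qed.

Lemma cvg_nrmP (T : Type) (F : set_system T) {FF : Filter F} (f : T -> V) y :
  f @ F --> y <-> forall e : R, 0 < e -> \forall t \near F, nrm (f t - y) < e.
Proof.
split=> [/cvgrPdist_lt h e e0|h].
  have e0' : 0 < e%:C by rewrite ltcR.
  by apply: filterS (h _ e0') => t; rewrite -nrmE ltcR nrmC.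
apply/cvgrPdist_lt => _ /gt0C[e e0 ->].
by apply: filterS (h e e0) => t; rewrite -nrmE ltcR nrmC.
Qed.

Lemma cvg_at_right_nrmP (f : R -> V) y : f h @[h --> 0^'+] --> y <->
  forall e : R, 0 < e ->
    exists2 d : R, 0 < d & forall h, 0 < h < d -> nrm (f h - y) < e.
Proof.
split=> [/cvg_nrmP h e e0|h].
  have [d /= d0 dh] := h e e0; exists d => // x /andP[x0 xd].
  by apply: dh => //=; rewrite sub0r normrN gtr0_norm.
apply/cvg_nrmP => e e0; have [d d0 dh] := h e e0.
exists d => //= x; rewrite /= sub0r normrN => xd x0; apply: dh.
by rewrite x0 -(gtr0_norm x0).
Qed.

Lemma cvg_seq_nrmP (f : nat -> V) y : f k @[k --> \oo] --> y <->
  forall e : R, 0 < e ->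
    exists K, forall k, (K <= k)%N -> nrm (f k - y) < e.
Proof.
split=> [/cvg_nrmP h e e0|h].
  by have [K _ Kh] := h e e0; exists K => k Kk; exact: Kh.
by apply/cvg_nrmP => e e0; have [K Kh] := h e e0; exists K.
Qed.

End RealNorm.

Section Linear.
Context {R : realType} {V : normedModType R[i]}.

Lemma linD (f : V -> V) : linear f -> forall x y, f (x + y) = f x + f y.
Proof. by move=> lf x y; have := lf 1 x y; rewrite !scale1r. Qed.

Lemma lin0 (f : V -> V) : linear f -> f 0 = 0.
Proof.
move=> lf; have := linD lf 0 0; rewrite addr0 => h.
by apply: (addrI (f 0)); rewrite -h addr0.
Qed.

Lemma linZ (f : V -> V) : linear f -> forall a x, f (a *: x) = a *: f x.
Proof. by move=> lf a x; have := lf a x 0; rewrite (lin0 lf) !addr0. Qed.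

Lemma linN (f : V -> V) : linear f -> forall x, f (- x) = - f x.
Proof. by move=> lf x; rewrite -scaleN1r linZ// scaleN1r. Qed.

Lemma linB (f : V -> V) : linear f -> forall x y, f (x - y) = f x - f y.
Proof. by move=> lf x y; rewrite linD// linN. Qed.

Lemma lin_sum (f : V -> V) : linear f ->
  forall (I : Type) (s : seq I) (P : pred I) (F : I -> V),
  f (\sum_(i <- s | P i) F i) = \sum_(i <- s | P i) f (F i).
Proof.
move=> lf I s P F; elim/big_rec2 : _ => [|i y1 y2 _ <-]; first exact: lin0.
exact: linD.
Qed.

Lemma lin_continuous_bounded (f : V -> V) : linear f -> continuous f ->
  exists2 M : R, 0 <= M & forall x, nrm (f x) <= M * nrm x.
Proof.
move=> lf /(_ 0) /cvg_nrmP /(_ 1 ltr01).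
rewrite lin0// => /nbhs_normP[e' /= /gt0C[e e0 ->]] H.
have e20 : 0 < e / 2 by rewrite divr_gt0.
exists (e / 2)^-1; first by rewrite invr_ge0 ltW.
move=> x; have [->|x0] := eqVneq x 0; first by rewrite lin0// !nrm0 mulr0.
have nx0 : 0 < nrm x.
  rewrite lt_neqAle nrm_ge0 andbT; apply: contra x0 => /eqP h.
  by apply/eqP/nrm_eq0.
have nc0 : 0 <= e / 2 / nrm x by rewrite divr_ge0// ?ltW.
have /H : ball_ Num.norm (0 : V) e%:C ((e / 2 / nrm x)%:C *: x).
  rewrite /= sub0r normrN -nrmE ltcR nrmZr ger0_norm//.
  by rewrite divfK ?gt_eqF// ltr_pdivrMr// ltr_pMr// ltr1n.
rewrite /= subr0 linZ// nrmZr ger0_norm// => /ltW.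
rewrite -ler_pdivlMl ?divr_gt0// mulr1 invf_div => /le_trans; apply.
by rewrite mulrC.
Qed.

End Linear.

(** * Uniform boundedness and orbits of semigroups *)

Section UniformBoundedness.
Context {R : realType} {V : normedModType R[i]}.

(** Completeness for the sequences that the proof meets: increments bounded by
    3^-k, with the tail of that series as the distance to the limit. *)
Definition geometrically_complete := forall x : nat -> V,
  (forall k, nrm (x k.+1 - x k) <= 3^-1 ^+ k) ->
  exists y, forall k, nrm (y - x k) <= 3 / 2 * 3^-1 ^+ k.

(** A vector y of the unit ball at which f attains its norm up to a factor
    3/2, so that nrm (f y) can replace the operator norm. *)
Lemma near_attained (f : V -> V) (M : R) : linear f ->
  (forall x, nrm (f x) <= M * nrm x) ->
  exists y, nrm y <= 1 /\ forall z, nrm (f z) <= 3 / 2 * nrm (f y) * nrm z.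
Proof.
move=> lf fM.
pose E := [set r | exists2 y, nrm y <= 1 & r = nrm (f y)].
have M0 x : nrm x <= 1 -> nrm (f x) <= `|M|.
  move=> x1; apply: le_trans (fM x) _.
  apply: (@le_trans _ _ (`|M| * nrm x)).
    by rewrite ler_wpM2r ?nrm_ge0 ?ler_norm.
  by rewrite ler_piMr.
have E0 : E 0 by exists 0; rewrite ?lin0 ?nrm0.
have hE : has_sup E.
  split; first by exists 0.
  by exists `|M| => _ [y y1 ->]; exact: M0.
have Es r : E r -> r <= sup E by move=> /(ub_le_sup hE.2).
have fs z : nrm (f z) <= sup E * nrm z.
  have [->|z0] := eqVneq z 0; first by rewrite lin0// nrm0 mulr0.
  have nz0 : 0 < nrm z.
    rewrite lt_neqAle nrm_ge0 andbT; apply: contra z0 => /eqP h.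
    by apply/eqP/nrm_eq0.
  rewrite -ler_pdivrMr//; apply: Es; exists ((nrm z)^-1%:C *: z).
    by rewrite nrmZr gtr0_norm ?invr_gt0// mulVf// gt_eqF.
  by rewrite linZ// nrmZr gtr0_norm ?invr_gt0// mulrC.
have [s0|s0] := leP (sup E) 0.
  exists 0; rewrite nrm0 ler01; split=> // z.
  rewrite lin0// nrm0 mulr0 mul0r; apply: le_trans (fs z) _.
  by rewrite mulr_le0_ge0 ?nrm_ge0.
have e0 : 0 < sup E / 3 by rewrite divr_gt0.
have [_ [y y1 ->] ylt] := sup_adherent e0 hE.
exists y; split=> // z; apply: le_trans (fs z) _.
rewrite ler_wpM2r ?nrm_ge0//; move: ylt; lra.
Qed.

(** Sokal's elementary proof, which takes the place of Baire's theorem. If the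
    norms of the F k are unbounded, steps w_j of length 3^-j are added or
    subtracted one after the other. One of the two signs makes the value of
    the j-th chosen operator at least nrm (G_j w_j); the later steps are too
    short to undo this, and the sum of all steps is a point at which the
    operators are unbounded. *)
Lemma uniform_boundedness (F : nat -> V -> V) : geometrically_complete ->
  (forall k, linear (F k) /\ continuous (F k)) ->
  (forall x, exists M : R, forall k, nrm (F k x) <= M) ->
  exists2 M : R, 0 <= M & forall k x, nrm (F k x) <= M * nrm x.
Proof.
move=> cV FL FB.
have /choice[y yP] k : exists y, nrm y <= 1 /\
    forall z, nrm (F k z) <= 3 / 2 * nrm (F k y) * nrm z.
  have [lF cF] := FL k; have [M _ FM] := lin_continuous_bounded lF cF.
  exact: near_attained lF FM.
have [[M yM]|unb] := pselect (exists M, forall k, nrm (F k (y k)) <= M).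
  exists (3 / 2 * M).
    by have := le_trans (nrm_ge0 _) (yM 0%N); lra.
  move=> k x; apply: le_trans ((yP k).2 x) _.
  by rewrite ler_wpM2r ?nrm_ge0// ler_wpM2l// divr_ge0.
(* 3 ^+ j cancels the length of the j-th step; the factor 4 leaves j%:R after
   the loss of 3/4 caused by the later steps. *)
have /choice[idx idxP] j : exists k, 4 * 3 ^+ j * j%:R < nrm (F k (y k)).
  apply: contrapT => h; apply: unb; exists (4 * 3 ^+ j * j%:R) => k.
  by rewrite leNgt; apply/negP => ?; apply: h; exists k.
pose G j := F (idx j).
pose w j := (3^-1 ^+ j)%:C *: y (idx j).
have p3 j : 0 < (3^-1 : R) ^+ j by rewrite exprn_gt0// invr_gt0.
have nw j : nrm (w j) <= 3^-1 ^+ j.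
  rewrite nrmZr gtr0_norm//; have [h _] := yP (idx j).
  by rewrite ler_piMr// ltW.
have Gw j : nrm (G j (w j)) = 3^-1 ^+ j * nrm (G j (y (idx j))).
  by rewrite linZ ?nrmZr ?gtr0_norm//; exact: (FL _).1.
pose fix x k := if k is j.+1 then
  if nrm (G j (w j)) <= nrm (G j (x j + w j)) then x j + w j else x j - w j
  else 0.
have xw j : nrm (G j (w j)) <= nrm (G j (x j.+1)).
  rewrite /=; case: ifPn => //; rewrite -ltNge => h.
  have lG : linear (G j) := (FL (idx j)).1.
  have : nrm (G j (w j)) *+ 2 <= nrm (G j (x j + w j)) + nrm (G j (x j - w j)).
    apply: le_trans (nrmB _ _); rewrite -linB// opprB addrC addrA subrK.
    have -> : G j (w j + w j) = (1 + 1)%:C *: G j (w j).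
      by rewrite linD// rmorphD scalerDl !scale1r.
    by rewrite nrmZr ger0_norm ?addr_ge0// mulrDl !mul1r mulr2n.
  by move: h; rewrite mulr2n; lra.
have xS j : nrm (x j.+1 - x j) <= 3^-1 ^+ j.
  by rewrite /=; case: ifPn => _; rewrite addrC addKr ?nrmN.
have [z zP] := cV x xS.
have [M zM] := FB z.
pose j := (Num.truncn `|M|).+1.
have jM : M < j%:R by apply: le_lt_trans (ler_norm _) _; exact: truncnS_gt.
have lG : linear (G j) := (FL (idx j)).1.
have := le_trans ((yP (idx j)).2 (z - x j.+1)) (ler_wpM2l _ (zP j.+1)).
have := xw j; rewrite Gw.
have : nrm (G j (x j.+1)) <= nrm (G j z) + nrm (G j (z - x j.+1)).
  by rewrite -{1}[x j.+1](subKr z) linB// nrmB.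
have := zM (idx j); rewrite -/(G j) => GM.
have h3 := idxP j; rewrite -/(G j) in h3.
have N0 : 0 <= nrm (G j (y (idx j))) := nrm_ge0 _.
set N := nrm (G j (y (idx j))) in h3 N0 *.
have q0 := p3 j.
have : 4 * j%:R < 3^-1 ^+ j * N.
  rewrite -ltr_pdivrMl//; apply: le_lt_trans h3.
  by rewrite exprVn invrK mulrA (mulrC (3 ^+ j)).
rewrite exprS; set q := 3^-1 ^+ j in q0 *.
have : 0 <= 3 / 2 * N by rewrite mulr_ge0.
move=> N3 h4 h5 h6 /(_ N3).
have -> : 3 / 2 * N * (3 / 2 * (3^-1 * q)) = 3 / 4 * (q * N) by field.
have M0 : 0 <= M := le_trans (nrm_ge0 _) GM.
move: h4 h5 h6 GM jM; move: (q * N) => qN; lra.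
Qed.

End UniformBoundedness.

Section Orbits.
Context {R : realType} {V : normedModType R[i]} (T : R -> V -> V).
Hypothesis cV : @geometrically_complete R V.
Hypothesis T_C0 : C0_semigroup T.

Lemma C0_linear t : 0 <= t -> linear (T t).
Proof. by case: T_C0 => h _ _ _ t0; exact: (h t t0).1. Qed.

Lemma C0_continuous_at0 x e : 0 < e -> exists2 d : R, 0 < d &
  forall h, 0 <= h < d -> nrm (T h x - x) < e.
Proof.
move=> e0; have [_ T0 _ /(_ x)/cvg_at_right_nrmP/(_ e e0)[d d0 dh]] := T_C0.
exists d => // h /andP[]; rewrite le_eqVlt => /predU1P[<- _|h0 hd].
  by rewrite T0 subrr nrm0.
by apply: dh; rewrite h0.
Qed.

(** Otherwise there are times h_k that tend to 0 and operators T (h_k) that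
    are unbounded as a family, although strong continuity at 0 makes them
    pointwise bounded. *)
Lemma C0_bounded_near0 : exists2 d : R, 0 < d &
  exists2 M : R, 0 <= M & forall h, 0 <= h <= d -> forall x, nrm (T h x) <= M * nrm x.
Proof.
apply: contrapT => noM.
have /choice[h hP] (k : nat) : exists h, 0 <= h <= k.+1%:R^-1 /\
    exists x, k%:R * nrm x < nrm (T h x).
  apply: contrapT => hk; apply: noM; exists k.+1%:R^-1; first by rewrite invr_gt0.
  exists k%:R => // h hd x; rewrite leNgt; apply/negP => hx.
  by apply: hk; exists h; split=> //; exists x.
have h0 k : 0 <= h k by have [/andP[]] := hP k.
have TL k : linear (T (h k)) /\ continuous (T (h k)).
  by case: T_C0 => TL _ _ _; exact: TL.
have TB x : exists M : R, forall k, nrm (T (h k) x) <= M.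
  have [d d0 dh] := C0_continuous_at0 x ltr01.
  pose K := (Num.truncn d^-1).+1.
  exists (nrm x + 1 + \sum_(k < K) nrm (T (h k) x)) => k.
  have [kK|Kk] := ltnP k K.
    rewrite (bigD1 (Ordinal kK))//= addrCA lerDl addr_ge0//.
      by rewrite addr_ge0// nrm_ge0.
    by apply: sumr_ge0 => j _; exact: nrm_ge0.
  have : nrm (T (h k) x - x) < 1.
    apply: dh; rewrite h0/=; have [/andP[_ hk] _] := hP k.
    apply: le_lt_trans hk _; rewrite invf_plt ?posrE//.
    apply: lt_le_trans (truncnS_gt d^-1) _.
    by rewrite ler_nat leqW.
  move=> h1; have := nrmD (T (h k) x - x) x; rewrite subrK => h2.
  have : 0 <= \sum_(k < K) nrm (T (h k) x) by apply: sumr_ge0 => j _; exact: nrm_ge0.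
  by move: h1 h2; lra.
have [M M0 TM] := uniform_boundedness cV TL TB.
have [_ [x]] := hP (Num.truncn M).+1; apply/negP; rewrite -leNgt.
apply: le_trans (TM _ _) _; rewrite ler_wpM2r ?nrm_ge0//.
by rewrite ltW// truncnS_gt.
Qed.

(** The interval [0, t] is covered by finitely many steps of the length given
    by C0_bounded_near0. *)
Lemma C0_bounded t : exists2 M : R, 0 <= M &
  forall h, 0 <= h <= t -> forall x, nrm (T h x) <= M * nrm x.
Proof.
have [d d0 [M0 _ M0P]] := C0_bounded_near0.
pose M := Num.max 1 M0.
have M1 : 1 <= M by rewrite le_max lexx.
have Mge0 : 0 <= M by rewrite (le_trans _ M1).
have MP h x : 0 <= h <= d -> nrm (T h x) <= M * nrm x.
  move=> hd; apply: le_trans (M0P h hd x) _.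
  by rewrite ler_wpM2r ?nrm_ge0// le_max lexx orbT.
have step k h : 0 <= h <= k.+1%:R * d -> forall x, nrm (T h x) <= M ^+ k.+1 * nrm x.
  elim: k h => [|k IH] h /andP[h0 hk] x.
    by rewrite expr1; apply: MP; rewrite h0 -[d]mul1r.
  have [hd|dh] := leP h d.
    apply: le_trans (MP h x _) _; first by rewrite h0.
    by rewrite exprS ler_wpM2r ?nrm_ge0// ler_peMr// exprn_ege1.
  have [_ _ TD _] := T_C0.
  have -> : T h x = T d (T (h - d) x).
    by rewrite -TD ?subr_ge0 ?ltW// addrC subrK.
  apply: le_trans (MP d _ _) _; first by rewrite lexx ltW.
  rewrite exprS -mulrA ler_wpM2l//; apply: IH.
  by rewrite subr_ge0 ltW//= lerBlDr; move: hk; rewrite -[k.+2%:R]natr1 mulrDl mul1r.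
pose k := Num.truncn (t / d).
exists (M ^+ k.+1); first by rewrite exprn_ge0.
move=> h /andP[h0 ht] x; apply: step; rewrite h0/=; apply: le_trans ht _.
by rewrite -ler_pdivrMr// ltW// truncnS_gt.
Qed.

(** The points r at which f has moved by at most e r from f 0 have a supremum.
    Left continuity puts the supremum in this set, and the right derivative 0
    moves it further unless it is b. *)
Lemma zero_right_derivative_constant (f : R -> V) (b : R) : 0 <= b ->
  (forall r, 0 <= r < b -> forall e, 0 < e -> exists2 d, 0 < d &
     forall h, 0 < h < d -> r + h <= b -> nrm (f (r + h) - f r) <= e * h) ->
  (forall r, 0 < r <= b -> forall e, 0 < e -> exists2 d, 0 < d &
     forall h, 0 < h < d -> 0 <= r - h -> nrm (f r - f (r - h)) <= e) ->
  f b = f 0.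
Proof.
move=> b0 fr fl; apply: (@nrm_le_eps_mul _ _ b) => e e0.
pose E := [set r | 0 <= r <= b /\ nrm (f r - f 0) <= e * r].
have E0 : E 0 by rewrite /E /= lexx b0 subrr nrm0 mulr0.
have hE : has_sup E by split; [exists 0|exists b => r [/andP[]]].
pose s := sup E.
have s0 : 0 <= s by exact: (ub_le_sup hE.2).
have sb : s <= b by apply: ge_sup; [exists 0|move=> r [/andP[]]].
have sE : E s.
  split; first by rewrite s0.
  move: s0; rewrite le_eqVlt => /predU1P[<-|s0]; first by rewrite subrr nrm0 mulr0.
  apply/ler_addgt0Pr => e' e'0.
  have [|d d0 dh] := fl s _ e' e'0; first by rewrite s0.
  have [r rE sr] := sup_adherent d0 hE.
  have := ub_le_sup hE.2 rE; rewrite -/s le_eqVlt => /predU1P[rs|rs].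
    by case: rE => _; rewrite rs => /le_trans; apply; rewrite lerDl ltW.
  case: rE => /andP[r0 _] rE.
  have := dh (s - r); rewrite subKr subr_gt0 rs ltrBlDr -ltrBlDl => /(_ sr r0).
  have := nrmD (f s - f r) (f r - f 0); rewrite addrA subrK.
  have : e * r <= e * s by rewrite ler_wpM2l// ltW.
  by move: rE; lra.
move: sb; rewrite le_eqVlt => /predU1P[<-|sb]; first by rewrite mulrC; case: sE.
have [|d d0 dh] := fr s _ e e0; first by rewrite s0.
pose h := Num.min (d / 2) (b - s).
have h0 : 0 < h by rewrite lt_min divr_gt0// subr_gt0.
have hd : h < d by rewrite gt_min ltr_pdivrMr// ltr_pMr// ltr1n.
have hb : s + h <= b by rewrite -lerBrDl ge_min lexx orbT.
have : E (s + h).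
  split; first by rewrite hb addr_ge0// ltW.
  have := dh h; rewrite h0 hd => /(_ isT hb).
  have := nrmD (f (s + h) - f s) (f s - f 0); rewrite addrA subrK mulrDr.
  by case: sE => _; lra.
move=> /(ub_le_sup hE.2); rewrite -/s => ssh; move: h0 ssh; lra.
Qed.

Lemma generatorP x y : generator T (x, y) -> forall e, 0 < e ->
  exists2 d : R, 0 < d &
    forall h, 0 < h < d -> nrm (T h x - x - h%:C *: y) <= e * h.
Proof.
move=> /cvg_at_right_nrmP h e e0; have [d d0 dh] := h e e0.
exists d => // r rd; have := dh r rd.
have r0 : 0 < r by case/andP: rd.
have -> : T r x - x - r%:C *: y = r%:C *: (r^-1%:C *: (T r x - x) - y).
  by rewrite scalerBr scalerA -rmorphM mulfV ?gt_eqF// rmorph1 scale1r.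
rewrite nrmZr gtr0_norm// mulrC => h'.
by rewrite ler_pM2r// ltW.
Qed.

Lemma generator_uniq x y y' : generator T (x, y) -> generator T (x, y') -> y = y'.
Proof.
move=> /generatorP hy /generatorP hy'; apply: nrm_le_eps => e e0.
have e2 : 0 < e / 2 by rewrite divr_gt0.
have [d d0 dh] := hy _ e2; have [d' d'0 dh'] := hy' _ e2.
pose h := Num.min (d / 2) (d' / 2).
have h0 : 0 < h by rewrite lt_min !divr_gt0.
have lt_half (r : R) : 0 < r -> r / 2 < r by lra.
have /dh H : 0 < h < d by rewrite h0 gt_min lt_half.
have /dh' H' : 0 < h < d' by rewrite h0 gt_min (lt_half d')// orbT.
have := nrmB (T h x - x - h%:C *: y') (T h x - x - h%:C *: y).
rewrite opprB addrC addrA subrK -scalerBr nrmZr gtr0_norm// => H3.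
rewrite -(ler_pM2l h0); move: H H' H3; lra.
Qed.

(** T t is continuous and commutes with the difference quotients. *)
Lemma generator_invariant t x y : 0 <= t ->
  generator T (x, y) -> generator T (T t x, T t y).
Proof.
move=> t0 xy; apply/cvg_at_right_nrmP => e e0.
have [TL _ TD _] := T_C0.
have [M M0 MT] := lin_continuous_bounded (TL t t0).1 (TL t t0).2.
have M1 : 0 < M + 1 by rewrite ltr_wpDl.
have e1 : 0 < e / (M + 1) by rewrite divr_gt0.
have /cvg_at_right_nrmP /(_ _ e1)[d d0 dh] := xy.
exists d => // h hd; have /andP[h0 _] := hd.
have lT := (TL t t0).1.
have -> : T h (T t x) = T t (T h x) by rewrite -!TD ?(ltW h0)// addrC.
rewrite -(linB lT) -(linZ lT) -(linB lT).
have := dh h hd; set w := _ - y => wd.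
apply: le_lt_trans (MT _) _; apply: le_lt_trans (_ : _ <= (M + 1) * nrm w) _.
  by rewrite ler_wpM2r ?nrm_ge0// lerDl.
by rewrite mulrC -ltr_pdivlMr.
Qed.

(** Classical solutions of y' = A y are orbits, because T (b - r) (y r) has
    right derivative 0. The two bounds, uniform in r and s, say that y is
    Lipschitz with derivative z. *)
Lemma solution_orbit (y z : R -> V) (b C : R) : 0 <= b ->
  (forall r, 0 <= r <= b -> generator T (y r, z r)) ->
  (forall r s, 0 <= r -> r <= s <= b ->
     nrm (y s - y r - (s - r)%:C *: z r) <= C * (s - r) ^+ 2) ->
  (forall r s, 0 <= r -> r <= s <= b -> nrm (y s - y r) <= C * (s - r)) ->
  y b = T b (y 0).
Proof.
move=> b0 yz yq yl; have [TL T0 TD _] := T_C0.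
have [M M0 MT] := C0_bounded b.
have C0 : 0 <= C \/ b = 0.
  move: b0; rewrite le_eqVlt => /predU1P[|b0]; first by right.
  left; have := le_trans (nrm_ge0 _) (yl 0 b (lexx _) _).
  by rewrite ltW// lexx subr0 pmulr_lge0//; exact.
case: C0 => [C0|->]; last by rewrite T0.
rewrite -[LHS]T0 -[X in T X _](subrr b) -[X in T X (y 0)]subr0.
apply: (@zero_right_derivative_constant (fun r => T (b - r) (y r))) => //.
- move=> r /andP[r0 rb] e e0.
  have M1 : 0 < M + 1 by rewrite ltr_wpDl.
  have e1 : 0 < e / 2 / (M + 1) by rewrite !divr_gt0.
  have [|d d0 dh] := generatorP (yz r _) e1; first by rewrite r0 ltW.
  pose d' := e / 2 / (M + 1) / (C + 1).
  have C1 : 0 < C + 1 by rewrite ltr_wpDl.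
  have d'0 : 0 < d' by rewrite divr_gt0.
  exists (Num.min d d'); first by rewrite lt_min d0.
  move=> h; rewrite lt_min => /and3P[h0 hd hd'] rhb.
  have {dh} := dh h; rewrite h0 hd => /(_ isT) H1.
  have bh : 0 <= b - (r + h) by rewrite subr_ge0.
  have -> : b - r = b - (r + h) + h by rewrite opprD addrA subrK.
  rewrite (TD (b - (r + h)) h)// ?(ltW h0)// -(linB (C0_linear bh)).
  apply: le_trans (MT _ _ _) _.
    by rewrite bh lerBlDr lerDl addr_ge0// ltW.
  have := yq r (r + h) r0; rewrite rhb lerDl ltW// [r + h]addrC addrK.
  rewrite [h + r]addrC => /(_ isT) H2.
  have : nrm (y (r + h) - T h (y r)) <= C * h ^+ 2 + e / 2 / (M + 1) * h.
    apply: le_trans (lerD H2 H1); apply: le_trans (nrmB _ _).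
    by rewrite opprB addrA subrK opprB addrA subrK.
  have : C * h ^+ 2 <= e / 2 / (M + 1) * h.
    rewrite expr2 mulrA ler_wpM2r ?ltW//.
    apply: le_lt_trans (_ : _ <= h * (C + 1)) _; last by rewrite -ltr_pdivlMr.
    by rewrite mulrC ler_wpM2l ?lerDl// ltW.
  move=> H3 H4; apply: le_trans (_ : _ <= (M + 1) * (e / (M + 1) * h)) _.
    apply: ler_pM => //; [exact: nrm_ge0|by rewrite lerDl|].
    by apply: le_trans H4 _; move: H3; rewrite -!mulrA (mulrCA 2^-1); lra.
  by rewrite mulrA mulrCA divff ?gt_eqF// mulr1.
- move=> r /andP[r0 rb] e e0.
  have M1 : 0 < M + 1 by rewrite ltr_wpDl.
  have e1 : 0 < e / 2 / (M + 1) by rewrite !divr_gt0.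
  have [d d0 dh] := C0_continuous_at0 (y r) e1.
  pose d' := e / 2 / (M + 1) / (M * C + 1).
  have C1 : 0 < M * C + 1 by rewrite ltr_wpDl// mulr_ge0.
  have d'0 : 0 < d' by rewrite divr_gt0.
  exists (Num.min d d'); first by rewrite lt_min d0.
  move=> h; rewrite lt_min => /and3P[h0 hd hd'] rh.
  have {dh} := dh h; rewrite (ltW h0) hd => /(_ isT)/ltW H1.
  have -> : b - (r - h) = (b - r) + h by rewrite opprB addrA addrAC.
  have br : 0 <= b - r by rewrite subr_ge0.
  rewrite (TD (b - r) h)// ?(ltW h0)// -(linB (C0_linear br)).
  apply: le_trans (MT _ _ _) _; first by rewrite br lerBlDr lerDl ltW.
  have : nrm (y r - T h (y (r - h))) <= e / 2 / (M + 1) + M * C * h.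
    have -> : y r - T h (y (r - h)) = T h (y r - y (r - h)) - (T h (y r) - y r).
      rewrite linB; last by apply: C0_linear; exact: ltW.
      by rewrite addrAC opprB [T h (y r) + _]addrC subrK.
    apply: le_trans (nrmB _ _) _; rewrite addrC; apply: lerD => //.
    apply: le_trans (MT _ _ _) _.
      by rewrite ltW//= (le_trans _ rb)// -subr_ge0.
    rewrite -mulrA; apply: ler_wpM2l => //.
    have := yl (r - h) r rh; rewrite rb lerBlDr lerDl ltW// subKr; exact.
  have : M * C * h <= e / 2 / (M + 1).
    apply: ltW; apply: le_lt_trans (_ : _ <= h * (M * C + 1)) _.
      by rewrite mulrC ler_wpM2l ?lerDl// ltW.
    by rewrite -ltr_pdivlMr.
  move=> H3 H4; apply: le_trans (_ : _ <= (M + 1) * (e / (M + 1))) _.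
    apply: ler_pM => //; [exact: nrm_ge0|by rewrite lerDl|].
    by apply: le_trans H4 _; move: H3; rewrite (mulrAC e); lra.
  by rewrite mulrCA divff ?gt_eqF// mulr1.
Qed.

End Orbits.

(** * Real integrals *)

Section RealIntegrals.
Context {d} {T : measurableType d} {R : realType}.
Variable mu : {measure set T -> \bar R}.
Implicit Types (f g : T -> R).

Definition intg f := mu.-integrable setT (EFin \o f).

Lemma intg_meas f : intg f -> measurable_fun setT f.
Proof. by move=> /integrableP[/measurable_EFinP]. Qed.

Lemma intgD f g : intg f -> intg g -> intg (fun x => f x + g x).
Proof. by move=> fi gi; exact: (integrableD measurableT fi gi). Qed.

Lemma intgZ (r : R) f : intg f -> intg (fun x => r * f x).
Proof. by move=> fi; exact: (integrableZl measurableT r fi). Qed.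

Lemma intgB f g : intg f -> intg g -> intg (fun x => f x - g x).
Proof. by move=> fi gi; exact: (integrableB measurableT fi gi). Qed.

Lemma intg_sum (I : Type) (s : seq I) (P : pred I) (F : I -> T -> R) :
  (forall i, P i -> intg (F i)) -> intg (fun x => \sum_(i <- s | P i) F i x).
Proof.
move=> h; have := @integrable_sum _ _ _ mu setT measurableT I s P
  (fun i x => (F i x)%:E) h.
by apply: eq_integrable => // x _ /=; rewrite sumEFin.
Qed.

Lemma intg_le f g : measurable_fun setT f -> (forall x, `|f x| <= `|g x|) ->
  intg g -> intg f.
Proof.
move=> mf fg gi; apply: le_integrable gi => //; first exact/measurable_EFinP.
by move=> x _; rewrite /= lee_fin.
Qed.

Lemma intg_mulr_bounded f g (C : R) : measurable_fun setT g ->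
  (forall x, `|g x| <= C) -> intg f -> intg (fun x => f x * g x).
Proof.
move=> mg gC fi; apply: (@intg_le _ (fun x => C * f x)); last exact: intgZ.
  by apply: measurable_funM => //; exact: intg_meas.
by move=> x; rewrite !normrM mulrC ler_wpM2r// (le_trans (gC x))// ler_norm.
Qed.

Lemma indic_bounded (A : set T) x : `|\1_A x : R| <= 1.
Proof. by rewrite indicE; case: (x \in A); rewrite ?normr1 ?normr0. Qed.

Lemma intg_indic f (A : set T) : measurable A -> intg f ->
  intg (fun x => f x * \1_A x).
Proof.
by move=> mA; apply: (@intg_mulr_bounded _ _ 1) => // x; exact: indic_bounded.
Qed.

Lemma IntD f g : intg f -> intg g ->
  \int[mu]_x (f x + g x) = \int[mu]_x f x + \int[mu]_x g x.
Proof. by move=> fi gi; rewrite RintegralD. Qed.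

Lemma IntB f g : intg f -> intg g ->
  \int[mu]_x (f x - g x) = \int[mu]_x f x - \int[mu]_x g x.
Proof. by move=> fi gi; rewrite RintegralB. Qed.

Lemma IntZ (r : R) f : intg f -> \int[mu]_x (r * f x) = r * \int[mu]_x f x.
Proof. by move=> fi; rewrite RintegralZl. Qed.

Lemma Int0 : \int[mu]_x (0 : R) = 0.
Proof. by rewrite /Rintegral integral0. Qed.

Lemma Int_sum (I : Type) (s : seq I) (P : pred I) (F : I -> T -> R) :
  (forall i, P i -> intg (F i)) ->
  \int[mu]_x (\sum_(i <- s | P i) F i x) = \sum_(i <- s | P i) \int[mu]_x F i x.
Proof.
move=> h; elim: s => [|i s IH].
  under eq_Rintegral do rewrite big_nil.
  by rewrite big_nil Int0.
under eq_Rintegral do rewrite big_cons.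
rewrite big_cons; case: ifPn => Pi //.
by rewrite IntD ?IH//; [exact: h|exact: intg_sum].
Qed.

Lemma Int_ge0 f : (forall x, 0 <= f x) -> 0 <= \int[mu]_x f x.
Proof. by move=> f0; apply: Rintegral_ge0. Qed.

Lemma Int_le f g : intg f -> intg g -> (forall x, f x <= g x) ->
  \int[mu]_x f x <= \int[mu]_x g x.
Proof. by move=> fi gi fg; apply: le_Rintegral. Qed.

Lemma Int_EFin f : intg f ->
  (\int[mu]_x (f x)%:E)%E = (\int[mu]_x f x)%:E.
Proof. by move=> fi; rewrite /Rintegral fineK// integrable_fin_num. Qed.

Lemma Int_norm f : intg f -> `|\int[mu]_x f x| <= \int[mu]_x `|f x|.
Proof. by move=> fi; apply: le_normr_Rintegral. Qed.

Lemma intg_norm f : intg f -> intg (fun x => `|f x|).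
Proof.
move=> fi; apply: (@intg_le _ f) => //; last by move=> x; rewrite normr_id.
by apply: measurableT_comp => //; exact: intg_meas.
Qed.

Lemma Int_ae f g : measurable_fun setT f -> measurable_fun setT g ->
  {ae mu, forall x, f x = g x} -> \int[mu]_x f x = \int[mu]_x g x.
Proof.
move=> mf mg fg; rewrite /Rintegral; congr fine; apply: ae_eq_integral => //.
- exact/measurable_EFinP.
- exact/measurable_EFinP.
- by apply: filterS fg => x -> _.
Qed.

Hypothesis mufin : (mu setT < +oo)%E.

Lemma mu_fin (A : set T) : measurable A -> (mu A < +oo)%E.
Proof.
by move=> mA; apply: le_lt_trans mufin; apply: le_measure; rewrite ?inE.
Qed.

Lemma intg_bounded f (C : R) : measurable_fun setT f ->
  (forall x, `|f x| <= C) -> intg f.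
Proof.
move=> mf fC; apply: (@intg_le _ (cst C)) => //.
  by move=> x; rewrite (le_trans (fC x))// ler_norm.
apply/integrableP; split => /=; first exact/measurable_EFinP.
rewrite (_ : (fun _ => _) = cst `|C|%:E)// integral_cst//.
by rewrite lte_mul_pinfty.
Qed.

Lemma intg_indic1 (A : set T) : measurable A -> intg (\1_A).
Proof. by move=> mA; apply: (@intg_bounded _ 1) => // x; exact: indic_bounded. Qed.

Lemma Int_indic (A : set T) : measurable A -> \int[mu]_x (\1_A x) = fine (mu A).
Proof. by move=> mA; rewrite /Rintegral integral_indic// setIT. Qed.

End RealIntegrals.

Section AlmostEverywhere.
Context {d} {T : measurableType d} {R : realType}.
Variable mu : {measure set T -> \bar R}.

Lemma ae_imp (P Q : T -> Prop) : {ae mu, forall x, P x} ->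
  (forall x, P x -> Q x) -> {ae mu, forall x, Q x}.
Proof. by move=> h PQ; apply: filterS h. Qed.

Lemma ae_imp2 (P P' Q : T -> Prop) :
  {ae mu, forall x, P x} -> {ae mu, forall x, P' x} ->
  (forall x, P x -> P' x -> Q x) -> {ae mu, forall x, Q x}.
Proof. by move=> h h' PQ; apply: filterS2 h h'. Qed.

End AlmostEverywhere.

Section LowerIntegral.
Context {d} {T : measurableType d} {R : realType}.
Variable mu : {measure set T -> \bar R}.
Local Open Scope ereal_scope.

Import HBNNSimple.

(** The integral of a nonnegative function is the supremum of the integrals of
    the simple functions below it, and cutting such a simple function off on
    the exceptional null set changes nothing. The lemma is applied to
    functions such as nrm (S x - F x) with an arbitrary F. *)
Lemma ge0_ae_le_integral (f g : T -> \bar R) :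
  (forall x, 0 <= f x) -> (forall x, 0 <= g x) ->
  {ae mu, forall x, f x <= g x} -> \int[mu]_x f x <= \int[mu]_x g x.
Proof.
move=> f0 g0 [N [mN N0 fgN]]; rewrite !ge0_integralTE//.
apply: ub_ereal_sup => _ [h /= hf <-].
have mCN : measurable (~` N) by exact: measurableC.
apply: (@le_trans _ _ (sintegral mu (proj_nnsfun h mCN))); last first.
  apply: ereal_sup_ubound; exists (proj_nnsfun h mCN) => //= x.
  rewrite mindicE; case: (boolP (x \in _)); rewrite ?mulr1 ?mulr0 ?g0//.
  rewrite inE => Nx; apply: le_trans (hf x) _.
  by apply: contrapT => fgx; apply: Nx; exact: fgN.
rewrite -!integralT_nnsfun le_eqVlt; apply/orP; left; apply/eqP.
apply: ae_eq_integral => //.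
- exact/measurable_EFinP.
- exact/measurable_EFinP.
- exists N; split=> // x /=; apply: contra_notP => Nx _.
  by rewrite mindicE mem_set// mulr1.
Qed.

End LowerIntegral.

(** * Bochner integrals *)

Section Combination.
Context {d} {T : measurableType d} {R : realType} {V : normedModType R[i]}.
Variable mu : {measure set T -> \bar R}.
Hypothesis mufin : (mu setT < +oo)%E.
Variables (J : finType) (A : J -> set T) (v : J -> V).
Hypothesis mA : forall j, measurable (A j).

Definition comb x : V := \sum_j (\1_(A j) x)%:C *: v j.
Definition comb_int : V := \sum_j (fine (mu (A j)))%:C *: v j.

(** The sets A j that contain x. Points with the same code form an atom of the
    algebra that the A j generate, and comb is constant on atoms. *)
Definition code x : {set J} := [set j | x \in A j].
Definition atom (I : {set J}) : set T := [set x | code x = I].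

Lemma measurable_atom I : measurable (atom I).
Proof.
have -> : atom I = \bigcap_(j in setT) (if j \in I then A j else ~` A j).
  apply/seteqP; split=> [x <- j _|x xI].
    by rewrite inE; case: ifPn => [/set_mem//|]; rewrite notin_setE.
  apply/setP => j; have := xI j Logic.I; rewrite inE; case: ifPn => _.
    by move=> /mem_set ->.
  by move=> h; apply/negbTE; rewrite notin_setE.
apply: fin_bigcap_measurable => //.
by move=> j _; case: ifPn => _ //; exact: measurableC.
Qed.

Lemma sum_atom (c : {set J} -> R) x : \sum_(I : {set J}) \1_(atom I) x * c I = c (code x).
Proof.
rewrite (bigD1 (code x))//= big1 => [|I Ix].
  by rewrite addr0 indicE mem_set// mul1r.
by rewrite indicE memNset ?mul0r// => h; move: Ix; rewrite -h eqxx.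
Qed.

Lemma nrm_combE x :
  nrm (comb x) = \sum_(I : {set J}) \1_(atom I) x * nrm (\sum_(j in I) v j).
Proof.
rewrite (sum_atom (fun I : {set J} => nrm (\sum_(j in I) v j))); congr nrm.
rewrite [RHS]big_mkcond; apply: eq_bigr => j _.
by rewrite inE indicE; case: (x \in A j); rewrite ?scale1r ?scale0r.
Qed.

Lemma intg_nrm_comb : intg mu (nrm \o comb).
Proof.
rewrite (_ : _ \o _ = fun x => \sum_(I : {set J}) nrm (\sum_(j in I) v j) * \1_(atom I) x).
  apply: intg_sum => I _; apply: intgZ; apply: intg_indic1 => //.
  exact: measurable_atom.
by apply/funext => x; rewrite /= nrm_combE; apply: eq_bigr => I _; rewrite mulrC.
Qed.

(** The sets A j may overlap, so both sides are written over the atoms, where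
    the claim is the triangle inequality. *)
Lemma nrm_comb_int_le : nrm comb_int <= \int[mu]_x nrm (comb x).
Proof.
have iA I : intg mu (\1_(atom I)) by apply: intg_indic1 => //; exact: measurable_atom.
have muA j : fine (mu (A j)) = \sum_(I : {set J} | j \in I) fine (mu (atom I)).
  rewrite -Int_indic//.
  rewrite (eq_bigr (fun I : {set J} => \int[mu]_x \1_(atom I) x)); last first.
    by move=> I _; rewrite Int_indic//; exact: measurable_atom.
  rewrite -Int_sum//; apply: eq_Rintegral => x _.
  rewrite big_mkcond/= (eq_bigr (fun I : {set J} => \1_(atom I) x * (j \in I)%:R)).
    by rewrite (sum_atom (fun I : {set J} => (j \in I)%:R)) inE indicE.
  by move=> I _; case: ifP; rewrite ?mulr1 ?mulr0.
have -> : comb_int = \sum_(I : {set J}) (fine (mu (atom I)))%:C *: (\sum_(j in I) v j).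
  rewrite /comb_int (eq_bigr (fun j => \sum_(I : {set J} | j \in I)
    (fine (mu (atom I)))%:C *: v j)) => [|j _]; last first.
    by rewrite muA rmorph_sum/= scaler_suml.
  rewrite (exchange_big_dep xpredT)//=.
  by apply: eq_bigr => I _; rewrite scaler_sumr.
apply: le_trans (nrm_sum _ _ _) _.
under eq_Rintegral do rewrite nrm_combE.
rewrite Int_sum => [|I _]; last first.
  by apply: (@eq_integrable _ _ _ _ setT measurableT
    (EFin \o (fun x => nrm (\sum_(j in I) v j) * \1_(atom I) x))) (intgZ _ (iA I))
    => // x _ /=; rewrite mulrC.
apply: ler_sum => I _; rewrite nrmZr ger0_norm ?fine_ge0// mulrC.
under eq_Rintegral do rewrite mulrC.
by rewrite IntZ// Int_indic//; exact: measurable_atom.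
Qed.

End Combination.

Section Bochner.
Context {d} {T : measurableType d} {R : realType} {V : normedModType R[i]}.
Variable mu : {measure set T -> \bar R}.
Hypothesis mufin : (mu setT < +oo)%E.

Lemma simple_of_comb (J : finType) (A : J -> set T) (v : J -> V) :
  (forall j, measurable (A j)) ->
  exists S : simple_map V mu, (forall x, simple_eval S x = comb A v x) /\
    simple_integral S = comb_int mu A v.
Proof.
move=> mA.
pose A' (i : 'I_#|J|) := A (enum_val i).
have mA' i : measurable (A' i) by exact: mA.
exists (SimpleMap (fun i => v (enum_val i)) mA' (fun i => mu_fin mufin (mA' i))).
have e (F : J -> V) : \sum_(i < #|J|) F (enum_val i) = \sum_j F j.
  by rewrite -big_enum_val; apply: eq_bigl => j; rewrite inE.
split=> [x|]; first by rewrite /comb -e.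
by rewrite /comb_int -e.
Qed.

(** A form of Bochner integrability with an integrable majorant G k of the
    error. Unlike the error itself, the majorant can be built from the data
    and compared with other functions. *)
Definition approximates (F : T -> V) (z : V)
    (S : nat -> simple_map V mu) (G : nat -> T -> R) :=
  [/\ forall k, intg mu (G k) /\ forall x, 0 <= G k x,
      {ae mu, forall x, forall k, nrm (simple_eval (S k) x - F x) <= G k x},
      \int[mu]_x G k x @[k --> \oo] --> 0 &
      forall e : R, 0 < e ->
        exists K, forall k, (K <= k)%N -> nrm (simple_integral (S k) - z) <= e].

Lemma approximates_bochner F z S G : approximates F z S G ->
  {ae mu, forall x, G k x @[k --> \oo] --> 0} -> bochner_integral mu F z.
Proof.
move=> [GP FS G0 Sz] Gx; exists S; split.
- move: FS Gx; apply: filterS2 => x FS /cvgrPdist_lt Gx.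
  apply/cvg_nrmP => e e0; apply: filterS (Gx e e0) => k.
  by rewrite sub0r normrN => /(le_lt_trans (ler_norm _)); exact: le_lt_trans.
- apply: (@squeeze_cvge _ _ _ _ (cst 0%E) _ (fun k => (\int[mu]_x G k x)%:E)).
  + apply: nearW => k /=; apply/andP; split.
      by apply: integral_ge0 => x _; rewrite lee_fin nrm_ge0.
    rewrite -Int_EFin; last exact: (GP k).1.
    apply: ge0_ae_le_integral => [x|x|].
    * by rewrite lee_fin nrm_ge0.
    * by rewrite lee_fin; exact: (GP k).2.
    * by apply: filterS FS => x /(_ k); rewrite lee_fin.
  + exact: cvg_cst.
  + by apply: cvg_EFin => //; exact: nearW.
- apply/cvg_seq_nrmP => e e0.
  have [|K KP] := Sz (e / 2); first by rewrite divr_gt0.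
  exists K => k /KP /le_lt_trans; apply.
  by rewrite ltr_pdivrMr// ltr_pMr// ltr1n.
Qed.

(** The integral of the simple map S k - S' k is bounded by the integral of
    its norm q. This is at most the integral of G k plus the integral of the
    excess of q over G k, and the excess is bounded by the second
    approximation error almost everywhere. *)
Lemma approximates_unique F F' z z' S G : approximates F z S G ->
  {ae mu, forall x, F x = F' x} -> bochner_integral mu F' z' -> z = z'.
Proof.
move=> [GP FS G0 Sz] FF' [S' [_ S'F S'z]]; apply: nrm_le_eps => e e0.
have e4 : 0 < e / 4 by rewrite divr_gt0.
have [K1 K1P] := Sz _ e4.
have /cvg_seq_nrmP/(_ _ e4)[K2 K2P] := S'z.
have /cvgrPdist_lt/(_ _ e4)[K3 _ K3P] := G0.
have [K4 _ K4P] : \forall k \near \oo,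
    (\int[mu]_x (nrm (simple_eval (S' k) x - F' x))%:E <= (e / 4)%:E)%E.
  have : nbhs 0%E [set y : \bar R | (y <= (e / 4)%:E)%E].
    by exists (e / 4) => //= r /=; rewrite sub0r normrN lee_fin => /ltW/(le_trans (ler_norm _)).
  by move=> /S'F.
pose k := maxn (maxn K1 K2) (maxn K3 K4).
have /K1P H1 : (K1 <= k)%N by rewrite !leq_max leqnn.
have /K2P H2 : (K2 <= k)%N by rewrite !leq_max leqnn orbT.
have /K3P : (K3 <= k)%N by rewrite !leq_max leqnn !orbT.
rewrite /= sub0r normrN => /(le_lt_trans (ler_norm _)) H3.
have /K4P/= H4 : (K4 <= k)%N by rewrite !leq_max leqnn !orbT.
pose J := ('I_(simple_size (S k)) + 'I_(simple_size (S' k)))%type.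
pose A (j : J) := match j with inl i => @simple_set _ _ _ _ _ (S k) i
                           | inr i => @simple_set _ _ _ _ _ (S' k) i end.
pose w (j : J) : V := match j with inl i => @simple_val _ _ _ _ _ (S k) i
                           | inr i => - @simple_val _ _ _ _ _ (S' k) i end.
have mA j : measurable (A j) by case: j => i; exact: simple_meas.
have evE x : comb A w x = simple_eval (S k) x - simple_eval (S' k) x.
  rewrite /comb big_sumType/=; congr (_ + _).
  by rewrite /simple_eval -sumrN; apply: eq_bigr => i _; rewrite scalerN.
have intE : comb_int mu A w = simple_integral (S k) - simple_integral (S' k).
  rewrite /comb_int big_sumType/=; congr (_ + _).
  by rewrite /simple_integral -sumrN; apply: eq_bigr => i _; rewrite scalerN.
have H5 := nrm_comb_int_le mufin w mA; rewrite intE in H5.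
have iq := intg_nrm_comb mufin w mA.
have iG := (GP k).1.
pose q x := nrm (comb A w x).
(* the excess is measurable, whereas nrm (simple_eval (S' k) x - F' x) may not
   be *)
pose r x := Num.max (q x - G k x) 0.
have ir : intg mu r.
  apply: (@intg_le _ _ _ _ _ (fun x => q x - G k x)) => //; last exact: intgB.
    apply: measurable_maxr => //; exact: measurable_funB (intg_meas iq) (intg_meas iG).
  move=> x; rewrite /r; have [h|h] := leP (q x - G k x) 0.
    by rewrite normr0.
  exact: lexx.
have H6 : \int[mu]_x r x <= e / 4.
  rewrite -lee_fin -Int_EFin//; apply: le_trans H4.
  apply: ge0_ae_le_integral => [x|x|].
  - by rewrite lee_fin le_max lexx orbT.
  - by rewrite lee_fin nrm_ge0.
  - move: FS FF'; apply: filterS2 => x /(_ k) Gx FF'.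
    rewrite lee_fin /r ge_max nrm_ge0 andbT lerBlDr /q evE -FF'.
    rewrite -(subrKA (F x)) (le_trans (nrmD _ _))// addrC lerD// nrmC.
    exact: lexx.
have H7 : \int[mu]_x q x <= \int[mu]_x r x + \int[mu]_x G k x.
  rewrite -IntD//; apply: Int_le => //; first exact: intgD.
  by move=> x; rewrite -lerBlDr le_max lexx.
have := nrmD (z - simple_integral (S k)) (simple_integral (S k) - z').
rewrite addrA subrK => H8.
have := nrmD (simple_integral (S k) - simple_integral (S' k)) (simple_integral (S' k) - z').
rewrite addrA subrK => H9.
rewrite nrmC in H1.
have : e = e / 4 + e / 4 + e / 4 + e / 4 by field.
move: H1 H2 H3 H5 H6 H7 H8 H9; rewrite -/(q _); lra.
Qed.

End Bochner.

(** * Riemann sums *)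

Section SimpleLayers.
Context {d} {T : measurableType d} {R : realType}.
Import HBNNSimple.

Lemma simple_layers (u : T -> R) : measurable_fun setT u -> (forall x, 0 <= u x) ->
  exists w : nat -> T -> R,
  [/\ forall k, measurable_fun setT (w k), forall k x, 0 <= w k x <= u x,
      forall x, w k x @[k --> \oo] --> u x &
      forall k, exists q (c : 'I_q -> R) (E : 'I_q -> set T),
        (forall i, measurable (E i)) /\
        forall x, w k x = \sum_i c i * \1_(E i) x].
Proof.
move=> mu u0.
have mEu : measurable_fun setT (EFin \o u) by exact/measurable_EFinP.
have u0' x : setT x -> (0 <= (EFin \o u) x)%E by move=> _; rewrite /= lee_fin.
exists (fun k => nnsfun_approx measurableT mEu k); split.
- by move=> k; exact: measurable_funP.
- move=> k x; apply/andP; split; first exact: fun_ge0.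
  rewrite nnsfun_approxE -lee_fin.
  exact: (@le_approx _ _ _ setT (EFin \o u) k x u0' I).
- move=> x.
  by have /fine_cvg := @cvg_nnsfun_approx _ _ _ setT measurableT _ mEu u0' x I.
- move=> k; set h := nnsfun_approx _ _ k.
  pose s : seq R := finmap.enum_fset (fset_set (range h)).
  exists (size s), (fun i => s`_i), (fun i => h @^-1` [set s`_i]); split=> [i|x].
    exact: measurable_funPTI.
  rewrite {1}(fimfunE h) fsbig_finite//= (big_nth 0) big_mkord.
  by apply: eq_bigr => i _.
Qed.

End SimpleLayers.

Section Riemann.
Context {R : realType} {V : normedModType R[i]}.

Lemma lebE (t : R) (A : set R) : leb t A = lebesgue_measure (A `&` `[0, t]).
Proof. by []. Qed.

Lemma leb_fin (t : R) : (leb t setT < +oo)%E.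
Proof. by rewrite lebE setTI lebesgue_measure_itv/=; case: ifP => _; rewrite ltry. Qed.

(** Endpoints do not matter; the interval is open at 0 because controls vanish
    there. *)
Lemma ae_leb (t : R) : {ae leb t, forall s, 0 < s <= t}.
Proof.
exists (~` `]0, t]); split.
- by apply: measurableC; exact: measurable_itv.
- rewrite -[RHS](@lebesgue_measure_set1 R 0) -[RHS]/(_ _).
  apply/eqP; rewrite eq_le; apply/andP; split.
    rewrite lebE; apply: le_measure; rewrite ?inE//.
    + apply: measurableI; last exact: measurable_itv.
      by apply: measurableC; exact: measurable_itv.
    + move=> x [/= h]; rewrite in_itv/= => /andP[x0 xt].
      move: x0; rewrite le_eqVlt => /predU1P[//|x0].
      by exfalso; apply: h; rewrite in_itv/= x0.
  by rewrite lebesgue_measure_set1 measure_ge0.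
- by move=> x /= h; rewrite in_itv/=.
Qed.

Definition node (t : R) (k j : nat) : R := t * (j%:R / k.+1%:R).
Definition cell (t : R) (k j : nat) : set (measurableTypeR R) := `]node t k j, node t k j.+1].

Lemma node0 t k : node t k 0 = 0.
Proof. by rewrite /node mul0r mulr0. Qed.

Lemma nodeT t k : node t k k.+1 = t.
Proof. by rewrite /node divff ?mulr1. Qed.

Lemma nodeS t k j : node t k j.+1 = node t k j + t / k.+1%:R.
Proof. by rewrite /node -natr1 mulrDl mulrDr mul1r. Qed.

Lemma node_ge0 t k j : 0 <= t -> 0 <= node t k j.
Proof. by move=> t0; rewrite mulr_ge0// divr_ge0. Qed.

Lemma node_le t k j : 0 <= t -> (j <= k.+1)%N -> node t k j <= t.
Proof.
move=> t0 jk; rewrite -[leRHS](nodeT t k) ler_wpM2l// ler_pM2r ?invr_gt0//.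
by rewrite ler_nat.
Qed.

Lemma indic_itv (a b x : R) : a <= b ->
  \1_(`]a, b] : set R) x = (x <= b)%R%:R - (x <= a)%R%:R :> R.
Proof.
move=> ab; rewrite indicE.
have [xa|ax] := leP x a.
  rewrite (le_trans xa ab) subrr memNset//= in_itv/=.
  by rewrite ltNge xa.
have [xb|bx] := leP x b.
  by rewrite subr0 mem_set//= in_itv/= ax.
by rewrite subr0 memNset//= in_itv/= (leNgt x b) bx andbF.
Qed.

Lemma sum_cells t k x : 0 <= t ->
  \sum_(j < k.+1) \1_(cell t k j) x = (x <= t)%R%:R - (x <= 0)%R%:R :> R.
Proof.
move=> t0; rewrite -(big_mkord xpredT (fun j => \1_(cell t k j) x)).
under eq_bigr => j _.
  rewrite indic_itv; last by rewrite nodeS lerDl divr_ge0.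
  over.
by rewrite telescope_sumr// nodeT node0.
Qed.

Lemma measurable_cell t k j : measurable (cell t k j).
Proof. exact: measurable_itv. Qed.

Lemma cell_dist t k j x : 0 <= t -> cell t k j x ->
  `|node t k j.+1 - x| <= t / k.+1%:R /\ 0 <= x.
Proof.
move=> t0; rewrite /cell/= in_itv/= nodeS => /andP[xl xr]; split.
  by rewrite ger0_norm ?subr_ge0// lerBlDl lerD2r ltW.
by apply: le_trans (ltW xl); exact: node_ge0.
Qed.

(** In the simple maps S k, u is replaced by a simple function w k below it
    and v by its values at the right ends of the cells. With Mv a bound of v,
    the error is at most Mv (u - w k) + m k u, and this majorant tends to 0. *)
Lemma riemann_approximates (t : R) (u : R -> R) (v : R -> V) (m : nat -> R) (z : V) :
  0 <= t -> (forall x, 0 <= u x) -> intg (leb t) u ->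
  m k @[k --> \oo] --> 0 -> (forall k, 0 <= m k) ->
  (forall k r s, 0 <= r <= t -> 0 <= s <= t -> `|r - s| <= t / k.+1%:R ->
     nrm (v r - v s) <= m k) ->
  (forall e : R, 0 < e -> exists K, forall k, (K <= k)%N ->
     nrm (\sum_(j < k.+1) (\int[leb t]_x (u x * \1_(cell t k j) x))%:C
            *: v (node t k j.+1) - z) <= e) ->
  exists (S : nat -> simple_map V (leb t)) G,
    approximates (fun s : measurableTypeR R => (u s)%:C *: v s) z S G /\
    {ae leb t, forall x, G k x @[k --> \oo] --> 0}.
Proof.
move=> t0 u0 iu m0 m_ge0 vm Rz.
have lfin := leb_fin t.
have [w [mw wu w_cvg wE]] := simple_layers (intg_meas iu) u0.
have w0 k x : 0 <= w k x by have /andP[] := wu k x.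
have w_le k x : w k x <= u x by have /andP[] := wu k x.
have iw k : intg (leb t) (w k).
  by apply: intg_le iu => // x; rewrite !ger0_norm.
have iuw k : intg (leb t) (fun x => u x - w k x) by exact: intgB.
pose dk k := \int[leb t]_x (u x - w k x).
have dk0 k : 0 <= dk k by apply: Int_ge0 => x; rewrite subr_ge0.
have dk_cvg : dk k @[k --> \oo] --> 0.
  have [] := @dominated_convergence _ _ _ (leb t) setT measurableT
    (fun k x => (w k x)%:E) (EFin \o u) (EFin \o u).
  - by move=> k; exact/measurable_EFinP.
  - by apply/measurable_EFinP; exact: intg_meas iu.
  - apply: aeW => x _; apply: cvg_EFin; [exact: nearW|exact: w_cvg].
  - exact: iu.
  - by apply: aeW => x k _; rewrite /= lee_fin ger0_norm.
  move=> _ /fine_cvg h _.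
  rewrite (_ : (fun k => dk k) = fine \o
    [sequence \int[leb t]_x `|(w n x)%:E - (EFin \o u) x|]_n%E)//.
  apply/funext => k /=; rewrite /dk /Rintegral; congr fine.
  apply: eq_integral => x _ /=; rewrite distrC ger0_norm// subr_ge0//.
pose Mv := nrm (v 0) + m 0%N.
have vM r : 0 <= r <= t -> nrm (v r) <= Mv.
  move=> rt; rewrite -[v r](subrK (v 0)) addrC; apply: le_trans (nrmD _ _) _.
  rewrite lerD2l; apply: vm; rewrite ?lexx// subr0 divr1.
  by rewrite ger0_norm; case/andP: rt.
have Mv0 : 0 <= Mv by rewrite addr_ge0// nrm_ge0.
have nodeI k (j : 'I_k.+1) : 0 <= node t k j.+1 <= t.
  by rewrite node_ge0//= node_le.
have /choice[S SP] k : exists S : simple_map V (leb t),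
    (forall x, simple_eval S x =
       \sum_(j < k.+1) (\1_(cell t k j) x * w k x)%:C *: v (node t k j.+1)) /\
    simple_integral S =
       \sum_(j < k.+1) (\int[leb t]_x (w k x * \1_(cell t k j) x))%:C
         *: v (node t k j.+1).
  have [q [c [E [mE wkE]]]] := wE k.
  have mA (ji : 'I_k.+1 * 'I_q) : measurable (cell t k ji.1 `&` E ji.2).
    by apply: measurableI => //; exact: measurable_cell.
  have [S [Sx SI]] := simple_of_comb lfin
    (fun ji : 'I_k.+1 * 'I_q => (c ji.2)%:C *: v (node t k ji.1.+1)) mA.
  exists S; split=> [x|].
    rewrite Sx /comb -(pair_bigA _ (fun (j : 'I_k.+1) (i : 'I_q) =>
      (\1_(cell t k j `&` E i) x)%:C *: ((c i)%:C *: v (node t k j.+1))))/=.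
    apply: eq_bigr => j _; rewrite wkE mulr_sumr rmorph_sum/= scaler_suml.
    apply: eq_bigr => i _; rewrite scalerA -rmorphM/= indicI/=.
    by rewrite mulrA mulrAC.
  rewrite SI /comb_int -(pair_bigA _ (fun (j : 'I_k.+1) (i : 'I_q) =>
    (fine (leb t (cell t k j `&` E i)))%:C *: ((c i)%:C *: v (node t k j.+1))))/=.
  apply: eq_bigr => j _.
  rewrite (@eq_Rintegral _ _ _ _ _
    (fun x => \sum_i c i * \1_(cell t k j `&` E i) x)); last first.
    move=> x _; rewrite wkE mulr_suml; apply: eq_bigr => i _.
    by rewrite indicI/= -mulrA; congr (_ * _); rewrite mulrC.
  rewrite Int_sum => [|i _]; last first.
    by apply: intgZ; apply: intg_indic1 => //; exact: (mA (j, i)).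
  rewrite rmorph_sum/= scaler_suml; apply: eq_bigr => i _.
  rewrite IntZ ?Int_indic//; [|exact: (mA (j, i))|]; last first.
    by apply: intg_indic1 => //; exact: (mA (j, i)).
  by rewrite scalerA -rmorphM/= mulrC.
pose G k x := Mv * (u x - w k x) + m k * u x.
have iG k : intg (leb t) (G k) by apply: intgD; exact: intgZ.
exists S, G; split; last first.
  apply: aeW => x.
  have -> : 0 = Mv * (u x - u x) + 0 * u x by rewrite subrr mulr0 mul0r addr0.
  apply: cvgD; first by apply: cvgMr; apply: cvgB; [exact: cvg_cst|exact: w_cvg].
  exact: cvgMl.
split.
- move=> k; split=> // x.
  by rewrite addr_ge0// mulr_ge0// subr_ge0.
- apply: (ae_imp (ae_leb t)) => x /andP[x0 xt] k; rewrite (SP k).1.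
  have s1 : \sum_(j < k.+1) \1_(cell t k j) x = 1 :> R.
    by rewrite sum_cells// xt leNgt x0 subr0.
  have -> : (u x)%:C *: v x = \sum_(j < k.+1) (\1_(cell t k j) x * u x)%:C *: v x.
    by rewrite -scaler_suml -rmorph_sum/= -mulr_suml s1 mul1r.
  rewrite -sumrB; apply: le_trans (nrm_sum _ _ _) _.
  rewrite -[leRHS]mul1r -s1 mulr_suml; apply: ler_sum => j _.
  rewrite indicE; have [/set_mem xj|_] := boolP (x \in cell t k j); last first.
    by rewrite !mul0r !scale0r subrr nrm0.
  rewrite !mul1r.
  rewrite (_ : _ - _ = (w k x)%:C *: (v (node t k j.+1) - v x) - (u x - w k x)%:C *: v x).
    apply: le_trans (nrmB _ _) _; rewrite addrC !nrmZr /G.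
    rewrite !ger0_norm ?subr_ge0//; apply: lerD.
      by rewrite mulrC ler_wpM2r ?subr_ge0// vM// (ltW x0).
    rewrite mulrC; apply: ler_pM => //; first exact: nrm_ge0.
    by apply: vm; rewrite ?(ltW x0)//; have [] := cell_dist t0 xj.
  by rewrite scalerBr rmorphB scalerBl opprB addrA subrK.
- have -> : (fun k => \int[leb t]_x G k x) =
     (fun k => Mv * dk k + m k * \int[leb t]_x u x).
    by apply/funext => k; rewrite IntD ?IntZ//; exact: intgZ.
  have -> : 0 = Mv * 0 + 0 * \int[leb t]_x u x by rewrite mulr0 mul0r addr0.
  by apply: cvgD; [exact: cvgMr|exact: cvgMl].
- move=> e e0.
  have [K1 K1P] := Rz (e / 2) (divr_gt0 e0 (ltr0Sn _ _)).
  have e1 : 0 < e / 2 / (Mv + 1) by rewrite !divr_gt0// ltr_wpDl.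
  have /cvgrPdist_lt/(_ _ e1)[K2 _ K2P] := dk_cvg.
  exists (maxn K1 K2) => k; rewrite geq_max => /andP[/K1P H1 /K2P].
  rewrite sub0r normrN => /(le_lt_trans (ler_norm _)) H2.
  rewrite (SP k).2; set z1 := \sum_(j < k.+1) _ in H1 *; set z2 := \sum_(j < k.+1) _.
  have H3 : nrm (z2 - z1) <= dk k * Mv.
    rewrite nrmC -sumrB; apply: le_trans (nrm_sum _ _ _) _.
    apply: (@le_trans _ _ (\sum_(j < k.+1)
       \int[leb t]_x ((u x - w k x) * \1_(cell t k j) x) * Mv)).
      apply: ler_sum => j _; rewrite -scalerBl -rmorphB -IntB; last 2 first.
        by apply: intg_indic => //; exact: measurable_cell.
        by apply: intg_indic => //; exact: measurable_cell.
      under eq_Rintegral do rewrite -mulrBl.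
      rewrite nrmZr ger0_norm.
        by rewrite ler_wpM2l ?vM// Int_ge0// => x; rewrite mulr_ge0// subr_ge0.
      by rewrite Int_ge0// => x; rewrite mulr_ge0// subr_ge0.
    rewrite -mulr_suml ler_wpM2r// -Int_sum; last first.
      by move=> j _; apply: intg_indic => //; exact: measurable_cell.
    apply: Int_le => //.
      by apply: intg_sum => j _; apply: intg_indic => //; exact: measurable_cell.
    move=> x; rewrite -mulr_sumr ler_piMr ?subr_ge0// sum_cells//.
    by rewrite lerBlDr (le_trans (_ : _ <= 1))// ?lerDl//; case: (x <= t).
  have : dk k * Mv <= e / 2.
    apply: (@le_trans _ _ (dk k * (Mv + 1))); first by rewrite ler_wpM2l// lerDl.
    by rewrite -ler_pdivlMr ?ltr_wpDl// ltW.
  have := nrmD (z2 - z1) (z1 - z); rewrite addrA subrK.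
  move: H1 H3; lra.
Qed.

End Riemann.

(** * Real functions in L^p *)

Section ComplexVectors.
Context {R : realType} {m : nat}.
Implicit Types (c : 'cV[R[i]]_m).

Lemma RecnormE (z : R[i]) : Rec `|z| = Num.sqrt (Rec z ^+ 2 + Imc z ^+ 2).
Proof. by rewrite normc_def. Qed.

Lemma Recnorm_ge0 (z : R[i]) : 0 <= Rec `|z|.
Proof. by rewrite RecnormE sqrtr_ge0. Qed.

Lemma Rec_le_norm (z : R[i]) : `|Rec z| <= Rec `|z|.
Proof. by rewrite RecnormE -sqrtr_sqr ler_wsqrtr// lerDl sqr_ge0. Qed.

Lemma Imc_le_norm (z : R[i]) : `|Imc z| <= Rec `|z|.
Proof. by rewrite RecnormE -sqrtr_sqr ler_wsqrtr// lerDr sqr_ge0. Qed.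

Lemma norm_le_ReIm (z : R[i]) : Rec `|z| <= `|Rec z| + `|Imc z|.
Proof.
rewrite RecnormE -[leRHS]ger0_norm ?addr_ge0// -sqrtr_sqr ler_wsqrtr// sqrrD.
rewrite !real_normK ?num_real// [leRHS]addrAC lerDl.
by rewrite mulrn_wge0// mulr_ge0.
Qed.

Lemma coord_le_vnorm c j : Rec `|c j 0| <= vnorm c.
Proof.
rewrite /vnorm (bigD1 j)//= lerDl; apply: sumr_ge0 => i _.
exact: Recnorm_ge0.
Qed.

Lemma vnorm_le_coords c : vnorm c <= \sum_j (`|Rec (c j 0)| + `|Imc (c j 0)|).
Proof. by apply: ler_sum => j _; exact: norm_le_ReIm. Qed.

Lemma vnormZr (r : R) c : vnorm (r%:C *: c) = `|r| * vnorm c.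
Proof. by rewrite vnormZ normCr. Qed.

Lemma vnormN c : vnorm (- c) = vnorm c.
Proof. by rewrite -scaleN1r vnormZ normrN1 mul1r. Qed.

Lemma vnormB c c' : vnorm (c - c') = vnorm (c' - c).
Proof. by rewrite -vnormN opprB. Qed.

Lemma vnorm0 : vnorm (0 : 'cV[R[i]]_m) = 0.
Proof. by rewrite /vnorm big1// => i _; rewrite mxE normr0. Qed.

Lemma vnorm_sum (I : Type) (s : seq I) (P : pred I) (F : I -> 'cV[R[i]]_m) :
  vnorm (\sum_(i <- s | P i) F i) <= \sum_(i <- s | P i) vnorm (F i).
Proof.
elim/big_ind2 : _ => //; first by rewrite vnorm0.
by move=> x a y b xa yb; apply: le_trans (vnormD _ _) _; exact: lerD.
Qed.

Lemma RecM (a b : R[i]) : Rec (a * b) = Rec a * Rec b - Imc a * Imc b.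
Proof. by case: a b => [? ?] [? ?]. Qed.

Lemma ImcM (a b : R[i]) : Imc (a * b) = Rec a * Imc b + Imc a * Rec b.
Proof. by case: a b => [? ?] [? ?]. Qed.

Lemma RecD (a b : R[i]) : Rec (a + b) = Rec a + Rec b.
Proof. by case: a b => [? ?] [? ?]. Qed.

Lemma ImcD (a b : R[i]) : Imc (a + b) = Imc a + Imc b.
Proof. by case: a b => [? ?] [? ?]. Qed.

End ComplexVectors.

Section PNorm.
Context {d} {T : measurableType d} {R : realType}.
Variables (mu : {measure set T -> \bar R}) (p : R).
Hypothesis p1 : 1 <= p.
Implicit Types (h g : T -> R).

Let p0 : 0 <= p. Proof. by rewrite (le_trans _ p1). Qed.
Let pn0 : p != 0. Proof. by rewrite gt_eqF// (lt_le_trans _ p1). Qed.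
Let p1E : (1 <= p%:E)%E. Proof. by rewrite lee_fin. Qed.

Lemma Lnorm_leP h (C : R) : (forall x, 0 <= h x) -> 0 <= C ->
  ('N[mu]_p%:E[EFin \o h] <= C%:E)%E <->
  (\int[mu]_x (h x `^ p)%:E <= (C `^ p)%:E)%E.
Proof.
move=> h0 C0; have IE : (\int[mu]_x (h x `^ p)%:E = 'N[mu]_p%:E[EFin \o h] `^ p)%E.
  rewrite (poweR_Lnorm mu _ pn0); apply: eq_integral => x _ /=.
  by rewrite ger0_norm// poweR_EFin.
split=> [h1|].
  rewrite IE -poweR_EFin; apply: gt0_ler_poweR => //.
  - by rewrite in_itv /= Lnorm_ge0 leey.
  - by rewrite in_itv /= lee_fin C0 leey.
rewrite IE -poweR_EFin => h1.
have -> : ('N[mu]_p%:E[EFin \o h] = ('N[mu]_p%:E[EFin \o h] `^ p) `^ p^-1)%E.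
  by rewrite -poweRrM mulfV// poweRe1// Lnorm_ge0.
have -> : (C%:E = (C%:E `^ p) `^ p^-1)%E.
  by rewrite -poweRrM mulfV// poweRe1// lee_fin.
apply: gt0_ler_poweR => //; first by rewrite invr_ge0.
- by rewrite in_itv /= ?lee_fin ?powR_ge0 ?poweR_ge0 leey.
- by rewrite in_itv /= ?lee_fin ?powR_ge0 ?poweR_ge0 leey.
Qed.

Lemma measurable_powR h : measurable_fun setT h ->
  measurable_fun setT (fun x => h x `^ p).
Proof.
by move=> mh; apply: (@measurableT_comp _ _ _ _ _ _ (@powR R ^~ p)).
Qed.

Lemma Lnorm_ae_le h g : (forall x, 0 <= h x) -> (forall x, 0 <= g x) ->
  {ae mu, forall x, h x <= g x} ->
  ('N[mu]_p%:E[EFin \o h] <= 'N[mu]_p%:E[EFin \o g])%E.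
Proof.
move=> h0 g0 hg; rewrite unlock /Lnorm.
apply: gt0_ler_poweR; first by rewrite invr_ge0.
- by rewrite in_itv /= integral_ge0 ?leey// => x _; exact: poweR_ge0.
- by rewrite in_itv /= integral_ge0 ?leey// => x _; exact: poweR_ge0.
apply: ge0_ae_le_integral; [by move=> x; exact: poweR_ge0..|].
apply: (ae_imp hg) => x hgx; rewrite /= lee_fin ge0_ler_powR ?nnegrE//.
by rewrite !ger0_norm.
Qed.

Lemma Lfun_meas h : h \in Lfun mu p%:E -> measurable_fun setT h.
Proof. by move=> /sub_Lfun_mfun; rewrite inE. Qed.

Lemma Lfun_finiteP h : h \in Lfun mu p%:E <->
  measurable_fun setT h /\ ('N[mu]_p%:E[EFin \o h] < +oo)%E.
Proof.
split=> [hL|[mh nh]].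
  by split; [exact: Lfun_meas|have /andP[_] := hL; rewrite inE].
by apply/andP; rewrite !inE.
Qed.

Lemma Lnorm_normr h :
  ('N[mu]_p%:E[EFin \o (fun x => `|h x|%R)] = 'N[mu]_p%:E[EFin \o h])%E.
Proof. by rewrite -[X in Lnorm _ _ X]/(abse \o (EFin \o h)) Lnorm_abse. Qed.

Lemma Lfun_le h g : measurable_fun setT h -> g \in Lfun mu p%:E ->
  {ae mu, forall x, `|h x| <= `|g x|} -> h \in Lfun mu p%:E.
Proof.
move=> mh /Lfun_finiteP[mg ng] hg; apply/Lfun_finiteP; split=> //.
rewrite -Lnorm_normr; apply: le_lt_trans ng; rewrite -[leRHS]Lnorm_normr.
exact: Lnorm_ae_le.
Qed.

Lemma LfunD h g : h \in Lfun mu p%:E -> g \in Lfun mu p%:E ->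
  (fun x => h x + g x) \in Lfun mu p%:E.
Proof.
by move=> fL gL; have := (Lfun_submod_closed mu p1E).2 1 h g fL gL; rewrite scale1r.
Qed.

Lemma Lfun0 : (fun=> 0 : R) \in Lfun mu p%:E.
Proof. exact: (Lfun_submod_closed mu p1E).1. Qed.

Lemma LfunZ (a : R) h : h \in Lfun mu p%:E -> (fun x => a * h x) \in Lfun mu p%:E.
Proof.
by move=> fL; have := (Lfun_submod_closed mu p1E).2 a h 0 fL Lfun0; rewrite addr0.
Qed.

Lemma LfunB h g : h \in Lfun mu p%:E -> g \in Lfun mu p%:E ->
  (fun x => h x - g x) \in Lfun mu p%:E.
Proof.
move=> hL gL; rewrite (_ : (fun _ => _) = (fun x => h x + -1 * g x)).
  by apply: LfunD => //; exact: LfunZ.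
by apply/funext => x; rewrite mulN1r.
Qed.

Lemma Lfun_sum (I : Type) (s : seq I) (P : pred I) (F : I -> T -> R) :
  (forall i, P i -> F i \in Lfun mu p%:E) ->
  (fun x => \sum_(i <- s | P i) F i x) \in Lfun mu p%:E.
Proof.
move=> FL; elim: s => [|i s IH].
  by under eq_fun do rewrite big_nil; exact: Lfun0.
have [Pi|Pi] := boolP (P i); last first.
  by under eq_fun do rewrite big_cons (negbTE Pi).
under eq_fun do rewrite big_cons Pi.
by apply: LfunD => //; exact: FL.
Qed.

Lemma Lnorm_sum_le (h : nat -> T -> R) (C : nat -> R) (s : seq nat) :
  (forall k, h k \in Lfun mu p%:E) ->
  (forall k, ('N[mu]_p%:E[EFin \o h k] <= (C k)%:E)%E) ->
  ('N[mu]_p%:E[EFin \o (fun x => (\sum_(k <- s) h k x)%R)] <= (\sum_(k <- s) C k)%R%:E)%E.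
Proof.
move=> hL hC; elim: s => [|k s IH].
  rewrite big_nil (_ : _ \o _ = cst 0%E); first by rewrite Lnorm0// eqe.
  by apply/funext => x; rewrite /= big_nil.
rewrite big_cons EFinD.
have -> : EFin \o (fun x => \sum_(j <- k :: s) h j x) =
          EFin \o (h k \+ (fun x => \sum_(j <- s) h j x)).
  by apply/funext => x; rewrite /= big_cons.
have mS : measurable_fun setT (fun x => \sum_(j <- s) h j x).
  by apply: Lfun_meas; exact: Lfun_sum.
apply: le_trans (minkowski_EFin mu (Lfun_meas (hL k)) mS p1) _.
exact: leeD.
Qed.

Section Increasing.
Variables (h : nat -> T -> R) (C : R).
Hypothesis mh : forall k, measurable_fun setT (h k).
Hypothesis h0 : forall k x, 0 <= h k x.
Hypothesis h_nd : forall x, nondecreasing_seq (h^~ x).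
Hypothesis C0 : 0 <= C.
Hypothesis hC : forall k, ('N[mu]_p%:E[EFin \o h k] <= C%:E)%E.

Let L x := limn (fun k => (h k x `^ p)%:E).

Let hp_nd x : nondecreasing_seq (fun k => (h k x `^ p)%:E).
Proof.
move=> a b ab; rewrite lee_fin ge0_ler_powR ?nnegrE//.
exact: h_nd.
Qed.

Let hL k x : ((h k x `^ p)%:E <= L x)%E.
Proof.
apply: lime_ge; first exact: ereal_nondecreasing_is_cvgn.
by exists k => // j /= kj; exact: hp_nd.
Qed.

Let L0 x : (0 <= L x)%E.
Proof. by apply: le_trans (hL 0%N x); rewrite lee_fin powR_ge0. Qed.

Let mhp k : measurable_fun setT (fun x => (h k x `^ p)%:E).
Proof. by apply/measurable_EFinP; exact: measurable_powR. Qed.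

Let IL : (\int[mu]_x L x <= (C `^ p)%:E)%E.
Proof.
have g0 k x : setT x -> (0 <= (h k x `^ p)%:E)%E by rewrite lee_fin powR_ge0.
have nd x : setT x -> nondecreasing_seq (fun k => (h k x `^ p)%:E) by move=> _.
rewrite (monotone_convergence mu measurableT mhp g0 nd).
apply: lime_le.
  apply: ereal_nondecreasing_is_cvgn => a b ab.
  apply: ge0_ae_le_integral => [x|x|]; rewrite ?lee_fin ?powR_ge0//.
  by apply: aeW => x; exact: hp_nd.
by apply: nearW => k; apply/Lnorm_leP.
Qed.

Let mL : measurable_fun setT L.
Proof.
apply: (emeasurable_fun_cvg (fun k x => (h k x `^ p)%:E)) => // x _.
exact: ereal_nondecreasing_is_cvgn.
Qed.

(** By monotone convergence the limit of the p-th powers is integrable, hence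
    finite almost everywhere. *)
Lemma increasing_ae_bounded :
  {ae mu, forall x, exists M : R, forall k, h k x <= M}.
Proof.
have iL : mu.-integrable setT L.
  apply/integrableP; split=> //; under eq_integral do rewrite gee0_abs//.
  by apply: le_lt_trans IL _; rewrite ltry.
apply: (ae_imp (integrable_ae measurableT iL)) => x /(_ I) Lx.
exists ((fine (L x)) `^ p^-1) => k.
have -> : h k x = (h k x `^ p) `^ p^-1 by rewrite -powRrM mulfV// powRr1.
rewrite ge0_ler_powR ?nnegrE ?invr_ge0 ?powR_ge0 ?fine_ge0//.
by rewrite -lee_fin fineK.
Qed.

(** H is any function below all upper bounds of the h k, such as their
    supremum; it inherits their bound by monotone convergence. *)
Lemma increasing_sup_Lnorm (H : T -> R) : (forall x, 0 <= H x) ->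
  {ae mu, forall x, forall M, (forall k, h k x <= M) -> H x <= M} ->
  ('N[mu]_p%:E[EFin \o H] <= C%:E)%E.
Proof.
move=> H0 Hh; apply/Lnorm_leP => //; apply: le_trans IL.
apply: ge0_ae_le_integral => // [x|]; first by rewrite lee_fin powR_ge0.
apply: (ae_imp Hh) => x Hx; have [->|Lx] := eqVneq (L x) +oo%E; first exact: leey.
have Lf : L x \is a fin_num by rewrite ge0_fin_numE// lt_neqAle Lx leey.
have F0 : 0 <= fine (L x) by exact: fine_ge0.
rewrite -(fineK Lf) lee_fin.
have -> : fine (L x) = (fine (L x) `^ p^-1) `^ p by rewrite -powRrM mulVf// powRr1.
rewrite ge0_ler_powR ?nnegrE ?powR_ge0//; apply: Hx => k.
have -> : h k x = (h k x `^ p) `^ p^-1 by rewrite -powRrM mulfV// powRr1.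
rewrite ge0_ler_powR ?nnegrE ?invr_ge0 ?powR_ge0//.
by rewrite -lee_fin fineK.
Qed.

End Increasing.

End PNorm.

(** * Completeness of vector-valued L^p *)

Lemma Rec_coordB {R : realType} {m : nat} (c c' : 'cV[R[i]]_m) j :
  Rec ((c - c') j 0) = Rec (c j 0) - Rec (c' j 0).
Proof. by rewrite !mxE; case: (c j 0) (c' j 0) => [? ?] [? ?]. Qed.

Lemma Imc_coordB {R : realType} {m : nat} (c c' : 'cV[R[i]]_m) j :
  Imc ((c - c') j 0) = Imc (c j 0) - Imc (c' j 0).
Proof. by rewrite !mxE; case: (c j 0) (c' j 0) => [? ?] [? ?]. Qed.

Section Classes.
Context {d} {T : measurableType d} {R : realType}.
Variables (mu : {measure set T -> \bar R}) (p : R) (p1 : 1 <= p) (m : nat).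
Notation V := (vLspace mu m p1).
Implicit Types (f g : T -> 'cV[R[i]]_m) (x y : V).

(** A function outside L^p is sent to 0. *)
Definition cls f : V := vLclass (insubd (0 : vLfun mu m p1) f).

Lemma vLpP f : f \in vLp mu p1 <-> forall j,
  (fun s => Rec (f s j 0)) \in Lfun mu p%:E /\
  (fun s => Imc (f s j 0)) \in Lfun mu p%:E.
Proof. by split=> [/asboolP|h]; last exact/asboolP. Qed.

Lemma vLspace_fun_in x : vLspace_fun x \in vLp mu p1.
Proof. by rewrite /vLspace_fun; case: (repr x). Qed.

Lemma cls_val f : f \in vLp mu p1 ->
  (insubd (0 : vLfun mu m p1) f : T -> 'cV[R[i]]_m) = f.
Proof. by move=> fL; rewrite [LHS](@insubdK _ _ (vLfun mu m p1)). Qed.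

Lemma clsE f : f \in vLp mu p1 -> {ae mu, forall s, vLspace_fun (cls f) s = f s}.
Proof.
move=> fL; have := vLspace_funE (insubd (0 : vLfun mu m p1) f).
by rewrite cls_val// => h; apply: (ae_imp h) => s ->.
Qed.

Lemma cls_eq f g : f \in vLp mu p1 -> g \in vLp mu p1 ->
  {ae mu, forall s, f s = g s} -> cls f = cls g.
Proof.
move=> fL gL fg; apply/vLclassP; rewrite !cls_val//.
by apply: (ae_imp fg) => s -> _.
Qed.

Lemma cls_fun x : cls (vLspace_fun x) = x.
Proof.
rewrite -[RHS]vLclassK; apply/vLclassP; rewrite cls_val ?vLspace_fun_in//.
by apply: aeW.
Qed.

Lemma cls_ext f x : f \in vLp mu p1 ->
  {ae mu, forall s, vLspace_fun x s = f s} -> x = cls f.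
Proof.
by move=> fL xf; rewrite -[x]cls_fun; apply: cls_eq => //; exact: vLspace_fun_in.
Qed.

Lemma vLpD f g : f \in vLp mu p1 -> g \in vLp mu p1 ->
  (fun s => f s + g s) \in vLp mu p1.
Proof.
move=> fL gL; have [_ h] := vLp_submod_closed mu m p1.
have := h 1 f g fL gL; rewrite (_ : 1 *: f + g = fun s => f s + g s)//.
by apply/funext => s; rewrite -[LHS]/(1 *: f s + g s) scale1r.
Qed.

Lemma vLp0 : (fun=> 0 : 'cV[R[i]]_m) \in vLp mu p1.
Proof. by have [] := vLp_submod_closed mu m p1. Qed.

Lemma vLpZ (a : R[i]) f : f \in vLp mu p1 -> (fun s => a *: f s) \in vLp mu p1.
Proof.
move=> fL; have [h0 h] := vLp_submod_closed mu m p1.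
have := h a f 0 fL h0; rewrite (_ : a *: f + 0 = fun s => a *: f s)//.
by apply/funext => s; rewrite -[LHS]/(a *: f s + 0) addr0.
Qed.

Lemma vLpB f g : f \in vLp mu p1 -> g \in vLp mu p1 ->
  (fun s => f s - g s) \in vLp mu p1.
Proof.
move=> fL gL; rewrite (_ : (fun _ => _) = (fun s => f s + (-1) *: g s)).
  by apply: vLpD => //; exact: vLpZ.
by apply/funext => s; rewrite scaleN1r.
Qed.

Lemma vLp_sum (I : Type) (r : seq I) (P : pred I) (F : I -> T -> 'cV[R[i]]_m) :
  (forall i, P i -> F i \in vLp mu p1) ->
  (fun s => \sum_(i <- r | P i) F i s) \in vLp mu p1.
Proof.
move=> FL; elim: r => [|i r IH].
  by under eq_fun do rewrite big_nil; exact: vLp0.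
have [Pi|Pi] := boolP (P i); last first.
  by under eq_fun do rewrite big_cons (negbTE Pi).
under eq_fun do rewrite big_cons Pi.
by apply: vLpD => //; exact: FL.
Qed.

Lemma vLp_scale (a : T -> R) (c : 'cV[R[i]]_m) : a \in Lfun mu p%:E ->
  (fun s => (a s)%:C *: c) \in vLp mu p1.
Proof.
move=> aL; apply/vLpP => j; split.
  rewrite (_ : (fun _ => _) = (fun s => Rec (c j 0) * a s)); first exact: LfunZ.
  by apply/funext => s; rewrite mxE RecM/= mul0r subr0 mulrC.
rewrite (_ : (fun _ => _) = (fun s => Imc (c j 0) * a s)); first exact: LfunZ.
by apply/funext => s; rewrite mxE ImcM/= mul0r addr0 mulrC.
Qed.

Lemma clsD f g : f \in vLp mu p1 -> g \in vLp mu p1 ->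
  cls (fun s => f s + g s) = cls f + cls g.
Proof.
move=> fL gL; rewrite /cls -vLclassD; apply/vLclassP.
rewrite cls_val ?vLpD//; apply: aeW => s _.
by rewrite -[RHS]/(vLfun_fun _ s + vLfun_fun _ s) !cls_val.
Qed.

Lemma clsZ (a : R[i]) f : f \in vLp mu p1 -> cls (fun s => a *: f s) = a *: cls f.
Proof.
move=> fL; rewrite /cls [RHS]vLscaleE; apply/vLclassP.
rewrite cls_val ?vLpZ//; apply: aeW => s _.
by rewrite -[RHS]/(a *: vLfun_fun _ s) cls_val.
Qed.

Lemma clsN f : f \in vLp mu p1 -> cls (fun s => - f s) = - cls f.
Proof.
move=> fL; rewrite -scaleN1r -clsZ//; congr cls.
by apply/funext => s; rewrite scaleN1r.
Qed.

Lemma clsB f g : f \in vLp mu p1 -> g \in vLp mu p1 ->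
  cls (fun s => f s - g s) = cls f - cls g.
Proof.
move=> fL gL; rewrite clsD// ?clsN//.
rewrite (_ : (fun _ => _) = (fun s => (-1) *: g s)); first exact: vLpZ.
by apply/funext => s; rewrite scaleN1r.
Qed.

Lemma vnorm_in f : f \in vLp mu p1 -> (fun s => vnorm (f s)) \in Lfun mu p%:E.
Proof.
by move=> fL; have := vnorm_Lfun (insubd (0 : vLfun mu m p1) f); rewrite cls_val.
Qed.

Lemma vLp_meas f j : f \in vLp mu p1 ->
  measurable_fun setT (fun s => Rec (f s j 0)) /\
  measurable_fun setT (fun s => Imc (f s j 0)).
Proof.
by move=> /vLpP/(_ j)[fR fI]; split; [exact: Lfun_meas fR|exact: Lfun_meas fI].
Qed.

Lemma nrm_cls f : f \in vLp mu p1 ->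
  (nrm (cls f))%:E = 'N[mu]_p%:E[EFin \o (fun s => vnorm (f s))]%E.
Proof.
move=> fL; have := vLnorm_class (insubd (0 : vLfun mu m p1) f).
rewrite -[LHS]/`|cls f| -nrmE => /complexI ->; rewrite cls_val//.
have /Lfun_finiteP[_ nf] := vnorm_in fL.
by rewrite fineK// ge0_fin_numE ?Lnorm_ge0.
Qed.

Lemma vLp_le_vnorm f (h : T -> R) :
  (forall j, measurable_fun setT (fun s => Rec (f s j 0)) /\
             measurable_fun setT (fun s => Imc (f s j 0))) ->
  h \in Lfun mu p%:E -> {ae mu, forall s, vnorm (f s) <= h s} ->
  f \in vLp mu p1.
Proof.
move=> mf hL fh; apply/vLpP => j; have [mR mI] := mf j.
split; apply: (Lfun_le p1 _ hL) => //; apply: (ae_imp fh) => s fs;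
  apply: le_trans (ler_norm _); apply: le_trans fs;
  apply: le_trans (coord_le_vnorm _ j).
- exact: Rec_le_norm.
- exact: Imc_le_norm.
Qed.

Lemma cvgn_sum (I : Type) (r : seq I) (a : I -> nat -> R) (l : I -> R) :
  (forall i, a i k @[k --> \oo] --> l i) ->
  (\sum_(i <- r) a i k) @[k --> \oo] --> \sum_(i <- r) l i.
Proof.
move=> al; elim: r => [|i r IH].
  by under eq_fun do rewrite big_nil; rewrite big_nil; exact: cvg_cst.
under eq_fun do rewrite big_cons; rewrite big_cons.
by apply: cvgD; [exact: al|exact: IH].
Qed.

(** Absolutely summable increments. *)
Lemma bounded_variation_cvg (a : nat -> R) (M : R) :
  (forall k, \sum_(j < k) `|a j.+1 - a j| <= M) -> cvgn a.
Proof.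
move=> aM.
have cs : cvgn (series (fun j => a j.+1 - a j)).
  apply: normed_cvg; apply: nondecreasing_is_cvgn.
    by apply: nondecreasing_series => j _ _; rewrite normr_ge0.
  exists M => _ [k _ <-]; apply: le_trans (aM k).
  by rewrite -(big_mkord xpredT (fun j => `|a j.+1 - a j|)).
have -> : a = (fun k => series (fun j => a j.+1 - a j) k + a 0%N).
  by apply/funext => k; rewrite /series/= telescope_sumr// subrK.
by apply: is_cvgD => //; exact: is_cvg_cst.
Qed.

Lemma geometric_tail (a b : nat) : \sum_(a <= k < b) (3^-1 : R) ^+ k <= 3 / 2 * 3^-1 ^+ a.
Proof.
have [ab|ba] := leqP a b; last first.
  by rewrite big_geq ?mulr_ge0 ?exprn_ge0 ?divr_ge0 ?invr_ge0// ltnW.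
suff -> : \sum_(a <= k < b) (3^-1 : R) ^+ k = 3 / 2 * 3^-1 ^+ a - 3 / 2 * 3^-1 ^+ b.
  by rewrite lerBlDr lerDl mulr_ge0 ?exprn_ge0 ?divr_ge0 ?invr_ge0.
rewrite -opprB -(@telescope_sumr _ a b (fun k => 3 / 2 * 3^-1 ^+ k))// -sumrN.
apply: eq_bigr => k _; rewrite exprS; move: (3^-1 ^+ k) => r; lra.
Qed.

(** The Riesz-Fischer argument. The norms of the increments sum to a function
    in L^p, which is finite off a null set N; there all coordinates converge.
    The tails of the sum dominate the distance to the limit and have the
    required norm. *)
Lemma vLspace_geometrically_complete : @geometrically_complete R V.
Proof.
move=> x xS.
pose f k := vLspace_fun (x k).
have fL k : f k \in vLp mu p1 by exact: vLspace_fun_in.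
pose dd k s := vnorm (f k.+1 s - f k s).
have ddL k : dd k \in Lfun mu p%:E by apply: vnorm_in; exact: vLpB.
have dd0 k s : 0 <= dd k s by exact: vnorm_ge0.
have ddN k : ('N[mu]_p%:E[EFin \o dd k] <= (3^-1 ^+ k)%:E)%E.
  rewrite -[leLHS](@nrm_cls (fun s => f k.+1 s - f k s)); last exact: vLpB.
  by rewrite clsB// !cls_fun lee_fin.
pose h n k s := \sum_(n <= j < k) dd j s.
have h_nd n s : nondecreasing_seq (fun k => h n k s).
  apply/nondecreasing_seqP => k; rewrite /h.
  have [nk|kn] := leqP n k; first by rewrite big_nat_recr//= lerDl.
  by rewrite !big_geq// ltnW.
have h0 n k s : 0 <= h n k s by apply: sumr_ge0.
have mh n k : measurable_fun setT (h n k).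
  by apply: (@Lfun_meas _ _ _ mu p); apply: Lfun_sum.
have C0 n : 0 <= 3 / 2 * (3^-1 : R) ^+ n.
  by rewrite mulr_ge0 ?exprn_ge0 ?divr_ge0 ?invr_ge0.
have hN n k : ('N[mu]_p%:E[EFin \o h n k] <= (3 / 2 * 3^-1 ^+ n)%:E)%E.
  apply: le_trans (Lnorm_sum_le p1 (index_iota n k) ddL ddN) _.
  by rewrite lee_fin geometric_tail.
have [N [mN N0 badN]] := increasing_ae_bounded p1 (mh 0%N) (h0 0%N) (h_nd 0%N) (C0 0%N) (hN 0%N).
have good s : ~ N s -> exists M : R, forall k, h 0%N k s <= M.
  by move=> Ns; apply: contrapT => h'; apply: Ns; exact: badN.
pose f' k s := (\1_(~` N) s)%:C *: f k s.
have f'E k s : ~ N s -> f' k s = f k s.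
  by move=> Ns; rewrite /f' indicE mem_set// scale1r.
have f'0 k s : N s -> f' k s = 0.
  by move=> Ns; rewrite /f' indicE memNset ?scale0r// => /(_ Ns).
have cR j s : cvgn (fun k => Rec (f' k s j 0)).
  have [Ns|Ns] := pselect (N s).
    rewrite (_ : (fun _ => _) = fun=> 0); first exact: is_cvg_cst.
    by apply/funext => k; rewrite f'0// mxE.
  have [M hM] := good s Ns; apply: (@bounded_variation_cvg _ M) => k.
  apply: le_trans (hM k); rewrite /h big_mkord; apply: ler_sum => i _.
  rewrite !f'E//; apply: le_trans (coord_le_vnorm _ j).
  by apply: le_trans (Rec_le_norm _); rewrite Rec_coordB.
have cI j s : cvgn (fun k => Imc (f' k s j 0)).
  have [Ns|Ns] := pselect (N s).
    rewrite (_ : (fun _ => _) = fun=> 0); first exact: is_cvg_cst.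
    by apply/funext => k; rewrite f'0// mxE.
  have [M hM] := good s Ns; apply: (@bounded_variation_cvg _ M) => k.
  apply: le_trans (hM k); rewrite /h big_mkord; apply: ler_sum => i _.
  rewrite !f'E//; apply: le_trans (coord_le_vnorm _ j).
  by apply: le_trans (Imc_le_norm _); rewrite Imc_coordB.
pose g s : 'cV[R[i]]_m := \col_j
  (limn (fun k => Rec (f' k s j 0)) +i* limn (fun k => Imc (f' k s j 0))).
have mg j : measurable_fun setT (fun s => Rec (g s j 0)) /\
            measurable_fun setT (fun s => Imc (g s j 0)).
  split.
    apply: (measurable_fun_cvg (h := fun k s => Rec (f' k s j 0))) => [k|s _].
      rewrite (_ : (fun _ => _) = fun s => \1_(~` N) s * Rec (f k s j 0)).
        apply: measurable_funM; last exact: (vLp_meas j (fL k)).1.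
        by apply: measurable_indic; exact: measurableC.
      by apply/funext => s; rewrite /f' mxE RecM/= mul0r subr0.
    by rewrite mxE; exact: cR.
  apply: (measurable_fun_cvg (h := fun k s => Imc (f' k s j 0))) => [k|s _].
    rewrite (_ : (fun _ => _) = fun s => \1_(~` N) s * Imc (f k s j 0)).
      apply: measurable_funM; last exact: (vLp_meas j (fL k)).2.
      by apply: measurable_indic; exact: measurableC.
    by apply/funext => s; rewrite /f' mxE ImcM/= mul0r addr0.
  by rewrite mxE; exact: cI.
have gf' s : vnorm (g s - f' k s) @[k --> \oo] --> 0.
  apply: (@squeeze_cvgr _ _ _ _ (cst 0) (fun k => \sum_j
    (`|Rec ((g s - f' k s) j 0)| + `|Imc ((g s - f' k s) j 0)|))).
  - by apply: nearW => k /=; rewrite vnorm_ge0 vnorm_le_coords.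
  - exact: cvg_cst.
  - rewrite [X in _ --> X](_ : 0 = \sum_(j < m) (0 + 0)); last first.
      by rewrite big1// => j _; rewrite addr0.
    apply: cvgn_sum => j; apply: cvgD.
      rewrite -[X in _ --> X](@normr0 R R); apply: cvg_norm.
      rewrite (_ : (fun _ => _) = fun k => Rec (g s j 0) - Rec (f' k s j 0)).
        rewrite -[X in _ --> X](subrr (Rec (g s j 0))).
        by apply: cvgB; [exact: cvg_cst|rewrite mxE; exact: cR].
      by apply/funext => k; rewrite Rec_coordB.
    rewrite -[X in _ --> X](@normr0 R R); apply: cvg_norm.
    rewrite (_ : (fun _ => _) = fun k => Imc (g s j 0) - Imc (f' k s j 0)).
      rewrite -[X in _ --> X](subrr (Imc (g s j 0))).
      by apply: cvgB; [exact: cvg_cst|rewrite mxE; exact: cI].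
    by apply/funext => k; rewrite Imc_coordB.
have aeN : {ae mu, forall s, ~ N s}.
  by exists N; split=> // s /= h'; apply: contrapT.
have gN n : ('N[mu]_p%:E[EFin \o (fun s => vnorm (g s - f n s))] <=
             (3 / 2 * 3^-1 ^+ n)%:E)%E.
  apply: (increasing_sup_Lnorm p1 (mh n) (h0 n) (h_nd n) (C0 n) (hN n)).
    by move=> s; exact: vnorm_ge0.
  apply: (ae_imp aeN) => s Ns M hM.
  have step k : vnorm (f (n + k)%N s - f n s) <= h n (n + k)%N s.
    elim: k => [|k IH]; first by rewrite addn0 subrr vnorm0 /h big_geq.
    rewrite addnS /h big_nat_recr ?leq_addr//= -/(h _ _ _).
    rewrite -(subrKA (f (n + k)%N s)) [leRHS]addrC.
    by apply: le_trans (vnormD _ _) _; rewrite lerD.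
  apply/ler_addgt0Pr => e e0.
  have /cvgrPdist_lt/(_ e e0)[K _ KP] := gf' s.
  have /KP : (K <= n + K)%N by rewrite leq_addl.
  rewrite sub0r normrN ger0_norm ?vnorm_ge0// f'E// => /ltW H1.
  rewrite -(subrKA (f (n + K)%N s)) [leRHS]addrC; apply: le_trans (vnormD _ _) _.
  rewrite lerD//; exact: le_trans (step K) (hM _).
have mNC : measurable (~` N) by exact: measurableC.
have f'L k : f' k \in vLp mu p1.
  apply/vLpP => j; have /vLpP/(_ j)[kR kI] := fL k.
  split; [apply: (Lfun_le p1 _ kR)|apply: (Lfun_le p1 _ kI)].
  - rewrite (_ : (fun _ => _) = fun s => \1_(~` N) s * Rec (f k s j 0)).
      by apply: measurable_funM; [exact: measurable_indic|exact: (vLp_meas j (fL k)).1].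
    by apply/funext => s; rewrite mxE RecM/= mul0r subr0.
  - by apply: (ae_imp aeN) => s Ns; rewrite f'E.
  - rewrite (_ : (fun _ => _) = fun s => \1_(~` N) s * Imc (f k s j 0)).
      by apply: measurable_funM; [exact: measurable_indic|exact: (vLp_meas j (fL k)).2].
    by apply/funext => s; rewrite mxE ImcM/= mul0r addr0.
  - by apply: (ae_imp aeN) => s Ns; rewrite f'E.
have gB : (fun s => vnorm (g s - f 0%N s)) \in Lfun mu p%:E.
  apply/Lfun_finiteP; split; last by apply: le_lt_trans (gN 0%N) _; rewrite ltry.
  apply: (measurable_fun_cvg (h := fun k s => vnorm (f' k s - f 0%N s) )) => [k|s _].
    by apply: (@Lfun_meas _ _ _ mu p); apply: vnorm_in; exact: vLpB.
  apply/cvgrPdist_le => e e0; have /cvgrPdist_le/(_ e e0) := gf' s.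
  apply: filterS => k; rewrite sub0r normrN ger0_norm ?vnorm_ge0// => /(le_trans _); apply.
  have := vnormD (g s - f' k s) (f' k s - f 0%N s); rewrite addrA subrK => H1.
  have := vnormD (f' k s - g s) (g s - f 0%N s); rewrite addrA subrK => H2.
  by rewrite ler_norml; apply/andP; split; move: H1 H2; rewrite (vnormB (f' k s) (g s)); lra.
have gL : g \in vLp mu p1.
  apply: (@vLp_le_vnorm _ (fun s => vnorm (g s - f 0%N s) + vnorm (f 0%N s))) => //.
    by apply: LfunD => //; exact: vnorm_in.
  by apply: aeW => s; rewrite -{1}(subrK (f 0%N s) (g s)) vnormD.
exists (cls g) => n; rewrite -lee_fin; apply: le_trans (gN n).
have -> : cls g - x n = cls (fun s => g s - f n s) by rewrite clsB// cls_fun.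
by rewrite nrm_cls//; exact: vLpB.
Qed.

End Classes.

(** * Lebesgue integrals on the line *)

Section Line.
Context {R : realType}.
Notation lam := (@lebesgue_measure R).
Notation RR := (measurableTypeR R).
Implicit Types (f g w : RR -> R).

Lemma intg_ae_le d (T : measurableType d) (mu : {measure set T -> \bar R})
    (f g : T -> R) : measurable_fun setT f -> intg mu g ->
  {ae mu, forall x, `|f x| <= `|g x|} -> intg mu f.
Proof.
move=> mf /integrableP[_ gi] fg; apply/integrableP; split.
  exact/measurable_EFinP.
apply: le_lt_trans gi; apply: ge0_ae_le_integral => //.
Qed.

Lemma integral_leb (t : R) (f : RR -> \bar R) : measurable_fun setT f ->
  (\int[leb t]_x f x = \int[lam]_(x in `[0%R, t]) f x)%E.
Proof.
move=> mf; have mI : measurable (`[0, t]%classic : set RR) by exact: measurable_itv.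
have -> : (\int[leb t]_x f x = \int[leb t]_(x in `[0%R, t]) f x)%E.
  rewrite [RHS]integral_mkcond; apply: ae_eq_integral => //.
    by apply/(measurable_restrictT _ _).1 => //; exact: measurable_funTS.
  have h := ae_leb t; apply: (ae_imp h) => x /andP[x0 xt] _.
  by rewrite patchE mem_set//= in_itv/= (ltW x0).
apply: eq_measure_integral => A mA AI.
by rewrite lebE; congr (lebesgue_measure _); exact/setIidPl.
Qed.

Lemma measurable_itvRR (i : interval R) : measurable ([set` i] : set RR).
Proof. exact: measurable_itv. Qed.

Lemma measurable_indic_itv (i : interval R) :
  measurable_fun setT (\1_([set` i]) : RR -> R).
Proof. by apply: measurable_indic; exact: measurable_itvRR. Qed.

Lemma integral_indicE (A : set RR) (f : RR -> R) :
  (\int[lam]_(x in A) (f x)%:E = \int[lam]_x (f x * \1_A x)%:E)%E.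
Proof.
rewrite integral_mkcond; apply: eq_integral => x _.
by rewrite patchE indicE; case: ifPn => _; rewrite ?mulr1 ?mulr0.
Qed.

Lemma Int_leb (t : R) f : measurable_fun setT f ->
  \int[leb t]_x f x = \int[lam]_x (f x * \1_(`[0, t]) x).
Proof.
move=> mf; rewrite /Rintegral -(integral_indicE `[0, t] f); congr fine.
by apply: (@integral_leb t (EFin \o f)); exact/measurable_EFinP.
Qed.

Lemma intg_leb (t : R) f : measurable_fun setT f ->
  intg (leb t) f <-> intg lam (fun x => f x * \1_(`[0, t]) x).
Proof.
move=> mf.
have mf1 : measurable_fun setT (fun x : RR => f x * \1_(`[0, t]) x).
  by apply: measurable_funM => //; exact: measurable_indic_itv.
have E : (\int[leb t]_x `|(f x)%:E| = \int[lam]_x `|(f x * \1_(`[0%R, t]) x)%:E|)%E.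
  rewrite integral_leb; last by apply/measurable_EFinP; exact: measurableT_comp.
  rewrite (integral_indicE _ (fun x => `|f x|)); apply: eq_integral => x _ /=.
  by rewrite normrM [X in _ = (_ * X)%:E]ger0_norm// indicE.
by split=> /integrableP[_ h]; apply/integrableP; split;
  rewrite ?E// -?E//; apply/measurable_EFinP.
Qed.

Lemma measurable_shift (c : R) : measurable_fun setT ((fun x => c + x) : RR -> RR).
Proof. exact: measurable_funD. Qed.

Lemma lebesgue_measure_shift (c : R) (A : set RR) : measurable A ->
  pushforward lam ((fun x => c + x) : RR -> RR) A = lam A.
Proof.
move=> mA; apply/esym/lebesgue_measure_unique => //.
  exact: measurable_shift.
move=> mshift _ [[a b]] _ <-.
rewrite /= /pushforward (_ : _ @^-1` _ = `]a - c, b - c]%classic); last first.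
  by apply/seteqP; split=> x /=; rewrite !in_itv/= ltrBlDl lerBrDl.
rewrite !lebesgue_measure_itv/= !lte_fin ltrD2r; case: ifP => // _.
by rewrite -!EFinB opprB addrA subrK.
Qed.

Lemma measurable_comp_shift (c : R) f : measurable_fun setT f ->
  measurable_fun setT (fun x : RR => f (c + x)).
Proof. by move=> mf; apply: measurableT_comp mf (measurable_shift c). Qed.

Lemma ge0_integral_shift (c : R) (f : RR -> \bar R) : measurable_fun setT f ->
  (forall x, 0 <= f x)%E -> (\int[lam]_x f (c + x)%R = \int[lam]_x f x)%E.
Proof.
move=> mf f0; have := ge0_integral_pushforward (measurable_shift c) lam
  measurableT mf (fun x _ => f0 x).
rewrite preimage_setT => <-; apply: eq_measure_integral.
  exact: measurable_shift.
by move=> ms A mA _; exact: lebesgue_measure_shift.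
Qed.

Lemma intg_shift (c : R) f : intg lam f -> intg lam (fun x => f (c + x)).
Proof.
move=> fi; have mf := intg_meas fi; move: fi => /integrableP[_ fi].
apply/integrableP; split.
  by apply/measurable_EFinP; exact: measurable_comp_shift.
rewrite (ge0_integral_shift c (f := fun x => `|(f x)%:E|%E))//.
by apply/measurable_EFinP; exact: measurableT_comp.
Qed.

Lemma Int_shift (c : R) f : intg lam f ->
  \int[lam]_x f (c + x) = \int[lam]_x f x.
Proof.
move=> fi; have mf := intg_meas fi.
rewrite /Rintegral; congr fine.
have := @integral_pushforward _ _ _ _ _ _ (measurable_shift c) lam setT (EFin \o f).
rewrite preimage_setT => /(_ _ (intg_shift c fi) measurableT) <-; last exact/measurable_EFinP.
apply: eq_measure_integral; first exact: measurable_shift.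
by move=> ms A mA _; exact: lebesgue_measure_shift.
Qed.

Lemma measurable_indic_le :
  measurable_fun setT (fun z : RR * RR => (z.1 <= z.2)%R%:R : R).
Proof.
have -> : (fun z : RR * RR => (z.1 <= z.2)%R%:R : R) =
          \1_([set z : RR * RR | (z.1 <= z.2)%R]).
  apply/funext => z; rewrite indicE; case: leP => h.
    by rewrite mem_set.
  by rewrite memNset//= leNgt h.
apply: measurable_indic.
have := @measurable_fun_ler _ _ R setT (fun z : RR * RR => z.1) (fun z => z.2)
  measurable_fst measurable_snd measurableT [set true] I.
rewrite setTI (_ : _ @^-1` _ = [set z : RR * RR | (z.1 <= z.2)%R])//.
Qed.

(** Fubini on the triangle x <= y. *)
Lemma Fubini_le f g : intg lam f -> intg lam g ->
  \int[lam]_y ((\int[lam]_x (f x * (x <= y)%R%:R)) * g y) =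
  \int[lam]_x (f x * \int[lam]_y ((x <= y)%R%:R * g y)).
Proof.
move=> fi gi; have mf := intg_meas fi; have mg := intg_meas gi.
pose k (z : RR * RR) := f z.1 * (z.1 <= z.2)%R%:R * g z.2.
have mk : measurable_fun setT k.
  apply: measurable_funM; last by apply: measurableT_comp mg measurable_snd.
  apply: measurable_funM; last exact: measurable_indic_le.
  by apply: measurableT_comp mf measurable_fst.
have b01 (b : bool) : `|b%:R : R| <= 1 by case: b; rewrite ?normr1 ?normr0.
have mle1 (x : R) : measurable_fun setT (fun y : RR => (x <= y)%R%:R : R).
  exact: measurable_fun_pair2 x measurable_indic_le.
have mle2 (y : R) : measurable_fun setT (fun x : RR => (x <= y)%R%:R : R).
  exact: measurable_fun_pair1 y measurable_indic_le.
have gi1 (x : R) : intg lam (fun y => (x <= y)%R%:R * g y).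
  under eq_fun do rewrite mulrC.
  exact: (@intg_mulr_bounded _ _ _ _ _ _ 1).
have fi1 (y : R) : intg lam (fun x => f x * (x <= y)%R%:R).
  exact: (@intg_mulr_bounded _ _ _ _ _ _ 1).
have ik : (lam \x lam)%E.-integrable setT (EFin \o k).
  apply/integrable12ltyP; first exact/measurable_EFinP.
  apply: (@le_lt_trans _ _ (\int[lam]_x (`|f x| * \int[lam]_y `|g y|)%:E)%E).
    apply: ge0_ae_le_integral => [x|x|].
    - exact: integral_ge0.
    - by rewrite lee_fin mulr_ge0// Int_ge0.
    apply: aeW => x; rewrite EFinM -Int_EFin; last exact: intg_norm.
    rewrite -ge0_integralZl_EFin//; last first.
      by apply/measurable_EFinP; exact: measurableT_comp.
    apply: ge0_ae_le_integral => //.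
    by apply: aeW => y; rewrite /= lee_fin !normrM ler_wpM2r// ler_piMr.
  under eq_integral do rewrite mulrC.
  rewrite Int_EFin ?ltry//; apply: intgZ; exact: intg_norm.
have := Fubini ik.
rewrite (_ : (\int[lam]_x \int[lam]_y (EFin \o k) (x, y))%E =
  (\int[lam]_x (f x * \int[lam]_y ((x <= y)%R%:R * g y))%:E)%E); last first.
  apply: eq_integral => x _; rewrite -IntZ// -Int_EFin; last exact: intgZ.
  by apply: eq_integral => y _; rewrite /= /k/= mulrA.
rewrite (_ : (\int[lam]_y \int[lam]_x (EFin \o k) (x, y))%E =
  (\int[lam]_y ((\int[lam]_x (f x * (x <= y)%R%:R)) * g y)%:E)%E); last first.
  apply: eq_integral => y _; rewrite mulrC -IntZ// -Int_EFin; last exact: intgZ.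
  by apply: eq_integral => x _; rewrite /= /k/= mulrC.
by move=> h; rewrite /Rintegral h.
Qed.

End Line.

(** * Primitives and integration by parts *)

Section Primitives.
Context {R : realType}.
Notation lam := (@lebesgue_measure R).
Notation RR := (measurableTypeR R).

(** The absolutely continuous functions on [0, 1] with derivative w. The
    indicator in the integrand keeps all integrals with respect to the same
    measure. *)
Definition prim01 (W w : R -> R) := forall s, 0 <= s <= 1 ->
  W s = W 0 + \int[leb 1]_r (w r * \1_(`]0, s]) r).

Section TestFunction.
Variable phi : R -> R.
Hypothesis tphi : test_function phi.

Lemma test_out s : ~~ (0 < s < 1) -> phi s = 0.
Proof.
case: tphi => _ _ [a [b [a0 b1 h]]] hs; apply: h.
apply: contra hs => /andP[as_ sb].
by rewrite (lt_le_trans a0)// (le_lt_trans sb).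
Qed.

Lemma test_continuous : continuous phi.
Proof.
move=> s; apply/differentiable_continuous/derivable1_diffP.
by case: tphi => + _ _; exact.
Qed.

Lemma test_measurable : measurable_fun setT (phi : RR -> R).
Proof. exact: continuous_measurable_fun test_continuous. Qed.

Lemma test_derive_measurable : measurable_fun setT (derive1 phi : RR -> R).
Proof. by apply: continuous_measurable_fun; case: tphi. Qed.

Lemma continuous_bounded01 (f : R -> R) : continuous f ->
  exists C, forall s, 0 <= s <= 1 -> `|f s| <= C.
Proof.
move=> cf; have cn : {within `[0, 1], continuous (fun s => `|f s|)}.
  apply: continuous_subspaceT => s.
  by apply: continuous_comp; [exact: cf|exact: norm_continuous].
have [c _ cP] := EVT_max (@ler01 R) cn.
by exists `|f c| => s s01; apply: cP; rewrite in_itv.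
Qed.

Lemma intg_mul_continuous (w f : R -> R) : continuous f -> intg (leb 1) w ->
  intg (leb 1) (fun s => w s * f s).
Proof.
move=> cf wi; have [C CP] := continuous_bounded01 cf.
apply: (@intg_ae_le _ _ _ _ _ (fun s : RR => C * w s)); last 2 first.
- exact: intgZ.
- have h := @ae_leb R 1; apply: (ae_imp h) => s /andP[s0 s1].
  have fC : `|f s| <= C by apply: CP; rewrite (ltW s0).
  by rewrite !normrM mulrC ler_wpM2r// (le_trans fC)// ler_norm.
apply: measurable_funM; first exact: intg_meas wi.
exact: continuous_measurable_fun cf.
Qed.

Lemma intg_cst1 : intg (leb 1) (cst (1 : R)).
Proof. by apply: (@intg_bounded _ _ _ _ (leb_fin 1) _ 1) => // x; rewrite normr1. Qed.

Lemma intg_test_derive : intg lam (fun s => derive1 phi s * \1_(`[0, 1]) s).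
Proof.
apply/intg_leb; first exact: test_derive_measurable.
have c : continuous (derive1 phi) by case: tphi.
have := intg_mul_continuous c intg_cst1.
by under eq_fun do rewrite /cst mul1r.
Qed.

(** The right end 1 does not contribute, since a test function vanishes there. *)
Lemma test_FTC r : 0 <= r <= 1 ->
  \int[lam]_y ((r <= y)%R%:R * (derive1 phi y * \1_(`[0, 1]) y)) = - phi r.
Proof.
move=> /andP[r0]; have p1 : phi 1 = 0 by apply: test_out; rewrite ltxx andbF.
have E : (\int[lam]_y ((r <= y)%R%:R * (derive1 phi y * \1_(`[0, 1]) y))%:E =
          \int[lam]_(y in `[r, 1%R]) (derive1 phi y)%:E)%E.
  rewrite [RHS]integral_indicE; apply: eq_integral => y _; congr EFin.
  rewrite !indicE mulrCA; congr (_ * _).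
  have [ry|yr] := leP r y; last first.
    by rewrite mul0r memNset//= in_itv/= leNgt yr.
  rewrite mul1r; have [y1|y1] := leP y 1.
    by rewrite !mem_set//= in_itv/= ?ry ?(le_trans r0 ry).
  by rewrite !memNset//= in_itv/= (leNgt y 1) y1 andbF.
rewrite /Rintegral E le_eqVlt => /predU1P[->|r1].
  by rewrite p1 oppr0 set_itv1 integral_set1.
have [dphi cphi _] := tphi.
rewrite (continuous_FTC2 (f := derive1 phi) (F := phi) r1).
- by rewrite p1 -EFinB /= sub0r.
- exact: continuous_subspaceT.
- split; first by move=> x _; exact: dphi.
    by apply: cvg_at_right_filter; exact: test_continuous.
  by apply: cvg_at_left_filter; exact: test_continuous.
- by move=> x _.
Qed.

(** W is only absolutely continuous, so W is replaced by the integral of w and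
    the order of integration is exchanged; the inner integral is then given by
    test_FTC. *)
Lemma integration_by_parts01 (W w : R -> R) :
  measurable_fun setT (W : RR -> R) -> intg (leb 1) w -> prim01 W w ->
  \int[leb 1]_s (W s * derive1 phi s) = - \int[leb 1]_s (w s * phi s).
Proof.
move=> mW wi Ww; have mw : measurable_fun setT (w : RR -> R) := intg_meas wi.
have mdphi := test_derive_measurable.
pose a (s : RR) := w s * \1_(`]0, 1]) s.
pose b (s : RR) := derive1 phi s * \1_(`[0, 1]) s.
have ib : intg lam b := intg_test_derive.
have ia : intg lam a.
  have /(intg_leb _ mw) h := wi.
  apply: (intg_le _ _ h); first by apply: measurable_funM => //; exact: measurable_indic_itv.
  move=> s; rewrite !normrM ler_wpM2l// !indicE.
  have [/set_mem h1|_] := boolP (s \in `]0, 1]%classic); last by rewrite normr0.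
  rewrite mem_set// /=; move: h1; rewrite /= !in_itv/= => /andP[/ltW -> ->] //.
have b0 s : ~~ (0 <= s <= 1) -> b s = 0.
  by move=> hs; rewrite /b indicE memNset ?mulr0//= in_itv/=; exact/negP.
have WE s : W s * b s = W 0 * b s + (\int[lam]_x (a x * (x <= s)%R%:R)) * b s.
  have [s01|/b0 ->] := boolP (0 <= s <= 1); last by rewrite !mulr0 addr0.
  rewrite -mulrDl Ww//; congr ((_ + _) * _).
  rewrite Int_leb; last by apply: measurable_funM => //; exact: measurable_indic_itv.
  apply: eq_Rintegral => x _; rewrite /a -!mulrA; congr (_ * _).
  case/andP: s01 => s0 s1; rewrite !indicE.
  have [x0|x0] := leP x 0.
    by rewrite !(memNset (A := `]0, _]%classic)) ?mul0r//= in_itv/= ltNge x0.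
  have [xs|sx] := leP x s.
    by rewrite !mem_set ?mulr1//= in_itv/= ?x0 ?(ltW x0) ?xs ?(le_trans xs s1).
  by rewrite mulr0 (memNset (A := `]0, s]%classic)) ?mul0r//= in_itv/= (leNgt x s) sx andbF.
have iWb : intg lam (fun s => W s * b s).
  apply: (@intg_le _ _ _ _ _ (fun s => (`|W 0| + \int[lam]_x `|a x|) * b s)).
  - by apply: measurable_funM => //; exact: intg_meas ib.
  - move=> s; rewrite WE -mulrDl !normrM ler_wpM2r//.
    rewrite [leRHS]ger0_norm; last by rewrite addr_ge0// Int_ge0.
    apply: le_trans (ler_normD _ _) _; rewrite lerD2l.
    have ia1 : intg lam (fun x => a x * (x <= s)%R%:R).
      apply: (@intg_mulr_bounded _ _ _ _ _ _ 1) => //.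
        exact: measurable_fun_pair1 s measurable_indic_le.
      by move=> x; case: (x <= s); rewrite ?normr1 ?normr0.
    apply: le_trans (Int_norm ia1) _; apply: Int_le => [||x].
    + exact: intg_norm.
    + exact: intg_norm.
    + by rewrite normrM ler_piMr//; case: (x <= s); rewrite ?normr1 ?normr0.
  - exact: intgZ.
rewrite Int_leb; last by apply: measurable_funM.
under eq_Rintegral do rewrite -mulrA -/(b _).
have i0b : intg lam (fun s => W 0 * b s) by exact: intgZ.
have iab : intg lam (fun s => (\int[lam]_x (a x * (x <= s)%R%:R)) * b s).
  have := intgB iWb i0b; apply: eq_integrable => // s _ /=.
  by rewrite WE addrAC subrr add0r.
under eq_Rintegral do rewrite WE.
rewrite IntD// IntZ// Fubini_le//.
have -> : \int[lam]_x b x = 0.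
  have := @test_FTC 0; rewrite lexx ler01 => /(_ isT).
  rewrite (@test_out 0) ?ltxx// oppr0 => <-; apply: eq_Rintegral => y _.
  have [y0|y0] := leP 0 y; first by rewrite mul1r.
  by rewrite mul0r b0// negb_and -ltNge y0.
rewrite mulr0 add0r.
have -> : \int[lam]_x (a x * \int[lam]_y ((x <= y)%R%:R * b y)) =
          \int[lam]_x (-1 * (w x * phi x * \1_(`[0, 1]) x)).
  apply: eq_Rintegral => x _; rewrite /a mulN1r.
  have [x01|x01] := boolP (0 < x <= 1).
    rewrite test_FTC; last by case/andP: x01 => /ltW -> ->.
    rewrite !indicE !mem_set//= ?in_itv/= ?x01//; last first.
      by case/andP: x01 => /ltW -> ->.
    by rewrite !mulr1 mulrN.
  rewrite indicE memNset; last by rewrite /= in_itv/=; exact/negP.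
  rewrite mulr0 mul0r test_out ?mulr0 ?mul0r ?oppr0//.
  by apply: contra x01 => /andP[-> /ltW].
have iwp : intg (leb 1) (fun s => w s * phi s).
  exact: intg_mul_continuous test_continuous wi.
have mwp : measurable_fun setT (fun s : RR => w s * phi s) := intg_meas iwp.
rewrite IntZ; last by apply/intg_leb.
by rewrite mulN1r -Int_leb.
Qed.

End TestFunction.

Lemma prim01_continuous (W w : R -> R) : intg (leb 1) w -> prim01 W w ->
  {within `[0, 1], continuous W}.
Proof.
move=> wi Ww; have mw : measurable_fun setT (w : RR -> R) := intg_meas wi.
have i01 : lam.-integrable `[0, 1] (EFin \o w).
  have /(intg_leb _ mw) h := wi.
  apply/(@integrable_mkcond _ _ _ lam _ (EFin \o w) (measurable_itvRR _)).
  apply: eq_integrable h => // x _ /=.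
  by rewrite patchE indicE; case: ifPn => _; rewrite ?mulr1 ?mulr0.
have c := parameterized_integral_continuous ler01 i01.
apply: (@subspace_eq_continuous _ _ _
  (fun s => W 0 + parameterized_integral lam 0 s w)).
  move=> s /set_mem/=; rewrite in_itv/= => s01.
  rewrite -[RHS]/(W s) (Ww s s01); congr (_ + _).
  rewrite /parameterized_integral Int_leb; last first.
    by apply: measurable_funM => //; exact: measurable_indic_itv.
  rewrite /Rintegral [in LHS]integral_indicE.
  transitivity (fine (\int[lam]_x (w x * \1_(`[0, s]) x * \1_(~` [set 0]) x)%:E)%E).
    congr fine; apply: ae_eq_integral => //.
    - apply/measurable_EFinP; apply: measurable_funM => //; exact: measurable_indic_itv.
    - apply/measurable_EFinP; apply: measurable_funM.
        by apply: measurable_funM => //; exact: measurable_indic_itv.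
      by apply: measurable_indic; exact: measurableC.
    - exists [set 0]; split=> //; first exact: lebesgue_measure_set1.
      move=> x /=; apply: contra_notP => x0 _.
      have -> : \1_(~` [set (0 : RR)]) x = 1 :> R by rewrite indicE mem_set.
      by rewrite mulr1.
  congr fine; apply: eq_integral => x _; congr EFin; rewrite -!mulrA; congr (_ * _).
  case/andP: s01 => s0 s1; rewrite !indicE.
  have [x0|x0|->] := ltgtP x 0.
  - by rewrite !(memNset (A := [set` Interval _ _])) ?mul0r//= in_itv/= ?(ltNge 0) ?(leNgt 0) ?x0// (ltW x0).
  - have [xs|sx] := leP x s.
      rewrite !mem_set ?mulr1//= ?in_itv/= ?x0 ?(ltW x0) ?xs ?(le_trans xs s1)//.
      by move=> x0'; move: x0; rewrite x0' ltxx.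
    by rewrite !(memNset (A := [set` Interval _ (BRight s)])) ?mul0r//= in_itv/= (leNgt x s) sx andbF.
  - rewrite (memNset (A := `]0, s]%classic)) ?mul0r; last by rewrite /= in_itv/= ltxx.
    by rewrite (memNset (A := ~` [set 0])) ?mulr0//=; apply.
move=> s; apply: cvgD; first exact: cvg_cst.
exact: c.
Qed.

End Primitives.

(** * Nonnegative controls *)

Section Controls.
Context {R : realType} (p : R) (p1 : 1 <= p).
Notation lam := (@lebesgue_measure R).
Notation RR := (measurableTypeR R).

Lemma Lfun_intg (t : R) (w : R -> R) : w \in Lfun (leb t) p%:E -> intg (leb t) w.
Proof.
move=> wL; apply/Lfun1_integrable.
apply: (@Lfun_subset _ _ _ (leb t) 1 p%:E) => //; rewrite ?lee_fin//.
by rewrite ge0_fin_numE// leb_fin.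
Qed.

Lemma leb1T : leb 1 setT = 1%E :> \bar R.
Proof. by rewrite lebE setTI lebesgue_measure_itv/= lte_fin ltr01 oppr0 adde0. Qed.

Lemma Lfun_bounded (w : RR -> R) (C : R) : measurable_fun setT w ->
  (forall s, 0 < s <= 1 -> `|w s| <= C) -> w \in Lfun (leb 1) p%:E.
Proof.
move=> mw wC; have C0 : 0 <= C.
  by apply: le_trans (wC 1 _); rewrite // ltr01 lexx.
have cL : (cst C : RR -> R) \in Lfun (leb 1) p%:E.
  apply/Lfun_finiteP; split=> //; apply: (@le_lt_trans _ _ C%:E); last exact: ltry.
  apply/(Lnorm_leP _ p1) => //.
  have -> : (\int[leb 1]_x (cst C x `^ p)%:E = \int[leb 1]_x (cst (C `^ p)%:E x))%E by [].
  by rewrite integral_cst// leb1T mule1.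
apply: (Lfun_le p1 mw cL).
have h := @ae_leb R 1; apply: (ae_imp h) => s /wC /le_trans; apply.
exact: ler_norm.
Qed.

(** Signals on the whole line that have not started at time 0. The class
    contains the extension by 0 of a nonnegative L^p function on [0, t] and is
    closed under primitives and under cutting out a time interval. Windows of
    length 1 are what the edges see. *)
Record control (u : RR -> R) : Prop := Control {
  control_meas : measurable_fun setT u;
  control_ge0 : forall x, 0 <= u x;
  control_past : forall x, x <= 0 -> u x = 0;
  control_intg : forall t, intg lam (fun x => u x * (x <= t)%R%:R);
  control_Lfun : forall c, (fun s => u (c + s)) \in Lfun (leb 1) p%:E }.

Definition prim (u : RR -> R) (t : RR) : R := \int[lam]_x (u x * (x <= t)%R%:R).

Lemma measurable_le (t : R) : measurable_fun setT (fun x : RR => (x <= t)%R%:R : R).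
Proof. exact: measurable_fun_pair1 t measurable_indic_le. Qed.

Lemma intg_indic_itv (t : R) : intg lam (\1_(`[0, t]) : RR -> R).
Proof.
have := (@intg_leb R t (cst 1) _).1; rewrite /cst => h.
have := h (@measurable_cst _ _ _ _ _ _).
have i1 : intg (leb t) (fun=> 1 : R).
  by apply: (@intg_bounded _ _ _ _ (leb_fin t) _ 1) => // x; rewrite normr1.
move=> /(_ i1); by under eq_fun do rewrite mul1r.
Qed.

Lemma bounded_control (u : RR -> R) : measurable_fun setT u ->
  (forall x, 0 <= u x) -> (forall x, x <= 0 -> u x = 0) ->
  (forall t, exists M, forall x, x <= t -> u x <= M) -> control u.
Proof.
move=> mu u0 up uM; split=> // [t|c].
  have [M MP] := uM t.
  apply: (@intg_le _ _ _ _ _ (fun x : RR => M * \1_(`[0, t]) x)).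
  - by apply: measurable_funM => //; exact: measurable_le.
  - move=> x; rewrite indicE; have [xt|tx] := leP x t; last by rewrite mulr0 normr0.
    have [x0|x0] := leP x 0; first by rewrite up// mul0r normr0.
    rewrite mem_set/= ?in_itv/= ?(ltW x0)// !mulr1 ger0_norm//.
    by rewrite (le_trans (MP x xt))// ler_norm.
  - by apply: intgZ; exact: intg_indic_itv.
have [M MP] := uM (c + 1).
apply: (@Lfun_bounded _ M); first exact: measurable_comp_shift.
by move=> s /andP[_ s1]; rewrite ger0_norm// MP// lerD2l.
Qed.

Lemma prim_eq0 (u : RR -> R) a t : (forall x, x <= a -> u x = 0) -> t <= a ->
  prim u t = 0.
Proof.
move=> ua ta; rewrite /prim -[RHS](@Int0 _ _ _ lam).
apply: eq_Rintegral => x _.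
have [xt|] := leP x t; last by rewrite mulr0.
by rewrite ua ?mul0r// (le_trans xt).
Qed.

Lemma intg_control_oc (u : RR -> R) (a b : R) : control u ->
  intg lam (fun x => u x * \1_(`]a, b]) x).
Proof.
move=> cu; apply: (@intg_le _ _ _ _ _ (fun x : RR => u x * (x <= b)%R%:R)).
- apply: measurable_funM; last exact: measurable_indic_itv.
  exact: control_meas.
- move=> x; rewrite !normrM ler_wpM2l// indicE.
  have [/set_mem/=|_] := boolP (x \in _); last by rewrite normr0.
  by rewrite in_itv/= => /andP[_ ->].
- exact: control_intg.
Qed.

Section Primitive.
Variable u : RR -> R.
Hypothesis cu : control u.

Lemma prim_ge0 t : 0 <= prim u t.
Proof. by apply: Int_ge0 => x; rewrite mulr_ge0// (control_ge0 cu). Qed.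

Lemma prim_past t : t <= 0 -> prim u t = 0.
Proof. by move=> t0; apply: prim_eq0 t0; exact: (control_past cu). Qed.

Lemma prim_diff a b : a <= b ->
  prim u b - prim u a = \int[lam]_x (u x * \1_(`]a, b]) x).
Proof.
move=> ab; rewrite -IntB; [|exact: (control_intg cu)..].
by apply: eq_Rintegral => x _; rewrite -mulrBr -indic_itv.
Qed.

Lemma prim_nd a b : a <= b -> prim u a <= prim u b.
Proof.
move=> ab; rewrite -subr_ge0 prim_diff//; apply: Int_ge0 => x.
by rewrite mulr_ge0// (control_ge0 cu).
Qed.

Lemma prim_meas : measurable_fun setT (prim u).
Proof.
have mf : measurable_fun setT (fun z : RR * RR => (u z.1 * (z.1 <= z.2)%R%:R)%:E).
  apply/measurable_EFinP; apply: measurable_funM; last exact: measurable_indic_le.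
  by apply: measurableT_comp (control_meas cu) measurable_fst.
have f0 (z : RR * RR) : (0 <= (u z.1 * (z.1 <= z.2)%R%:R)%:E)%E.
  by rewrite lee_fin mulr_ge0// (control_ge0 cu).
have := measurable_fun_fubini_tonelli_G (m1 := lam) _ mf f0.
move=> h; have := measurableT_comp (@fine_measurable R setT measurableT) h.
exact.
Qed.

Lemma control_prim : control (prim u).
Proof.
apply: bounded_control; [exact: prim_meas|exact: prim_ge0|exact: prim_past|].
by move=> t; exists (prim u t) => x; exact: prim_nd.
Qed.

Lemma prim_prim01 c : prim01 (fun s => prim u (c + s)) (fun s => u (c + s)).
Proof.
move=> s /andP[s0 s1].
suff h : prim u (c + s) - prim u c = \int[leb 1]_r (u (c + r) * \1_(`]0, s]) r).
  by rewrite /= addr0 -h [RHS]addrC subrK.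
rewrite prim_diff ?lerDl//.
have mus : measurable_fun setT (fun r : RR => u (c + r)).
  by apply: measurable_comp_shift; exact: control_meas.
rewrite Int_leb; last by apply: measurable_funM => //; exact: measurable_indic_itv.
rewrite -(@Int_shift _ c (fun x => u x * \1_(`]c, c + s]) x)); last first.
  exact: intg_control_oc.
apply: eq_Rintegral => r _; rewrite -mulrA; congr (_ * _); rewrite !indicE.
have [/set_mem/=|] := boolP (r \in `]0, s]%classic).
  rewrite in_itv/= => /andP[r0 rs].
  by rewrite !mem_set ?mulr1//= in_itv/= ?ltrDl ?r0 ?lerD2l ?(ltW r0)// (le_trans rs).
rewrite notin_setE/= in_itv/= => h.
by rewrite mul0r memNset//= in_itv/= ltrDl lerD2l.
Qed.

Lemma prim_const (t : R) : (forall x, t < x -> u x = 0) ->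
  forall s, t <= s -> prim u s = prim u t.
Proof.
move=> ut s ts; apply: eq_Rintegral => x _.
have [xt|tx] := leP x t; first by rewrite (le_trans xt ts).
by rewrite ut// !mul0r.
Qed.

End Primitive.

Lemma intg_indic_oc (a b : R) : intg lam (\1_(`]a, b]) : RR -> R).
Proof.
apply: (intg_le _ _ (intg_shift (- a) (intg_indic_itv (b - a)))).
  exact: measurable_indic_itv.
move=> x; rewrite !indicE.
have [/set_mem/=|_] := boolP (x \in `]a, b]%classic); last by rewrite normr0.
rewrite in_itv/= => /andP[ax xb]; rewrite mem_set//= in_itv/=.
by rewrite addrC subr_ge0 (ltW ax) lerD2r.
Qed.

Lemma Int_indic_oc (a b : R) : a <= b -> \int[lam]_x \1_(`]a, b]) x = b - a.
Proof.
move=> ab; have lab : fine (lam (`]a, b]%classic : set RR)) = b - a.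
  rewrite lebesgue_measure_itv/= lte_fin; case: ltgtP ab => // [->] _.
  by rewrite subrr.
by rewrite -lab; apply: Int_indic; exact: measurable_itvRR.
Qed.

Lemma prim_diff_le (u : RR -> R) (C a b : R) : control u -> a <= b ->
  (forall x, a < x <= b -> u x <= C) -> prim u b - prim u a <= C * (b - a).
Proof.
move=> cu ab uC; rewrite prim_diff// -(Int_indic_oc ab).
have iab := intg_indic_oc a b.
rewrite -IntZ//; apply: Int_le; [exact: intg_control_oc|exact: intgZ|].
move=> x; rewrite indicE; have [/set_mem/=|_] := boolP (x \in _).
  by rewrite in_itv/= => xab; rewrite !mulr1 uC.
by rewrite !mulr0.
Qed.

Lemma prim_diff_ge (u : RR -> R) (C a b : R) : control u -> a <= b ->
  (forall x, a < x <= b -> C <= u x) -> C * (b - a) <= prim u b - prim u a.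
Proof.
move=> cu ab uC; rewrite prim_diff// -(Int_indic_oc ab).
have iab := intg_indic_oc a b.
rewrite -IntZ//; apply: Int_le; [exact: intgZ|exact: intg_control_oc|].
move=> x; rewrite indicE; have [/set_mem/=|_] := boolP (x \in _).
  by rewrite in_itv/= => xab; rewrite !mulr1 uC.
by rewrite !mulr0.
Qed.

(** Translation invariance of the Lebesgue measure; u is supported in the
    interval on which it is p-integrable. *)
Lemma Lfun_shift (t t' c : R) (u : RR -> R) : measurable_fun setT u ->
  (forall x, 0 <= u x) -> (forall x, ~~ (0 < x <= t) -> u x = 0) ->
  u \in Lfun (leb t) p%:E -> (fun s => u (c + s)) \in Lfun (leb t') p%:E.
Proof.
move=> mu u0 ut uL.
have ind x : u x * \1_(`[0, t]) x = u x.
  rewrite indicE; have [_|] := boolP (x \in _); first by rewrite mulr1.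
  rewrite notin_setE/= in_itv/= => h; rewrite ut ?mul0r//.
  by apply/negP => /andP[x0 xt]; apply: h; rewrite ltW.
apply/Lfun_finiteP; split; first exact: measurable_comp_shift.
have /Lfun_finiteP[_ nu] := uL.
apply: le_lt_trans nu; have [->|] := eqVneq ('N[leb t]_p%:E[EFin \o u])%E +oo%E.
  exact: leey.
move=> nu.
have Cf : 'N[leb t]_p%:E[EFin \o u]%E \is a fin_num.
  by rewrite ge0_fin_numE ?Lnorm_ge0// lt_neqAle nu leey.
rewrite -(fineK Cf); apply/(Lnorm_leP _ p1); rewrite ?fine_ge0 ?Lnorm_ge0//.
have mup : measurable_fun setT (fun x => (u x `^ p)%:E).
  by apply/measurable_EFinP; apply: measurable_powR.
have : ('N[leb t]_p%:E[EFin \o u] <= (fine 'N[leb t]_p%:E[EFin \o u])%:E)%E by rewrite fineK.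
move/(Lnorm_leP _ p1) => /(_ u0 (fine_ge0 (Lnorm_ge0 _ _ _))); apply: le_trans.
rewrite !integral_leb//; last first.
  by apply/measurable_EFinP; apply: measurable_powR; exact: measurable_comp_shift.
rewrite [leRHS]integral_indicE [leLHS](integral_indicE _ (fun x => u (c + x) `^ p)).
under [leRHS]eq_integral => x _.
  rewrite (_ : u x `^ p * _ = u x `^ p); last first.
    rewrite -{2}(ind x) indicE; case: (x \in _); rewrite ?mulr1// !mulr0 powR0//.
    by rewrite gt_eqF// (lt_le_trans _ p1).
  over.
rewrite -(ge0_integral_shift c mup); last by move=> x; rewrite lee_fin powR_ge0.
apply: ge0_ae_le_integral => [x|x|].
- by rewrite lee_fin mulr_ge0 ?powR_ge0.
- by rewrite lee_fin powR_ge0.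
apply: aeW => x; rewrite lee_fin ler_piMr ?powR_ge0// indicE.
Qed.

Lemma Lp_control (t : R) (u : RR -> R) : measurable_fun setT u ->
  (forall x, 0 <= u x) -> (forall x, ~~ (0 < x <= t) -> u x = 0) ->
  u \in Lfun (leb t) p%:E -> control u.
Proof.
move=> mu u0 ut uL.
have up x : x <= 0 -> u x = 0 by move=> x0; apply: ut; rewrite negb_and -leNgt x0.
have ind x : u x * \1_(`[0, t]) x = u x.
  rewrite indicE; have [_|] := boolP (x \in _); first by rewrite mulr1.
  rewrite notin_setE/= in_itv/= => h; rewrite ut ?mul0r//.
  by apply/negP => /andP[x0 xt]; apply: h; rewrite ltW.
have iu : intg lam u.
  have /(intg_leb _ mu) := Lfun_intg uL.
  by under eq_fun do rewrite ind.
split=> // [s|c]; last exact: Lfun_shift ut uL.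
  apply: (@intg_mulr_bounded _ _ _ _ _ _ 1) => //; first exact: measurable_le.
  by move=> x; case: (x <= s); rewrite ?normr1 ?normr0.
Qed.

(** A Taylor estimate at a for the primitive of w. *)
Lemma second_order (w : RR -> R) (c a b : R) : control w -> a <= b ->
  (forall x, a <= x <= b -> 0 <= w x - w a <= c * (x - a)) -> 0 <= c ->
  0 <= prim w b - prim w a - (b - a) * w a <= c * (b - a) ^+ 2.
Proof.
move=> cw ab wc c0; apply/andP; split.
  rewrite subr_ge0 mulrC; apply: (prim_diff_ge cw ab) => x /andP[ax xb].
  by have := wc x; rewrite (ltW ax) xb => /(_ isT)/andP[]; rewrite subr_ge0.
rewrite lerBlDr [leRHS]addrC expr2 [c * _]mulrA [(b - a) * w a]mulrC -mulrDl.
apply: (prim_diff_le cw ab) => x /andP[ax xb].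
have := wc x; rewrite (ltW ax) xb => /(_ isT)/andP[_].
rewrite lerBlDr [leRHS]addrC => /le_trans; apply; rewrite lerD2l ler_wpM2l//.
by rewrite lerD2r.
Qed.

Lemma control_indic (u : RR -> R) (E : set RR) : control u -> measurable E ->
  control (fun x => u x * \1_E x).
Proof.
move=> cu mE; have I0 x : 0 <= \1_E x :> R by rewrite indicE.
have mI : measurable_fun setT (\1_E : RR -> R) by exact: measurable_indic.
split.
- by apply: measurable_funM => //; exact: control_meas cu.
- by move=> x; apply: mulr_ge0 (I0 x); exact: (control_ge0 cu).
- by move=> x x0; rewrite (control_past cu) ?mul0r.
- move=> t; under eq_fun do rewrite mulrAC.
  by apply: intg_indic (control_intg cu t).
- move=> c; apply: (Lfun_le p1 _ (control_Lfun cu c)).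
    apply: (@measurable_comp_shift _ c (fun x => u x * \1_E x)).
    by apply: measurable_funM => //; exact: control_meas cu.
  by apply: aeW => x; rewrite normrM ler_piMr// indic_bounded.
Qed.

End Controls.

(** * The boundary value problem on the network *)

Section Operators.
Context {R : realType} {p : R} (p1 : 1 <= p) {n m : nat} (N : network R n m).
Notation RR := (measurableTypeR R).
Notation V := (Lp01 p1 m).
Notation vL := (vLp (leb 1) p1).
Notation L01 := (Lfun (leb 1) p%:E).
Implicit Types (f g : V) (F G : R -> 'cV[R[i]]_m).

Lemma fun_in f : (vLspace_fun f : RR -> 'cV[R[i]]_m) \in vL.
Proof. exact: vLspace_fun_in. Qed.

Lemma RecMr (z : R[i]) (r : R) : Rec (z * r%:C) = Rec z * r.
Proof. by case: z => a b /=; rewrite mulr0 subr0. Qed.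

Lemma ImcMr (z : R[i]) (r : R) : Imc (z * r%:C) = Imc z * r.
Proof. by case: z => a b /=; rewrite mulr0 add0r. Qed.

Lemma integral01_test f (psi : R -> R) j :
  integral01 (fun s => vLspace_fun f s j 0 * (psi s)%:C) =
  (\int[leb 1]_s (Rec (vLspace_fun f s j 0) * psi s)) +i*
  (\int[leb 1]_s (Imc (vLspace_fun f s j 0) * psi s)).
Proof.
rewrite /integral01; congr (_ +i* _); apply: eq_Rintegral => s _.
  by rewrite RecMr.
by rewrite ImcMr.
Qed.

(** Weak derivatives do not depend on the representatives. *)
Lemma weak_derivativeP F G : (F : RR -> _) \in vL -> (G : RR -> _) \in vL ->
  weak_derivative (cls (leb 1) p1 F : V) (cls (leb 1) p1 G) <->
  forall phi, test_function phi -> forall j,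
    (\int[leb 1]_s (Rec (F s j 0) * derive1 phi s) =
      - \int[leb 1]_s (Rec (G s j 0) * phi s)) /\
    (\int[leb 1]_s (Imc (F s j 0) * derive1 phi s) =
      - \int[leb 1]_s (Imc (G s j 0) * phi s)).
Proof.
move=> FL GL.
have E (H : R -> 'cV[R[i]]_m) (psi : R -> R) j : (H : RR -> _) \in vL ->
    measurable_fun setT (psi : RR -> R) ->
    (\int[leb 1]_s (Rec (vLspace_fun (cls (leb 1) p1 H) s j 0) * psi s) =
     \int[leb 1]_s (Rec (H s j 0) * psi s)) /\
    (\int[leb 1]_s (Imc (vLspace_fun (cls (leb 1) p1 H) s j 0) * psi s) =
     \int[leb 1]_s (Imc (H s j 0) * psi s)).
  move=> HL mpsi; have [mR mI] := vLp_meas j HL.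
  have [mR' mI'] := vLp_meas j (fun_in (cls (leb 1) p1 H)).
  split; apply: Int_ae; [exact: measurable_funM|exact: measurable_funM| |
    exact: measurable_funM|exact: measurable_funM|];
    by apply: (ae_imp (clsE HL)) => s ->.
split=> h phi tphi j.
  have := h phi tphi j; rewrite !integral01_test.
  have [-> ->] := E F _ j FL (test_derive_measurable tphi).
  have [-> ->] := E G _ j GL (test_measurable tphi).
  by case.
rewrite !integral01_test.
have [-> ->] := E F _ j FL (test_derive_measurable tphi).
have [-> ->] := E G _ j GL (test_measurable tphi).
by have [-> ->] := h phi tphi j.
Qed.

Lemma lin_cls (a : R[i]) f g :
  a *: f + g = cls (leb 1) p1 (fun s => a *: vLspace_fun f s + vLspace_fun g s).
Proof.
have fL := fun_in f; have gL := fun_in g.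
by rewrite clsD ?vLpZ// clsZ// !cls_fun.
Qed.

Lemma weak_derivative_lin (a : R[i]) f f' g g' :
  weak_derivative f f' -> weak_derivative g g' ->
  weak_derivative (a *: f + g) (a *: f' + g').
Proof.
have fL := fun_in f; have f'L := fun_in f'.
have gL := fun_in g; have g'L := fun_in g'.
rewrite (lin_cls a f g) (lin_cls a f' g').
rewrite -{1}(cls_fun f) -{1}(cls_fun f') -{1}(cls_fun g) -{1}(cls_fun g').
move=> /(weak_derivativeP fL f'L) hf /(weak_derivativeP gL g'L) hg.
apply/weak_derivativeP; [exact: vLpD (vLpZ _ _) _..|].
move=> phi tphi j; have [hfR hfI] := hf phi tphi j; have [hgR hgI] := hg phi tphi j.
have cphi := test_continuous tphi; have cdphi : continuous (derive1 phi) by case: tphi.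
have [ifR ifI] : intg (leb 1) (fun s => Rec (vLspace_fun f s j 0)) /\
                 intg (leb 1) (fun s => Imc (vLspace_fun f s j 0)).
  by have /vLpP/(_ j)[] := fL => /(Lfun_intg p1)? /(Lfun_intg p1).
have [if'R if'I] : intg (leb 1) (fun s => Rec (vLspace_fun f' s j 0)) /\
                 intg (leb 1) (fun s => Imc (vLspace_fun f' s j 0)).
  by have /vLpP/(_ j)[] := f'L => /(Lfun_intg p1)? /(Lfun_intg p1).
have [igR igI] : intg (leb 1) (fun s => Rec (vLspace_fun g s j 0)) /\
                 intg (leb 1) (fun s => Imc (vLspace_fun g s j 0)).
  by have /vLpP/(_ j)[] := gL => /(Lfun_intg p1)? /(Lfun_intg p1).
have [ig'R ig'I] : intg (leb 1) (fun s => Rec (vLspace_fun g' s j 0)) /\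
                 intg (leb 1) (fun s => Imc (vLspace_fun g' s j 0)).
  by have /vLpP/(_ j)[] := g'L => /(Lfun_intg p1)? /(Lfun_intg p1).
have D (x y z : RR -> R) (r s : R) (psi : R -> R) : continuous psi ->
    intg (leb 1) x -> intg (leb 1) y -> intg (leb 1) z ->
    \int[leb 1]_t ((r * x t + s * y t + z t) * psi t) =
    r * \int[leb 1]_t (x t * psi t) + s * \int[leb 1]_t (y t * psi t) +
    \int[leb 1]_t (z t * psi t).
  move=> cpsi ix iy iz.
  have ix' := intg_mul_continuous cpsi ix.
  have iy' := intg_mul_continuous cpsi iy.
  have iz' := intg_mul_continuous cpsi iz.
  rewrite -!IntZ// -!IntD//; first last.
  - exact: intgZ.
  - exact: intgZ.
  - by apply: intgD; exact: intgZ.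
  by apply: eq_Rintegral => t _; rewrite !mulrDl !mulrA.
have RE (x y : V) t : Rec ((a *: vLspace_fun x t + vLspace_fun y t) j 0) =
    Rec a * Rec (vLspace_fun x t j 0) + - Imc a * Imc (vLspace_fun x t j 0)
    + Rec (vLspace_fun y t j 0).
  by rewrite !mxE RecD RecM mulNr.
have IE (x y : V) t : Imc ((a *: vLspace_fun x t + vLspace_fun y t) j 0) =
    Rec a * Imc (vLspace_fun x t j 0) + Imc a * Rec (vLspace_fun x t j 0)
    + Imc (vLspace_fun y t j 0).
  by rewrite !mxE ImcD ImcM.
split.
  under eq_Rintegral do rewrite RE; under [in RHS]eq_Rintegral do rewrite RE.
  rewrite !D// hfR hfI hgR; ring.
under eq_Rintegral do rewrite IE; under [in RHS]eq_Rintegral do rewrite IE.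
rewrite !D// hfR hfI hgI; ring.
Qed.

(** Integration by parts in each coordinate. *)
Lemma weak_derivative_scale (W w : R -> R) (c : 'cV[R[i]]_m) :
  (W : RR -> R) \in L01 -> (w : RR -> R) \in L01 -> prim01 W w ->
  weak_derivative (cls (leb 1) p1 (fun s => (W s)%:C *: c) : V)
                  (cls (leb 1) p1 (fun s => (w s)%:C *: c)).
Proof.
move=> WL wL Ww; apply/weak_derivativeP; [exact: vLp_scale..|].
move=> phi tphi j; have iw := Lfun_intg p1 wL.
have cphi := test_continuous tphi; have cdphi : continuous (derive1 phi) by case: tphi.
have ibp := integration_by_parts01 tphi (Lfun_meas WL) iw Ww.
have iWp := intg_mul_continuous cdphi (Lfun_intg p1 WL).
have iwp := intg_mul_continuous cphi iw.
have RE (h : R -> R) s : Rec (((h s)%:C *: c) j 0) = Rec (c j 0) * h s.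
  by rewrite mxE mulrC RecMr.
have IE (h : R -> R) s : Imc (((h s)%:C *: c) j 0) = Imc (c j 0) * h s.
  by rewrite mxE mulrC ImcMr.
split.
  under eq_Rintegral do rewrite RE -mulrA.
  under [in RHS]eq_Rintegral do rewrite RE -mulrA.
  by rewrite !IntZ// ibp mulrN.
under eq_Rintegral do rewrite IE -mulrA.
under [in RHS]eq_Rintegral do rewrite IE -mulrA.
by rewrite !IntZ// ibp mulrN.
Qed.

Lemma fun_lin (a : R[i]) f g : {ae leb 1, forall s,
  vLspace_fun (a *: f + g) s = a *: vLspace_fun f s + vLspace_fun g s}.
Proof.
have fL := fun_in f; have gL := fun_in g.
have hL : (fun s : RR => a *: vLspace_fun f s + vLspace_fun g s) \in vL.
  by apply: vLpD => //; exact: vLpZ.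
by apply: (ae_imp (clsE hL)) => s <-; rewrite lin_cls.
Qed.

Lemma continuous_repr_lin (a : R[i]) f g F G :
  continuous_repr f F -> continuous_repr g G ->
  continuous_repr (a *: f + g) (fun s => a *: F s + G s).
Proof.
move=> [cF fF] [cG gG]; split.
  move=> s; apply: cvgD; last exact: cG.
  by apply: cvgZr; exact: cF.
have fF' : {ae leb 1, forall s, vLspace_fun f s = F s} by apply: (ae_imp fF) => s; exact.
have gG' : {ae leb 1, forall s, vLspace_fun g s = G s} by apply: (ae_imp gG) => s; exact.
have h : {ae leb 1, forall s, vLspace_fun f s = F s /\ vLspace_fun g s = G s}.
  exact: (ae_imp2 fF' gG').
apply: (ae_imp2 (fun_lin a f g) h) => s h1 [h2 h3] _.
by rewrite h1 h2 h3.
Qed.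

Lemma continuous_repr_scale (W w : R -> R) (c : 'cV[R[i]]_m) :
  (W : RR -> R) \in L01 -> (w : RR -> R) \in L01 -> prim01 W w ->
  continuous_repr (cls (leb 1) p1 (fun s => (W s)%:C *: c) : V)
                  (fun s => (W s)%:C *: c).
Proof.
move=> WL wL Ww; split; last first.
  by apply: (ae_imp (clsE (vLp_scale p1 c WL))) => s ->.
have cW := prim01_continuous (Lfun_intg p1 wL) Ww.
move=> s; apply/cvg_nrmP => e e0.
have /cvgrPdist_lt := cW s.
have c1 : 0 < nrm c + 1 by rewrite ltr_wpDl// nrm_ge0.
move=> /(_ (e / (nrm c + 1)) (divr_gt0 e0 c1)); apply: filterS => t ht.
rewrite -[X in nrm (X - _)]/((W t)%:C *: c) -[X in nrm (_ - X)]/((W s)%:C *: c).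
rewrite -scalerBl -rmorphB nrmZr distrC.
apply: (@le_lt_trans _ _ (`|W s - W t| * (nrm c + 1))).
  by rewrite ler_wpM2l// lerDl.
by rewrite -ltr_pdivlMr.
Qed.

(** The head incidence matrix: B = Psi *m incidence and A = incidence *m Psi,
    which gives Psi A = B Psi. *)
Definition incidence : 'M[R[i]]_(n, m) := \matrix_(j, f) (tgt N f == j)%:R.

Lemma adjBE : adjB N = Psi N *m incidence.
Proof.
apply/matrixP => e f; rewrite !mxE (bigD1 (src N e))//= big1 => [|j je].
  by rewrite !mxE eqxx addr0; case: eqP => _; rewrite ?mulr1 ?mulr0.
by rewrite !mxE eq_sym (negbTE je) mul0r.
Qed.

Lemma adjAE : adjA N = incidence *m Psi N.
Proof.
apply/matrixP => a b; rewrite !mxE big_mkcond/=; apply: eq_bigr => e _.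
rewrite !mxE; case: (src N e == b); case: (tgt N e == a) => /=;
  by rewrite ?mul1r ?mul0r ?mulr0.
Qed.

Lemma Psi_adjA : Psi N *m adjA N = adjB N *m Psi N.
Proof. by rewrite adjAE adjBE mulmxA. Qed.

Lemma Psi_adjA_exp k : Psi N *m (adjA N ^+ k) = (adjB N ^+ k) *m Psi N.
Proof.
elim: k => [|k IH]; first by rewrite !expr0 mulmx1 mul1mx.
rewrite [adjA N ^+ _]exprSr [adjB N ^+ _]exprSr.
by rewrite -[_ * adjA N]/(_ *m adjA N) -[_ * adjB N]/(_ *m adjB N)
  mulmxA IH -!mulmxA Psi_adjA.
Qed.

Lemma rgPsi_adjB c : rgPsi N (adjB N *m c).
Proof. by exists (incidence *m c) => //; rewrite adjBE mulmxA. Qed.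

Lemma rgPsiD c c' : rgPsi N c -> rgPsi N c' -> rgPsi N (c + c').
Proof. by move=> [x _ <-] [y _ <-]; exists (x + y) => //; rewrite mulmxDr. Qed.

Lemma rgPsiZ a c : rgPsi N c -> rgPsi N (a *: c).
Proof. by move=> [x _ <-]; exists (a *: x) => //; rewrite scalemxAr. Qed.

(** The range condition on F 1 is a consequence of F 1 = B (F 0), as B factors
    through Psi. *)
Lemma opAP f g : opA p1 N (f, g) <-> weak_derivative f g /\
  exists2 F, continuous_repr f F & F 1 = adjB N *m F 0.
Proof.
split=> [[[/= fg _] [_ [F fF /eqP]]]|[fg [F fF F1]]].
  by rewrite eq_sym subr_eq0 => /eqP F1; split=> //; exists F.
have rF : rgPsi N (F 1) by rewrite F1; exact: rgPsi_adjB.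
split; first by split=> //; exists F.
split; first by exists g; split=> //; exists F.
by exists F => //=; rewrite F1 subrr.
Qed.

Section Resolvent.
Variables (l : R[i]) (S : V -> V).
Hypothesis linS : linear S.
Hypothesis SP : forall x y, opA p1 N (x, l *: x - y) <-> x = S y.

Lemma opA_S y : opA p1 N (S y, l *: S y - y).
Proof. exact/SP. Qed.

(** f solves f' = l f with boundary value d, that is Q f = d in the notation
    of opQ. *)
Definition boundary_solution (d : 'cV[R[i]]_m) f := weak_derivative f (l *: f) /\
  exists2 F, continuous_repr f F & F 1 - adjB N *m F 0 = d.

Lemma boundary_solutionP d f : rgPsi N d ->
  (opAm p1 N (f, l *: f) /\ opQ p1 N (f, d)) <-> boundary_solution d f.
Proof.
move=> rd; split=> [[[/= ff _] [_ [F fF dE]]]|[ff [F fF dE]]].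
  by split=> //; exists F.
have rF : rgPsi N (F 1).
  rewrite -(subrK (adjB N *m F 0) (F 1)) dE; apply: rgPsiD => //.
  exact: rgPsi_adjB.
have fAm : opAm p1 N (f, l *: f) by split=> //; exists F.
split=> //; split; first by exists (l *: f).
by exists F.
Qed.

Lemma boundary_solution_lin a d d' f f' :
  boundary_solution d f -> boundary_solution d' f' ->
  boundary_solution (a *: d + d') (a *: f + f').
Proof.
move=> [ff [F fF dE]] [ff' [F' fF' dE']]; split.
  rewrite scalerDr scalerA mulrC -scalerA.
  exact: weak_derivative_lin.
exists (fun s => a *: F s + F' s); first exact: continuous_repr_lin.
rewrite -dE -dE' mulmxDr -scalemxAr scalerBr opprD addrACA.
by [].
Qed.

(** With boundary value 0 the solution lies in the domain of A and in the
    kernel of l - A. *)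
Lemma boundary_solution0 f : boundary_solution 0 f -> f = 0.
Proof.
move=> [ff [F fF /eqP]]; rewrite subr_eq0 => /eqP F1.
rewrite -(lin0 linS); apply/SP/opAP; rewrite subr0; split=> //.
by exists F.
Qed.

Lemma boundary_solution_uniq d f f' :
  boundary_solution d f -> boundary_solution d f' -> f = f'.
Proof.
move=> h h'; have := boundary_solution_lin (-1) h' h.
rewrite !scaleN1r addrC subrr => /boundary_solution0 /eqP.
by rewrite addrC subr_eq0 => /eqP.
Qed.

(** The function s d satisfies the boundary condition but not the equation; an
    element of the domain of A corrects it. *)
Lemma boundary_solution_ex d : exists f, boundary_solution d f.
Proof.
pose W (s : R) : R := s; pose w (s : R) : R := 1.
have WL : (W : RR -> R) \in L01.
  apply: (@Lfun_bounded _ _ p1 _ 1); first exact: measurable_id.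
  by move=> s /andP[s0 s1]; rewrite ger0_norm// ltW.
have wL : (w : RR -> R) \in L01.
  apply: (@Lfun_bounded _ _ p1 _ 1); first exact: measurable_cst.
  by move=> s _; rewrite normr1.
have Ww : prim01 W w.
  move=> s /andP[s0 s1]; rewrite /W /w add0r.
  under eq_Rintegral do rewrite mul1r.
  rewrite Int_indic; last exact: measurable_itvRR.
  rewrite lebE (_ : _ `&` _ = `]0, s]%classic); last first.
    apply/seteqP; split=> x /=; first by case.
    move=> xs; split=> //; move: xs; rewrite /= !in_itv/= => /andP[/ltW -> xs].
    exact: le_trans xs s1.
  rewrite lebesgue_measure_itv/= lte_fin.
  move: s0; rewrite le_eqVlt => /predU1P[<-|->]; first by rewrite ltxx.
  by rewrite oppr0 adde0.
pose f0 : V := cls (leb 1) p1 (fun s => (W s)%:C *: d).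
pose f0' : V := cls (leb 1) p1 (fun s => (w s)%:C *: d).
have f0f0' : weak_derivative f0 f0' by exact: weak_derivative_scale.
have f0W : continuous_repr f0 (fun s => (W s)%:C *: d).
  exact: continuous_repr_scale WL wL Ww.
pose y := l *: f0 - f0'.
have /opAP[wS [F SF F1]] := opA_S y.
exists (- 1 *: S y + f0); split.
  have -> : l *: (-1 *: S y + f0) = -1 *: (l *: S y - y) + f0'.
    rewrite /y !scaleN1r scalerDr scalerN opprB addrAC.
    by rewrite subrK addrC.
  exact: weak_derivative_lin.
exists (fun s => -1 *: F s + (W s)%:C *: d); first exact: continuous_repr_lin.
rewrite F1 /W !scaleN1r scale1r scale0r addr0 mulmxN opprK addrAC addNr add0r.
by [].
Qed.

Lemma Qinv_solution d : rgPsi N d -> boundary_solution d (Qinv p1 N l d).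
Proof.
move=> rd; apply/(boundary_solutionP _ rd).
apply: (@getPex _ [set f | opAm p1 N (f, l *: f) /\ opQ p1 N (f, d)]).
have [f fd] := boundary_solution_ex d.
by exists f; apply/(boundary_solutionP _ rd).
Qed.

(** Boundary solutions are unique, so the operator that selects them is
    homogeneous. *)
Lemma Qinv_scale a d : rgPsi N d -> Qinv p1 N l (a *: d) = a *: Qinv p1 N l d.
Proof.
move=> rd; apply: (@boundary_solution_uniq (a *: d)).
  by apply: Qinv_solution; exact: rgPsiZ.
have r0 : rgPsi N 0 by exists 0 => //; rewrite mulmx0.
have s0 := Qinv_solution r0.
have := boundary_solution_lin a (Qinv_solution rd) s0.
by rewrite addr0 (boundary_solution0 s0) addr0.
Qed.

End Resolvent.

End Operators.

(** * Waves and driven states *)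

Section Waves.
Context {R : realType} {p : R} (p1 : 1 <= p) {n m : nat} (N : network R n m).
Notation RR := (measurableTypeR R).
Notation V := (Lp01 p1 m).
Notation L01 := (Lfun (leb 1) p%:E).
Variables (v : 'cV[R[i]]_n) (K : nat).

Definition wave (k : nat) : 'cV[R[i]]_m := adjB N ^+ k *m (Psi N *m v).

Lemma wave0 : wave 0 = Psi N *m v.
Proof. by rewrite /wave expr0 mul1mx. Qed.

Lemma waveS k : wave k.+1 = adjB N *m wave k.
Proof. by rewrite /wave exprS -[_ * _]/(_ *m _) -mulmxA. Qed.

Definition state (w : nat -> RR -> R) : V :=
  cls (leb 1) p1 (fun s => \sum_(k < K) (w k s)%:C *: wave k).

Definition amplitudes (w : nat -> RR -> R) := forall k, w k \in L01.

Lemma state_in w : amplitudes w ->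
  (fun s : RR => \sum_(k < K) (w k s)%:C *: wave k) \in vLp (leb 1) p1.
Proof. by move=> wL; apply: vLp_sum => k _; exact: vLp_scale. Qed.

Lemma stateD w w' : amplitudes w -> amplitudes w' ->
  state (fun k s => w k s + w' k s) = state w + state w'.
Proof.
move=> wL w'L; rewrite /state -clsD ?state_in//; congr cls; apply/funext => s.
by rewrite -big_split/=; apply: eq_bigr => k _; rewrite rmorphD scalerDl.
Qed.

Lemma stateZ (r : R) w : amplitudes w ->
  state (fun k s => r * w k s) = r%:C *: state w.
Proof.
move=> wL; rewrite /state -clsZ ?state_in//; congr cls; apply/funext => s.
by rewrite scaler_sumr; apply: eq_bigr => k _; rewrite rmorphM scalerA.
Qed.

Lemma amplitudesZ (r : R) w : amplitudes w -> amplitudes (fun k s => r * w k s).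
Proof. by move=> wL k; exact: LfunZ. Qed.

Lemma amplitudesB w w' : amplitudes w -> amplitudes w' ->
  amplitudes (fun k s => w k s - w' k s).
Proof. by move=> wL w'L k; exact: LfunB. Qed.

Lemma stateB w w' : amplitudes w -> amplitudes w' ->
  state (fun k s => w k s - w' k s) = state w - state w'.
Proof.
move=> wL w'L; rewrite -[- state w']scaleN1r.
have -> : -1 = (-1 : R)%:C :> R[i] by rewrite rmorphN rmorph1.
rewrite -stateZ// -stateD//; last exact: amplitudesZ.
by congr state; apply/funext => k; apply/funext => s; rewrite mulN1r.
Qed.

Lemma eq_state w w' : amplitudes w -> amplitudes w' ->
  (forall k s, (k < K)%N -> 0 < s <= 1 -> w k s = w' k s) -> state w = state w'.
Proof.
move=> wL w'L ww'; apply: cls_eq; [exact: state_in..|].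
have h := @ae_leb R 1; apply: (ae_imp h) => s s01.
by apply: eq_bigr => k _; rewrite ww'.
Qed.

Lemma state_sum (I : Type) (r : seq I) (w : I -> nat -> RR -> R) :
  (forall i, amplitudes (w i)) ->
  state (fun k s => \sum_(i <- r) w i k s) = \sum_(i <- r) state (w i).
Proof.
move=> wL; elim: r => [|i r IH].
  rewrite big_nil /state -[RHS](cls_fun 0); apply: cls_eq.
  - apply: vLp_sum => k _; apply: vLp_scale.
    by rewrite (_ : (fun _ => _) = fun=> 0) ?Lfun0//; apply/funext => s; rewrite big_nil.
  - exact: vLspace_fun_in.
  - have h := fun_lin (-1) (0 : V) 0.
    apply: (ae_imp h) => s; rewrite scaler0 addr0 => ->.
    by rewrite scaleN1r addNr big1// => k _; rewrite big_nil scale0r.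
rewrite big_cons -IH -stateD//; last first.
  by move=> k; apply: (Lfun_sum p1) => j _; exact: wL.
by congr state; apply/funext => k; apply/funext => s; rewrite big_cons.
Qed.

Definition wave_bound : R := \sum_(k < K) vnorm (wave k).

Lemma wave_bound_ge0 : 0 <= wave_bound.
Proof. by apply: sumr_ge0 => k _; exact: vnorm_ge0. Qed.

(** Used with a thin set E: the factor |E|^(1/p) then makes the state small. *)
Lemma nrm_state_le w (C : R) (E : set RR) : amplitudes w -> measurable E -> 0 <= C ->
  (forall k s, (k < K)%N -> 0 < s <= 1 -> `|w k s| <= C * \1_E s) ->
  nrm (state w) <= wave_bound * C * (fine (leb 1 E)) `^ p^-1.
Proof.
move=> wL mE C0 wC; have p0 : 0 < p by rewrite (lt_le_trans _ p1).
have D0 : 0 <= wave_bound * C by rewrite mulr_ge0// wave_bound_ge0.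
have I0 x : 0 <= \1_E x :> R by rewrite indicE.
rewrite -lee_fin nrm_cls ?state_in//.
apply: (@le_trans _ _ ('N[leb 1]_p%:E[EFin \o (fun s => wave_bound * C * \1_E s)%R])%E).
  apply: Lnorm_ae_le => //; [by move=> s; exact: vnorm_ge0|by move=> s; exact: mulr_ge0|].
  have h := @ae_leb R 1; apply: (ae_imp h) => s s01.
  apply: le_trans (vnorm_sum _ _ _) _; rewrite -mulrA mulr_suml.
  apply: ler_sum => k _; rewrite vnormZr mulrC ler_wpM2l ?vnorm_ge0//.
  exact: wC.
apply/(Lnorm_leP _ p1); first by move=> s; exact: mulr_ge0.
  by rewrite mulr_ge0// powR_ge0.
rewrite powRM ?powR_ge0// -powRrM mulVf ?gt_eqF// powRr1 ?fine_ge0//.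
have fE : leb 1 E \is a fin_num.
  by rewrite ge0_fin_numE//; apply: mu_fin => //; exact: leb_fin.
have iE : (\int[leb 1]_x (\1_E x)%:E = leb 1 E)%E by rewrite integral_indic// setIT.
rewrite EFinM fineK// -iE.
rewrite -ge0_integralZl_EFin ?powR_ge0//; last first.
  by apply/measurable_EFinP; exact: measurable_indic.
apply: ge0_ae_le_integral => [x|x|].
- by rewrite lee_fin powR_ge0.
- by rewrite lee_fin mulr_ge0// powR_ge0.
apply: aeW => x; rewrite -EFinM lee_fin powRM// indicE.
by case: (x \in E); rewrite ?powR1// powR0// gt_eqF.
Qed.

Lemma nrm_state_le1 w (C : R) : amplitudes w -> 0 <= C ->
  (forall k s, (k < K)%N -> 0 < s <= 1 -> `|w k s| <= C) ->
  nrm (state w) <= wave_bound * C.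
Proof.
move=> wL C0 wC; have := nrm_state_le wL measurableT C0.
rewrite leb1T powR1 mulr1; apply => k s kK s01.
by rewrite indicT mulr1 wC.
Qed.

(** What is at position x of wave k at time s was emitted at time s - 1 - k +
    x: it has run through k edges and the part from 1 to x of another one.
    With s <= K, later waves have not been emitted yet. *)
Definition driven (s : R) (u : RR -> R) : V :=
  state (fun k x => u (s - 1 - k%:R + x)).

Lemma driven_amplitudes s u : control p u ->
  amplitudes (fun k x => u (s - 1 - k%:R + x)).
Proof. by move=> cu k; exact: control_Lfun. Qed.

Section Star.
Variables (l : R[i]) (S : V -> V).
Hypothesis linS : linear S.
Hypothesis contS : continuous S.
Hypothesis SP : forall x y, opA p1 N (x, l *: x - y) <-> x = S y.

(** The element g = Q_l Psi v of the kernel of l - A_m, whose boundary value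
    is the direction of the control. *)
Definition input : V := Qinv p1 N l (Psi N *m v).

Lemma rgPsi_v : rgPsi N (Psi N *m v).
Proof. by exists v. Qed.

Definition sobolev (f f' : V) (F : R -> 'cV[R[i]]_m) :=
  weak_derivative f f' /\ continuous_repr f F.

Lemma sobolev_lin a f f' F g g' G : sobolev f f' F -> sobolev g g' G ->
  sobolev (a *: f + g) (a *: f' + g') (fun s => a *: F s + G s).
Proof.
move=> [ff' fF] [gg' gG]; split; first exact: weak_derivative_lin.
exact: continuous_repr_lin.
Qed.

(** By induction on the number of waves. The empty sum is written with the
    vector 0, so that the base case is a single wave as well. *)
Lemma sobolev_state (W w : nat -> RR -> R) : amplitudes W -> amplitudes w ->
  (forall k, prim01 (W k) (w k)) ->
  sobolev (state W) (state w) (fun s => \sum_(k < K) (W k s)%:C *: wave k).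
Proof.
rewrite /state; elim: K => [|q IH] WL wL Ww.
  have E (x : nat -> RR -> R) : (fun s : RR => \sum_(k < 0) (x k s)%:C *: wave k) =
      (fun s => (x 0%N s)%:C *: 0).
    by apply/funext => s; rewrite big_ord0 scaler0.
  rewrite (E W) (E w); split; first exact: weak_derivative_scale.
  exact: continuous_repr_scale (wL 0%N) _.
have sq := IH WL wL Ww.
have s1 : sobolev (cls (leb 1) p1 (fun s => (W q s)%:C *: wave q) : V)
      (cls (leb 1) p1 (fun s => (w q s)%:C *: wave q)) (fun s => (W q s)%:C *: wave q).
  by split; [exact: weak_derivative_scale|exact: continuous_repr_scale (wL q) _].
have := sobolev_lin 1 sq s1.
have E (x : nat -> RR -> R) : amplitudes x ->
    1 *: (cls (leb 1) p1 (fun s => \sum_(k < q) (x k s)%:C *: wave k) : V) +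
    cls (leb 1) p1 (fun s => (x q s)%:C *: wave q) =
    cls (leb 1) p1 (fun s => \sum_(k < q.+1) (x k s)%:C *: wave k).
  move=> xL; rewrite scale1r -clsD ?vLp_scale//.
    by congr cls; apply/funext => s; rewrite big_ord_recr.
  by apply: vLp_sum => k _; exact: vLp_scale.
rewrite (E W WL) (E w wL).
rewrite (_ : (fun s => 1 *: (\sum_(k < q) (W k s)%:C *: wave k) + (W q s)%:C *: wave q) =
  (fun s => \sum_(k < q.+1) (W k s)%:C *: wave k))//.
by apply/funext => s; rewrite big_ord_recr scale1r.
Qed.

(** The operator A S, written without A by means of (l - A) S = 1. *)
Definition AS (x : V) : V := l *: S x - x.

(** The continuous function x = driven s (prim u) - U(s) g has derivative
    driven s u - U(s) l g. Its boundary defect vanishes: at position 1 wave k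
    + 1 has the amplitude that wave k has at position 0, so only U(s) B^0 Psi
    v is left, and it cancels the defect of U(s) g. Hence x lies in D(A), and
    x = S (l x - A x) is the claim. *)
Lemma resolvent_driven u s : control p u -> s <= K%:R ->
  S (driven s u) = AS (driven s (prim u)) + (prim u s)%:C *: input.
Proof.
move=> cu sK; have cU := control_prim p1 cu.
have [gg [G gG Gd]] : boundary_solution N l (Psi N *m v) input.
  exact: (Qinv_solution SP rgPsi_v).
have sg : sobolev input (l *: input) G by [].
have sU : sobolev (driven s (prim u)) (driven s u)
    (fun x => \sum_(k < K) (prim u (s - 1 - k%:R + x))%:C *: wave k).
  apply: (sobolev_state (driven_amplitudes s cU) (driven_amplitudes s cu)) => k.
  exact: prim_prim01 cu _.
have [wd cr] := sobolev_lin (- (prim u s)%:C) sg sU.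
set x := _ + driven s (prim u) in wd cr.
suff : x = S (l *: driven s (prim u) - driven s u).
  rewrite (linB linS) (linZ linS) => xE.
  have -> : S (driven s u) = l *: S (driven s (prim u)) - x by rewrite xE opprB addrC subrK.
  by rewrite /AS /x scaleNr opprD opprK addrA addrAC.
apply/SP/opAP; split.
  have -> : l *: x - (l *: driven s (prim u) - driven s u) =
    - (prim u s)%:C *: (l *: input) + driven s u; last exact: wd.
  rewrite /x scalerDr opprB addrA -addrA (addrC (driven s u)) addrA addrK.
  by rewrite !scalerA mulrC.
exists (fun z => - (prim u s)%:C *: G z +
  \sum_(k < K) (prim u (s - 1 - k%:R + z))%:C *: wave k) => //.
rewrite mulmxDr mulmx_sumr -scalemxAr.
have G1 : G 1 = adjB N *m G 0 + wave 0 by rewrite wave0 -Gd addrC subrK.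
rewrite G1 scalerDr -addrA; congr (_ + _).
pose a k := (prim u (s - k%:R))%:C *: wave k.
set X := \sum_(k < K) _; set Y := \sum_(k < K) _.
(* the sum telescopes; its last term vanishes because s <= K *)
have key : X - Y = (prim u s)%:C *: wave 0.
  rewrite /X /Y -sumrB (eq_bigr (fun k : 'I_K => a k - a k.+1)); last first.
    move=> k _; rewrite /a waveS -scalemxAr addr0; congr (_ *: _ - _ *: _).
      by congr ((prim u _)%:C); rewrite addrAC subrK.
    by congr ((prim u _)%:C); rewrite -natr1 opprD addrA addrAC.
  rewrite -(big_mkord xpredT (fun k => a k - a k.+1)).
  rewrite (@telescope_sumr_eq _ 0 K (fun k => - a k))// => [|k _]; last first.
    by rewrite opprK addrC.
  have UK : prim u (s - K%:R) = 0 by apply: (prim_past cu); rewrite subr_le0.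
  by rewrite opprK /a subr0 UK scale0r oppr0 add0r.
by rewrite -(subrK Y X) key scaleNr addrA addNr add0r.
Qed.

End Star.

End Waves.

(** * Free evolution of driven states *)

Section AbstractTaylor.
Variables (C : comNzRingType) (W : lmodType C) (L : W -> W).
Hypothesis linL : linear L.

Let LD x y : L (x + y) = L x + L y.
Proof. by have := linL 1 x y; rewrite !scale1r. Qed.

Let LZ a x : L (a *: x) = a *: L x.
Proof.
have L0 : L 0 = 0 by apply: (addrI (L 0)); rewrite -LD !addr0.
by have := linL a x 0; rewrite L0 !addr0.
Qed.

Let LN x : L (- x) = - L x.
Proof. by rewrite -scaleN1r LZ scaleN1r. Qed.

(** The expansion of S^3 (driven (a + r) u) to first order in r, over an
    abstract module: A and A' stand for driven states of the third primitive
    of u, G for one of the second, B for the input, D for S B, E for a term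
    that does not depend on time, and c for the final value of the first
    primitive. *)
Lemma taylor_combination (A A' G B D E : W) (b b' g h c : C) :
  L (L (L A + b *: B) + (g + c * h) *: D) + E
    - (L (L (L A' + b' *: B) + g *: D) + E)
    - h *: L (L (L G + g *: B) + c *: D) =
  L (L (L (A - A' - h *: G) + (b - b' - h * g) *: B)).
Proof.
have cancel (x y z : W) : x + z - (y + z) = x - y.
  by rewrite opprD addrACA subrr addr0.
rewrite !(LD, LN, LZ).
rewrite cancel opprD addrACA -scalerBl [g + _ - g]addrAC subrr add0r.
rewrite opprD addrACA -scalerBl !scalerDr !scalerA [h * c]mulrC cancel.
by rewrite opprD addrACA -scalerBl.
Qed.

End AbstractTaylor.

Section Orbit.
Context {R : realType} {p : R} (p1 : 1 <= p) {n m : nat} (N : network R n m).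
Notation RR := (measurableTypeR R).
Notation V := (Lp01 p1 m).
Variables (v : 'cV[R[i]]_n) (K : nat).
Variables (T : R -> V -> V) (l : R[i]) (S : V -> V).
Hypothesis T_C0 : C0_semigroup T.
Hypothesis TA : generator T = opA p1 N.
Hypothesis linS : linear S.
Hypothesis contS : continuous S.
Hypothesis SP : forall x y, opA p1 N (x, l *: x - y) <-> x = S y.
Notation AS := (AS l S).
Notation wave := (wave N v).
Notation driven := (driven p1 N v K).
Notation state := (state p1 N v K).
Notation input := (input p1 N v l).
Notation wave_bound := (wave_bound N v K).

Let cV : @geometrically_complete R V.
Proof. exact: vLspace_geometrically_complete. Qed.

Lemma generator_resolvent x : generator T (S x, AS x).
Proof. by rewrite TA; exact: (opA_S SP). Qed.

(** S x and S y determine x and y because A is single-valued, being a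
    generator. *)
Lemma resolvent_inj x y : S x = S y -> x = y.
Proof.
move=> xy; have := @generator_resolvent x; rewrite xy => h.
have := generator_uniq h (@generator_resolvent y).
by rewrite /AS xy => /addrI/oppr_inj.
Qed.

(** T t preserves the graph of A. *)
Lemma resolvent_semigroup t x : 0 <= t -> S (T t x) = T t (S x).
Proof.
move=> t0; have [TL _ _ _] := T_C0; have lT := (TL t t0).1.
have := generator_invariant T_C0 t0 (@generator_resolvent x).
by rewrite /AS (linB lT) (linZ lT) TA => /SP ->.
Qed.

Lemma AS_linear : linear AS.
Proof.
move=> a x y; rewrite /AS (linD linS) (linZ linS) scalerDr scalerBr.
by rewrite scalerA [l * a]mulrC -scalerA opprD addrACA.
Qed.

Lemma AS_S x : AS (S x) = S (AS x).
Proof. by rewrite /AS (linB linS) (linZ linS). Qed.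

Lemma resolvent_bounded : exists2 M : R, 0 <= M &
  forall x, nrm (S x) <= M * nrm x /\ nrm (AS x) <= M * nrm x.
Proof.
have [M M0 SM] := lin_continuous_bounded linS contS.
exists (M + (Rec `|l| * M + 1)).
  by rewrite !addr_ge0// mulr_ge0// Recnorm_ge0.
move=> x; split.
  apply: le_trans (SM x) _; rewrite ler_wpM2r ?nrm_ge0// lerDl.
  by rewrite addr_ge0// mulr_ge0// Recnorm_ge0.
apply: le_trans (nrmB _ _) _; rewrite nrmZ !mulrDl mul1r.
apply: ler_wpDl; first by rewrite mulr_ge0// nrm_ge0.
by rewrite lerD2r -mulrA ler_wpM2l// Recnorm_ge0.
Qed.

(** After time a the control is 0 and its first primitive U is a constant c.
    By resolvent_driven, S^3 (driven (a + r) u) is a combination of driven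
    states of the third primitive U3 and of fixed vectors with coefficients
    U3, U2 and c, where U3 has derivative U2 and U2 has the Lipschitz constant
    c. The expansion of the third primitive to second order therefore gives
    the bounds of solution_orbit, with z = A S^3 (driven (a + r) u). The
    injectivity of S removes the three resolvents. *)
Lemma driven_orbit u a r : control p u -> (forall x, a < x -> u x = 0) ->
  0 <= r -> a + r <= K%:R -> T r (driven a u) = driven (a + r) u.
Proof.
move=> cu ua r0 arK.
have cU := control_prim p1 cu; have cU2 := control_prim p1 cU.
have cU3 := control_prim p1 cU2.
set U := prim u in cU cU2 cU3; set U2 := prim U in cU2 cU3.
set U3 := prim U2 in cU3.
pose c := U a; have c0 : 0 <= c by exact: (prim_ge0 cu).
have Uc x : a <= x -> U x = c by move=> ax; exact: (prim_const ua).
have U_le x : U x <= c.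
  have [/Uc -> //|/ltW xa] := leP a x; exact: (prim_nd cu).
have U2_lip x y : x <= y -> 0 <= U2 y - U2 x <= c * (y - x).
  move=> xy; rewrite subr_ge0 (prim_nd cU)//=.
  by apply: (prim_diff_le cU) => // z _.
have U2_lin x y : a <= x -> x <= y -> U2 y - U2 x = c * (y - x).
  move=> ax xy; apply/eqP; rewrite eq_le; apply/andP; split.
    by have /andP[] := U2_lip x y xy.
  apply: (prim_diff_ge cU) => // z /andP[/ltW xz _].
  by rewrite Uc// (le_trans ax).
have U3_quad x y : x <= y -> 0 <= U3 y - U3 x - (y - x) * U2 x <= c * (y - x) ^+ 2.
  by move=> xy; apply: (second_order cU2) => // z /andP[/U2_lip].
have [M M0 MP] := resolvent_bounded.
pose D w s : V := driven (a + s) w.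
have aD w : control p w -> forall s, @amplitudes R p (fun k x => w (a + s - 1 - k%:R + x)).
  by move=> cw s; exact: driven_amplitudes.
have a2 := aD _ cU2; have a3 := aD _ cU3.
have rD w s : control p w -> s <= r ->
    S (D w s) = AS (D (prim w) s) + (prim w (a + s))%:C *: input.
  move=> cw sr; apply: resolvent_driven => //.
  by apply: le_trans arK; rewrite lerD2l.
have SSE s : 0 <= s -> s <= r -> S (S (D u s)) =
    AS (AS (D U2 s) + (U2 (a + s))%:C *: input) + c%:C *: S input.
  move=> s0 sr; rewrite rD// -/U (linD linS) (linZ linS) -AS_S rD// -/U2.
  by rewrite Uc// lerDl.
have SSSE s : 0 <= s -> s <= r -> S (S (S (D u s))) =
    AS (AS (AS (D U3 s) + (U3 (a + s))%:C *: input) + (U2 (a + s))%:C *: S input) +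
    c%:C *: S (S input).
  move=> s0 sr; rewrite SSE// (linD linS) (linZ linS) -AS_S (linD linS) (linZ linS).
  by rewrite -AS_S rD.
have LB := linB AS_linear; have LD := linD AS_linear; have LZ := linZ AS_linear.
pose C := M ^+ 3 * (wave_bound * c) + M ^+ 2 * (c * nrm input).
suff : S (S (S (D u r))) = T r (S (S (S (D u 0)))).
  rewrite -!resolvent_semigroup// => /resolvent_inj/resolvent_inj/resolvent_inj.
  by rewrite /D addr0.
apply: (@solution_orbit R V T cV T_C0 (fun s => S (S (S (D u s))))
  (fun s => AS (S (S (D u s)))) r C) => //.
- by move=> s _; exact: generator_resolvent.
- move=> x y x0 /andP[xy yr]; have xr := le_trans xy yr; have y0 := le_trans x0 xy.
  have axy : a + x <= a + y by rewrite lerD2l.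
  pose w k s := U3 (a + y - 1 - k%:R + s) - U3 (a + x - 1 - k%:R + s)
    - (y - x) * U2 (a + x - 1 - k%:R + s).
  have wE : state w = D U3 y - D U3 x - (y - x)%:C *: D U2 x.
    rewrite /w stateB; last 2 first.
    + exact: (amplitudesB p1 (a3 y) (a3 x)).
    + exact: (amplitudesZ p1 _ (a2 x)).
    by rewrite (stateZ _ _ _ _ _ (a2 x)) (stateB _ _ _ _ (a3 y) (a3 x)).
  have wL : @amplitudes R p w.
    exact: (amplitudesB p1 (amplitudesB p1 (a3 y) (a3 x)) (amplitudesZ p1 _ (a2 x))).
  have wB : nrm (state w) <= wave_bound * (c * (y - x) ^+ 2).
    apply: nrm_state_le1 => //; first by rewrite mulr_ge0// sqr_ge0.
    move=> k s _ _; rewrite /w.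
    have -> : y - x = (a + y - 1 - k%:R + s) - (a + x - 1 - k%:R + s) by ring.
    have /U3_quad/andP[] : a + x - 1 - k%:R + s <= a + y - 1 - k%:R + s by rewrite !lerD2r.
    by move=> h0; rewrite ger0_norm.
  pose b := U3 (a + y) - U3 (a + x) - (y - x) * U2 (a + x).
  have [b0 bB] : 0 <= b /\ b <= c * (y - x) ^+ 2.
    have /andP[] := U3_quad _ _ axy.
    by have -> : a + y - (a + x) = y - x by ring.
  have -> : S (S (S (D u y))) - S (S (S (D u x))) - (y - x)%:C *: AS (S (S (D u x))) =
      AS (AS (AS (state w) + b%:C *: input)).
    rewrite !SSSE// SSE// wE /b.
    have U2E : U2 (a + y) = U2 (a + x) + c * (y - x).
      have := U2_lin (a + x) (a + y); rewrite lerDl x0 => /(_ isT axy) h.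
      by rewrite -[LHS](subrK (U2 (a + x))) h [LHS]addrC; congr (_ + _ * _); ring.
    rewrite U2E !(rmorphB, rmorphD, rmorphM) /=.
    exact: (taylor_combination AS_linear).
  apply: le_trans (MP _).2 _; apply: le_trans (_ : M * (M * _) <= _).
    by rewrite ler_wpM2l//; exact: (MP _).2.
  apply: (@le_trans _ _ (M * (M * (M * (wave_bound * (c * (y - x) ^+ 2)) + c * (y - x) ^+ 2 * nrm input)))).
    rewrite !ler_wpM2l//; apply: le_trans (nrmD _ _) _; apply: lerD.
      by apply: le_trans (MP _).2 _; rewrite ler_wpM2l.
    by rewrite nrmZr ger0_norm// ler_wpM2r// nrm_ge0.
  by rewrite le_eqVlt; apply/orP; left; apply/eqP; rewrite /C; ring.
- move=> x y x0 /andP[xy yr]; have xr := le_trans xy yr; have y0 := le_trans x0 xy.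
  have axy : a + x <= a + y by rewrite lerD2l.
  pose w k s := U2 (a + y - 1 - k%:R + s) - U2 (a + x - 1 - k%:R + s).
  have wE : state w = D U2 y - D U2 x by exact: (stateB _ _ _ _ (a2 y) (a2 x)).
  have wL : @amplitudes R p w by exact: (amplitudesB p1 (a2 y) (a2 x)).
  have wB : nrm (state w) <= wave_bound * (c * (y - x)).
    apply: nrm_state_le1 => //; first by rewrite mulr_ge0// subr_ge0.
    move=> k s _ _; rewrite /w.
    have -> : y - x = (a + y - 1 - k%:R + s) - (a + x - 1 - k%:R + s) by ring.
    have /U2_lip/andP[] : a + x - 1 - k%:R + s <= a + y - 1 - k%:R + s by rewrite !lerD2r.
    by move=> h0; rewrite ger0_norm.
  pose b := U2 (a + y) - U2 (a + x).
  have [b0 bB] : 0 <= b /\ b <= c * (y - x).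
    have /andP[] := U2_lip _ _ axy.
    by have -> : a + y - (a + x) = y - x by ring.
  have -> : S (S (S (D u y))) - S (S (S (D u x))) = S (AS (AS (state w) + b%:C *: input)).
    rewrite -(linB linS) !SSE// wE /b opprD addrACA subrr addr0 -LB; congr (S (AS _)).
    by rewrite opprD addrACA -LB rmorphB scalerBl.
  apply: le_trans (MP _).1 _; apply: le_trans (_ : M * (M * _) <= _).
    by rewrite ler_wpM2l//; exact: (MP _).2.
  apply: (@le_trans _ _ (M * (M * (M * (wave_bound * (c * (y - x))) + c * (y - x) * nrm input)))).
    rewrite !ler_wpM2l//; apply: le_trans (nrmD _ _) _; apply: lerD.
      by apply: le_trans (MP _).2 _; rewrite ler_wpM2l.
    by rewrite nrmZr ger0_norm// ler_wpM2r// nrm_ge0.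
  by rewrite le_eqVlt; apply/orP; left; apply/eqP; rewrite /C; ring.
Qed.

End Orbit.

(** * The controllability map *)

Section Integral.
Context {R : realType} {p : R} (p1 : 1 <= p) {n m : nat} (N : network R n m).
Notation RR := (measurableTypeR R).
Notation V := (Lp01 p1 m).
Variables (v : 'cV[R[i]]_n) (K : nat).
Variables (T : R -> V -> V) (l : R[i]) (S : V -> V).
Hypothesis T_C0 : C0_semigroup T.
Hypothesis TA : generator T = opA p1 N.
Hypothesis linS : linear S.
Hypothesis contS : continuous S.
Hypothesis SP : forall x y, opA p1 N (x, l *: x - y) <-> x = S y.
Notation AS := (AS l S).
Notation driven := (driven p1 N v K).
Notation state := (state p1 N v K).
Notation input := (input p1 N v l).
Notation wave_bound := (wave_bound N v K).

Let cV : @geometrically_complete R V.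
Proof. exact: vLspace_geometrically_complete. Qed.

(** In resolvent_driven the primitive of the pulse vanishes before a, hence at
    time b it is present only in wave 0 and on the interval ]1 - (b - a), 1],
    where it is at most prim u b. *)
Lemma resolvent_pulse (M : R) u a b : (forall x, nrm (AS x) <= M * nrm x) -> 0 <= M ->
  control p u -> (forall x, ~~ (a < x <= b) -> u x = 0) ->
  a <= b -> b - a <= 1 -> b <= K%:R ->
  nrm (S (driven b u) - (prim u b)%:C *: input) <=
    M * (wave_bound * prim u b * (b - a) `^ p^-1).
Proof.
move=> ASM M0 cu uab ab ba1 bK.
have cU := control_prim p1 cu.
rewrite (resolvent_driven v linS SP cu) // addrK.
apply: le_trans (ASM _) _; rewrite ler_wpM2l//.
pose E : set RR := `]1 - (b - a), 1]%classic.
have mE : measurable E by exact: measurable_itvRR.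
have lE : fine (leb 1 E) = b - a.
  rewrite lebE (_ : _ `&` _ = E); last first.
    apply/seteqP; split=> x /=; first by case.
    move=> xE; split=> //; move: xE; rewrite /E /= !in_itv/= => /andP[xl ->].
    by rewrite andbT (le_trans _ (ltW xl))// subr_ge0.
  rewrite lebesgue_measure_itv/= lte_fin; case: ltP => [_|].
    by rewrite /=; ring.
  by rewrite lerBrDr gerDl => ba; apply/esym/eqP; rewrite eq_le ba subr_ge0.
rewrite -lE; apply: (nrm_state_le p1 N v (driven_amplitudes b cU) mE) => //.
  exact: (prim_ge0 cu).
move=> k s kK /andP[s0 s1]; rewrite ger0_norm ?(prim_ge0 cu)// indicE.
have up x : x <= a -> u x = 0 by move=> xa; apply: uab; rewrite negb_and -leNgt xa.
have [_|sE] := boolP (s \in E).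
  rewrite mulr1; apply: (prim_nd cu).
  by have : 0 <= k%:R :> R by []; move: s1; lra.
rewrite mulr0 (prim_eq0 up)//; move: sE; rewrite notin_setE /E/= in_itv/= s1 andbT.
move/negP; rewrite -leNgt => sl.
apply: le_trans (_ : b - 1 + s <= _); last by move: sl; lra.
by rewrite lerD2r gerBl.
Qed.

Lemma driven_sum (I : Type) (r : seq I) t (w : I -> RR -> R) :
  (forall i, control p (w i)) ->
  driven t (fun x => \sum_(i <- r) w i x) = \sum_(i <- r) driven t (w i).
Proof.
by move=> cw; apply: state_sum => i; exact: driven_amplitudes.
Qed.

(** The control is cut along the cells of [0, t]. The part emitted during a
    cell evolves freely after it by driven_orbit, and is seen by S as a
    multiple of the input by resolvent_pulse. The errors add up to at most a
    constant times (integral of u) h^(1/p), where h is the length of the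
    cells, so the Riemann sums converge. *)
Lemma input_integral t u : control p u -> (forall x, t < x -> u x = 0) ->
  0 <= t -> t <= K%:R ->
  exists (F : nat -> simple_map V (leb t)) G,
    approximates (fun s : RR => (u s)%:C *: T (t - s) input) (S (driven t u)) F G /\
    {ae leb t, forall x, G k x @[k --> \oo] --> 0}.
Proof.
move=> cu ut t0 tK; have [TL _ TD _] := T_C0.
have p0 : 0 < p by rewrite (lt_le_trans _ p1).
have [Mt Mt0 MtP] := C0_bounded cV T_C0 t.
have [M M0 MP] := resolvent_bounded l linS contS.
have mu : measurable_fun setT u by exact: control_meas cu.
have u0 x : 0 <= u x by exact: control_ge0 cu x.
have iu : intg (leb t) u.
  apply/intg_leb => //.
  apply: (@intg_le _ _ _ _ _ (fun x : RR => u x * (x <= t)%R%:R)).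
  - by apply: measurable_funM => //; exact: measurable_indic_itv.
  - move=> x; rewrite !normrM ler_wpM2l// indicE.
    have [/set_mem/=|_] := boolP (x \in _); last by rewrite normr0.
    by rewrite in_itv/= => /andP[_ ->].
  - exact: control_intg cu t.
pose h k := t / k.+1%:R : R.
have h0 k : 0 <= h k by rewrite divr_ge0.
have ht k : h k <= t by rewrite ler_pdivrMr// ler_peMr// ler1n.
have hlim : h k @[k --> \oo] --> 0.
  rewrite -[X in _ --> X](mulr0 t); apply: cvgMr.
  exact: cvg_harmonic.
pose D k := [set nrm (T r input - input) | r in [set r | 0 <= r <= h k]].
have D0 k : D k 0.
  exists 0; first by rewrite /= lexx h0.
  by case: T_C0 => _ -> _ _; rewrite subrr nrm0.
have Dub k : has_sup (D k).
  split; first by exists 0.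
  exists (Mt * nrm input + nrm input) => _ [r /andP[r0 rh] <-].
  apply: le_trans (nrmB _ _) _; rewrite lerD2r; apply: MtP.
  by rewrite r0 (le_trans rh).
pose m_ k := Mt * sup (D k).
have sup0 k : 0 <= sup (D k) by exact: (ub_le_sup (Dub k).2).
apply: (@riemann_approximates _ _ t u (fun s => T (t - s) input) m_) => //.
- apply/cvgrPdist_le => e e0.
  have e1 : 0 < e / (Mt + 1) by rewrite divr_gt0// ltr_wpDl.
  have [d d0 dP] := C0_continuous_at0 T_C0 input e1.
  have /cvgrPdist_lt/(_ _ d0) := hlim; apply: filterS => k.
  rewrite sub0r normrN ger0_norm// => hd.
  rewrite sub0r normrN ger0_norm ?mulr_ge0//.
  apply: (@le_trans _ _ ((Mt + 1) * (e / (Mt + 1)))).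
    apply: ler_pM => //; first by rewrite lerDl.
    apply: ge_sup; first by exists 0.
    move=> _ [r /andP[r0 rh] <-]; apply/ltW/dP.
    by rewrite r0 (le_lt_trans rh).
  by rewrite mulrCA divff ?mulr1// gt_eqF// ltr_wpDl.
- by move=> k; exact: mulr_ge0.
- move=> k.
  have key r s : 0 <= r -> r <= s -> s <= t -> s - r <= h k ->
      nrm (T (t - r) input - T (t - s) input) <= m_ k.
    move=> r0 rs st srh.
    have -> : t - r = (t - s) + (s - r) by ring.
    have ts0 : 0 <= t - s by rewrite subr_ge0.
    rewrite TD ?subr_ge0// -(linB (TL _ ts0).1).
    apply: le_trans (MtP _ _ _) _.
      by rewrite ts0 lerBlDr lerDl (le_trans r0).
    rewrite ler_wpM2l//; apply: (ub_le_sup (Dub k).2).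
    by exists (s - r) => //=; rewrite subr_ge0 rs.
  move=> r s /andP[r0 rt] /andP[s0 st]; have [rs|/ltW sr] := leP r s.
    by rewrite distrC ger0_norm ?subr_ge0// => ?; exact: key.
  by rewrite ger0_norm ?subr_ge0// nrmC => ?; exact: key.
- move=> e e0.
  pose I := \int[leb t]_x u x.
  have I0 : 0 <= I by exact: Int_ge0.
  pose B := Mt * (M * wave_bound) * I.
  have B0 : 0 <= B by rewrite !mulr_ge0// wave_bound_ge0.
  have B1 : 0 < e / (B + 1) by rewrite divr_gt0// ltr_wpDl.
  have [d d0 dP] : exists2 d : R, 0 < d & forall r : R, 0 <= r <= d -> r `^ p^-1 <= e / (B + 1).
    exists ((e / (B + 1)) `^ p); first exact: powR_gt0.
    move=> r /andP[r0 rd].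
    have <- : ((e / (B + 1)) `^ p) `^ p^-1 = e / (B + 1).
      by rewrite -powRrM divff ?gt_eqF// powRr1// ltW.
    by rewrite ge0_ler_powR// ?nnegrE ?powR_ge0// invr_ge0 ltW.
  have d1 : 0 < Num.min d 1 by rewrite lt_min d0 ltr01.
  have /cvgrPdist_lt/(_ _ d1)[k0 _ k0P] := hlim.
  exists k0 => k kk0; have := k0P k kk0; rewrite /= sub0r normrN ger0_norm// lt_min => /andP[/ltW hd /ltW h1].
  pose w (j : nat) (x : RR) := u x * \1_(cell t k j) x.
  have cw j : control p (w j).
    by apply: (control_indic p1 cu); exact: measurable_cell.
  have node_bounds (j : 'I_k.+1) : [/\ node t k j <= node t k j.+1,
      node t k j.+1 - node t k j = h k, 0 <= node t k j & node t k j.+1 <= t].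
    have dE : node t k j.+1 - node t k j = h k by rewrite nodeS addrAC subrr add0r.
    split=> //; last exact: (node_le t0 (ltn_ord j)).
      by rewrite -subr_ge0 dE.
    exact: node_ge0.
  have w0 j x : ~~ (node t k j < x <= node t k j.+1) -> w j x = 0.
    by move=> xj; rewrite /w indicE memNset ?mulr0// /cell/= in_itv/=; exact/negP.
  have c_prim (j : 'I_k.+1) : \int[leb t]_x w j x = prim (w j) (node t k j.+1).
    have [n1 n2 n3 n4] := node_bounds j.
    rewrite Int_leb; last exact: control_meas (cw j).
    apply: eq_Rintegral => x _; have [xj|/w0 ->] := boolP (node t k j < x <= node t k j.+1).
      have /andP[xl xr] := xj; rewrite xr indicE mem_set//= in_itv/=.
      by rewrite (le_trans n3 (ltW xl)) (le_trans xr).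
    by rewrite !mul0r.
  have drivenE : driven t u = \sum_(j < k.+1) driven t (w j).
    rewrite -driven_sum//; congr driven; apply/funext => x.
    rewrite -mulr_sumr sum_cells//.
    have [x0|x0] := leP x 0; first by rewrite (control_past cu)// mul0r.
    have [xt|tx] := leP x t; first by rewrite subr0 mulr1.
    by rewrite ut// mul0r.
  have sum_c : \sum_(j < k.+1) \int[leb t]_x w j x = I.
    rewrite -Int_sum => [|j _]; last by apply: intg_indic => //; exact: measurable_cell.
    apply: eq_Rintegral => x _; rewrite -mulr_sumr sum_cells//.
    have [x0|x0] := leP x 0; first by rewrite (control_past cu)// mul0r.
    have [xt|tx] := leP x t; first by rewrite subr0 mulr1.
    by rewrite ut// mul0r.
  rewrite drivenE (lin_sum linS) -sumrB.
  apply: le_trans (nrm_sum _ _ _) _.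
  apply: (@le_trans _ _ (\sum_(j < k.+1) Mt * (M * wave_bound) * (e / (B + 1)) *
     \int[leb t]_x w j x)).
    apply: ler_sum => j _; have [n1 n2 n3 n4] := node_bounds j.
    have tn : 0 <= t - node t k j.+1 by rewrite subr_ge0.
    have tE : t = node t k j.+1 + (t - node t k j.+1) by rewrite addrC subrK.
    have wn x : node t k j.+1 < x -> w j x = 0.
      by move=> xn; apply: w0; rewrite negb_and -!ltNge xn orbT.
    have := driven_orbit v T_C0 TA linS contS SP (cw j) wn tn.
    rewrite -tE => <- //.
    rewrite (resolvent_semigroup T_C0 TA SP)// -(linZ (TL _ tn).1) -(linB (TL _ tn).1).
    apply: le_trans (MtP _ _ _) _.
      by rewrite tn lerBlDr lerDl (le_trans n3).
    rewrite nrmC c_prim -!mulrA ler_wpM2l//.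
    apply: le_trans (resolvent_pulse (fun x => (MP x).2) M0 (cw j) (@w0 j) n1 _ _) _.
    + by rewrite n2.
    + exact: le_trans n4 tK.
    rewrite n2 ler_wpM2l// -mulrA ler_wpM2l ?wave_bound_ge0//.
    rewrite mulrC mulrA ler_wpM2r//; first exact: (prim_ge0 (cw j)).
    by apply: dP; rewrite h0.
  rewrite -mulr_sumr sum_c mulrAC -/B mulrA ler_pdivrMr ?ltr_wpDl//.
  by rewrite mulrC ler_wpM2l ?lerDl// ltW.
Qed.

End Integral.

(** * The reachable states *)

Section Reachability.
Context {R : realType} {p : R} (p1 : 1 <= p) {n m : nat} (N : network R n m).
Notation RR := (measurableTypeR R).
Notation V := (Lp01 p1 m).
Notation L01 := (Lfun (leb 1) p%:E).
Variable v : 'cV[R[i]]_n.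
Notation wave := (wave N v).

(** The representatives of nonnegative elements of L^p([0, t]) that are used
    as signals on the line. *)
Definition input_on (t : R) (u : RR -> R) : Prop :=
  [/\ measurable_fun setT u, forall x, 0 <= u x,
      forall x, ~~ (0 < x <= t) -> u x = 0 & u \in Lfun (leb t) p%:E].

Lemma input_on_control t u : input_on t u -> control p u.
Proof. by case; exact: Lp_control. Qed.

Section Semigroup.
Variables (T : R -> V -> V) (l : R[i]) (S : V -> V).
Hypothesis T_C0 : C0_semigroup T.
Hypothesis TA : generator T = opA p1 N.
Hypothesis linS : linear S.
Hypothesis contS : continuous S.
Hypothesis SP : forall x y, opA p1 N (x, l *: x - y) <-> x = S y.

Lemma opBlE t s (a : R) : s <= t ->
  T (t - s) (opBl p1 N v l a%:C) = a%:C *: T (t - s) (input p1 N v l).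
Proof.
move=> st; have [TL _ _ _] := T_C0.
have ts : 0 <= t - s by rewrite subr_ge0.
by rewrite /opBl /opB (Qinv_scale linS SP _ (rgPsi_v N v)) (linZ (TL _ ts).1).
Qed.

(** By input_integral and uniqueness of Bochner integrals, the integral in the
    controllability map is S (driven t u) for the positive part u of the given
    control, and l - A maps it to driven t u. *)
Lemma reachable_driven x : positive_reachability N v T l x <->
  exists (K : nat) t u, [/\ 0 <= t, t <= K%:R, input_on t u & x = driven p1 N v K t u].
Proof.
split=> [[t [u0 [t0 uL0 u0_ge0 [z zint zx]]]]|[K [t [u [t0 tK iu xE]]]]].
  pose u (s : RR) := Num.max (u0 s) 0 * \1_(`]0, t]) s.
  have iu : input_on t u.
    have mu : measurable_fun setT u.
      apply: measurable_funM; last exact: measurable_indic_itv.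
      by apply: measurable_maxr => //; exact: Lfun_meas uL0.
    split=> //.
    - by move=> s; rewrite mulr_ge0// ?le_max ?lexx ?orbT// indicE.
    - by move=> s st; rewrite /u indicE memNset ?mulr0//= in_itv/=; exact/negP.
    apply: (Lfun_le p1 mu uL0); apply: aeW => s; rewrite normrM.
    apply: le_trans (_ : `|Num.max (u0 s) 0| <= _).
      by rewrite ler_piMr// indic_bounded.
    by case: (leP (u0 s) 0) => _; rewrite ?normr0.
  have cu := input_on_control iu; have [mu u_ge0 ut uL] := iu.
  pose K := (Num.truncn t).+1; have tK : t <= K%:R by rewrite ltW// truncnS_gt.
  exists K, t, u; split=> //.
  have ut' s : t < s -> u s = 0.
    by move=> ts; apply: ut; rewrite negb_and -!ltNge ts orbT.
  have [F [G [FG _]]] := input_integral v T_C0 TA linS contS SP cu ut' t0 tK.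
  have zE : S (driven p1 N v K t u) = z.
    apply: (approximates_unique (leb_fin t) FG _ zint).
    have h := @ae_leb R t; apply: (ae_imp2 h u0_ge0) => s st us.
    have [_ st'] := andP st; rewrite opBlE//; congr (_%:C *: _).
    by rewrite /u max_l// indicE mem_set ?mulr1//= in_itv/= st.
  have /SP := zx; rewrite -zE.
  by move/(resolvent_inj TA SP).
have cu := input_on_control iu; have [mu u_ge0 ut uL] := iu.
have ut' s : t < s -> u s = 0.
  by move=> ts; apply: ut; rewrite negb_and -!ltNge ts orbT.
exists t, u; split=> //; first exact: aeW.
exists (S x); last exact/SP.
have [F [G [[FG1 FG2 FG3 FG4] G0]]] := input_integral v T_C0 TA linS contS SP cu ut' t0 tK.
rewrite xE; apply: (@approximates_bochner _ _ _ _ _ _ _ F G) => //; split=> //.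
have h := @ae_leb R t; apply: (ae_imp2 h FG2) => s st FGs k.
have [_ st'] := andP st; rewrite opBlE//.
Qed.

End Semigroup.

(** A convex combination may use the same wave several times; the coefficients
    are collected wave by wave. The bound K0 is left open, so that finitely
    many elements can be expanded over the same waves. *)
Lemma wave_hull c : convex_hull [set wave k | k in [set: nat]] c ->
  exists (b : nat -> R) (K0 : nat), (forall k, 0 <= b k) /\
    forall K, (K0 <= K)%N -> c = \sum_(k < K) (b k)%:C *: wave k.
Proof.
move=> [q [a [c' [a0 _ c'w ->]]]].
have /choice[f fE] : forall j, exists k, wave k = c' j.
  by move=> j; have [k _ <-] := c'w j; exists k.
exists (fun k => \sum_j a j * (f j == k)%:R), (\max_j f j).+1; split.
  by move=> k; apply: sumr_ge0 => j _; rewrite mulr_ge0.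
move=> K fK; under [RHS]eq_bigr do rewrite rmorph_sum/= scaler_suml.
rewrite exchange_big/=; apply: eq_bigr => j _.
have jK : (f j < K)%N by apply: leq_trans fK; rewrite ltnS leq_bigmax.
rewrite (bigD1 (Ordinal jK))//= eqxx mulr1 fE big1 ?addr0// => k kj.
have -> : (f j == k) = false.
  by apply/negbTE; apply: contra kj => /eqP fjk; apply/eqP/val_inj.
by rewrite mulr0 scale0r.
Qed.

Lemma hull_wave k : convex_hull [set wave k | k in [set: nat]] (wave k).
Proof.
exists 1%N, (fun=> 1), (fun=> wave k); rewrite !big_ord1 scale1r.
by split=> // _; exists k.
Qed.

(** A cone generated by a convex hull is generated by the vertices: the sum of
    f_j tensor c_j is regrouped by waves. Coefficient functions that are
    nonnegative almost everywhere are replaced by their positive parts. *)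
Lemma tensor_state x :
  positive_tensor p1 (convex_hull [set wave k | k in [set: nat]]) x <->
  exists (K : nat) (a : nat -> RR -> R),
    [/\ amplitudes (p:=p) a, forall k s, 0 <= a k s & x = state p1 N v K a].
Proof.
split=> [[q [f [c [fL f0 cw xE]]]]|[K [a [aL a0 ->]]]].
  have /choice[b] : forall j, exists b : nat -> R, exists K0 : nat, (forall k, 0 <= b k) /\
    forall K, (K0 <= K)%N -> c j = \sum_(k < K) (b k)%:C *: wave k.
    by move=> j; exact: wave_hull.
  move=> /choice[K0 bP].
  pose K := \max_j K0 j; pose g j (s : RR) := Num.max (f j s) 0.
  have gL j : g j \in L01.
    apply: (Lfun_le p1 _ (fL j)).
      by apply: measurable_maxr => //; exact: Lfun_meas (fL j).
    by apply: aeW => s; rewrite /g; case: (leP (f j s) 0) => _; rewrite ?normr0.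
  pose a k (s : RR) := \sum_j b j k * g j s.
  have aL : amplitudes (p:=p) a.
    by move=> k; apply: (Lfun_sum p1) => j _; exact: (LfunZ p1).
  exists K, a; split=> //.
    move=> k s; apply: sumr_ge0 => j _; rewrite mulr_ge0 ?(bP j).1//.
    by rewrite le_max lexx orbT.
  apply: cls_ext; first exact: state_in.
  have fg : {ae leb 1, forall s, forall j, f j s = g j s}.
    apply: filter_forall => j; apply: (ae_imp (f0 j)) => s fs.
    by rewrite /g max_l.
  apply: (ae_imp2 fg xE) => s fgs xs; rewrite xs// /a.
  under [RHS]eq_bigr do rewrite rmorph_sum/= scaler_suml.
  rewrite exchange_big/=; apply: eq_bigr => j _.
  have jK : (K0 j <= K)%N by exact: leq_bigmax.
  rewrite {1}((bP j).2 K jK) scaler_sumr; apply: eq_bigr => k _.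
  by rewrite fgs scalerA rmorphM mulrC.
exists K, (fun j => a j), (fun j => wave j); split=> //.
- by move=> j; exact: aeW.
- by move=> j; exact: hull_wave.
- have h := clsE (state_in p1 N v K aL).
  by apply: (ae_imp h) => s hs _.
Qed.

Lemma driven_state K t u : input_on t u ->
  exists a, [/\ amplitudes (p:=p) a, forall k s, 0 <= a k s &
    driven p1 N v K t u = state p1 N v K a].
Proof.
move=> iu; have cu := input_on_control iu.
exists (fun k x => u (t - 1 - k%:R + x)); split=> //.
  exact: driven_amplitudes.
by move=> k s; exact: (control_ge0 cu).
Qed.

(** At time K, wave k has entered the network during the time interval from K
    - 1 - k to K - k. Emitting the amplitude a k then, for every k < K, gives
    the prescribed state; the intervals do not overlap. *)
Lemma state_driven K a : amplitudes (p:=p) a -> (forall k s, 0 <= a k s) ->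
  exists u, input_on K%:R u /\ state p1 N v K a = driven p1 N v K K%:R u.
Proof.
move=> aL a0.
pose g k (s : RR) := a k s * \1_(`]0, 1]) s.
have I0 (s : RR) : 0 <= \1_(`]0, 1]) s :> R by rewrite indicE.
have mg k : measurable_fun setT (g k).
  by apply: measurable_funM; [exact: Lfun_meas (aL k)|exact: measurable_indic_itv].
have g0 k s : 0 <= g k s by rewrite mulr_ge0.
have gz k s : ~~ (0 < s <= 1) -> g k s = 0.
  by move=> s01; rewrite /g indicE memNset ?mulr0//= in_itv/=; exact/negP.
have ga k s : 0 < s <= 1 -> g k s = a k s.
  by move=> s01; rewrite /g indicE mem_set ?mulr1//= in_itv/=.
have gL k : g k \in L01.
  apply: (Lfun_le p1 (mg k) (aL k)); apply: aeW => s.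
  by rewrite normrM ler_piMr// indic_bounded.
(* cut off outside ]0, 1], so that the time intervals are disjoint *)
pose u (r : RR) := \sum_(k < K) g k (k%:R + 1 - K%:R + r).
have iu : input_on K%:R u.
  split.
  - by apply: measurable_sum => k; exact: measurable_comp_shift (mg k).
  - by move=> x; apply: sumr_ge0.
  - move=> x xK; apply: big1 => k _; apply: gz; apply: contra xK => /andP[h1 h2].
    have kK : (k%:R + 1 <= K%:R :> R) by rewrite natr1 ler_nat.
    have k0 : 0 <= k%:R :> R by [].
    by apply/andP; split; move: h1 h2; lra.
  - apply: (Lfun_sum p1) => k _.
    exact: (Lfun_shift p1 _ _ (mg k) (g0 k) (gz k) (gL k)).
exists u; split=> //.
have cu := input_on_control iu.
apply: eq_state => //; first exact: driven_amplitudes.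
move=> k s kK s01; rewrite /u (bigD1 (Ordinal kK))//= big1 => [|j jk].
  rewrite addr0 -(ga k s s01); congr g; ring.
apply: gz; apply: contra jk => /andP[h1 h2]; apply/eqP/val_inj => /=.
have /andP[s0 s1] := s01.
have jk1 : (j%:R < k%:R + 1 :> R) by move: h1 h2; lra.
have kj1 : (k%:R < j%:R + 1 :> R) by move: h1 h2; lra.
move: jk1 kj1; rewrite !natr1 !ltr_nat !ltnS => jk1 kj1.
by apply/eqP; rewrite eqn_leq jk1.
Qed.

Lemma hull_waves_image : convex_hull [set wave k | k in [set: nat]] =
  [set Psi N *m c | c in convex_hull [set adjA N ^+ k *m v | k in [set: nat]]].
Proof.
have waveE k : wave k = Psi N *m (adjA N ^+ k *m v).
  by rewrite /wave !mulmxA Psi_adjA_exp.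
apply/seteqP; split=> c.
  move=> [q [a [c' [a0 a1 c'w ->]]]].
  have /choice[f fE] : forall j, exists k, wave k = c' j.
    by move=> j; have [k _ <-] := c'w j; exists k.
  exists (\sum_j (a j)%:C *: (adjA N ^+ f j *m v)).
    by exists q, a, (fun j => adjA N ^+ f j *m v); split=> // j; exists (f j).
  rewrite mulmx_sumr; apply: eq_bigr => j _.
  by rewrite -scalemxAr -waveE fE.
move=> [_ [q [a [c' [a0 a1 c'w ->]]]] <-].
exists q, a, (fun j => Psi N *m c' j); split=> //.
  by move=> j; have [k _ <-] := c'w j; exists k => //; rewrite waveE.
by rewrite mulmx_sumr; apply: eq_bigr => j _; rewrite -scalemxAr.
Qed.

End Reachability.

Theorem corollary5p10 (R : realType) (p : R) (p1 : 1 <= p) (n m : nat)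
    (N : network R n m) (i : 'I_n)
    (T : R -> Lp01 p1 m -> Lp01 p1 m) (l : R[i]) :
  let v : 'cV[R[i]]_n := delta_mx i 0 in
  generates (opA p1 N) T ->
  resolvent_set (opA p1 N) l ->
  positive_reachability N v T l =
    positive_tensor p1
      (convex_hull [set adjB N ^+ k *m (Psi N *m v) | k in [set: nat]]) /\
  positive_tensor p1
      (convex_hull [set adjB N ^+ k *m (Psi N *m v) | k in [set: nat]]) =
    positive_tensor p1
      [set Psi N *m c | c in
         convex_hull [set adjA N ^+ k *m v | k in [set: nat]]].
Proof.
move=> v [T_C0 TA] [S [linS contS] SP]; split; last first.
  by congr positive_tensor; exact: hull_waves_image.
apply/seteqP; split=> x.
  move/(reachable_driven v T_C0 TA linS contS SP) => [K [t [u [t0 tK iu ->]]]].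
  have [a [aL a0 ->]] := driven_state p1 N v K iu.
  by apply/tensor_state; exists K, a.
move/tensor_state => [K [a [aL a0 ->]]].
have [u [iu ->]] := state_driven p1 N v K aL a0.
apply/(reachable_driven v T_C0 TA linS contS SP).
by exists K, K%:R, u.
Qed.
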